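(* The set $\{A\in\mathbf{K}([0,1]) : A \text{ is a Salem set}\}$ is $\boldsymbol\Pi^0_3$-complete.
   Context: $\mathbf{K}([0,1])$ is the space of compact subsets of $[0,1]$ (including $\emptyset$) with the Vietoris topology, i.e. the topology generated by the sets $\{F : F\cap C=\emptyset\}$ ($C$ closed) and $\{F: F\cap U\neq\emptyset\}$ ($U$ open); it is Polish. For $A\subset\mathbb{R}$, the Hausdorff dimension is $\dim_{\mathcal H}(A)=\sup\{s\ge 0:\mathcal H^s(A)>0\}$, where $\mathcal H^s$ is $s$-dimensional Hausdorff measure. $\mathbb{P}(A)$ denotes the set of Borel probability measures on $\mathbb{R}$ with support included in $A$; $\widehat\mu(\xi)=\int e^{-i\xi x}\,d\mu(x)$. The Fourier dimension is $\dim_{\mathrm F}(A)=\sup\{s\in[0,1] : (\exists\mu\in\mathbb{P}(A))(\exists c>0)(\forall x\in\mathbb{R}, x\ne 0)\ |\widehat\mu(x)|\le c|x|^{-s/2}\}$. Convention: $\sup\emptyset=0$ in both definitions. $A$ is a Salem set if $\dim_{\mathcal H}(A)=\dim_{\mathrm F}(A)$. Borel hierarchy: $\boldsymbol\Sigma^0_1$ are the open sets, $\boldsymbol\Pi^0_1$ the closed sets; $\boldsymbol\Sigma^0_\xi$ sets ($\xi>1$) are countable unions of sets each in some $\boldsymbol\Pi^0_{\eta}$ with $\eta<\xi$; $\boldsymbol\Pi^0_\xi$ sets are complements of $\boldsymbol\Sigma^0_\xi$ sets. For $A\subset X$, $B\subset Y$ write $A\le_W B$ if there is a continuous $f:X\to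 Y$ with $x\in A\iff f(x)\in B$. For $Y$ Polish, $B\subset Y$ is $\boldsymbol\Gamma$-hard if $A\le_W B$ for every $A\in\boldsymbol\Gamma(X)$ and every Polish $X$ having a basis of clopen sets; it is $\boldsymbol\Gamma$-complete if it is $\boldsymbol\Gamma$-hard and $B\in\boldsymbol\Gamma(Y)$. *)

(* Defs.v *)
From HB Require Import structures.
From mathcomp Require Import all_boot all_order all_algebra.
From mathcomp Require Import all_classical all_reals all_analysis.
From mathcomp Require Import complex.

Set Implicit Arguments.
Unset Strict Implicit.
Unset Printing Implicit Defensive.

Import Order.TTheory GRing.Theory Num.Theory.
Import numFieldNormedType.Exports.

Local Open Scope classical_set_scope.
Local Open Scope ring_scope.

Record compacts (X : topologicalType) := Compacts {
  compacts_set :> set X ;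
  compacts_compact : compact compacts_set }.

HB.instance Definition _ (X : topologicalType) := gen_eqMixin (compacts X).
HB.instance Definition _ (X : topologicalType) := gen_choiceMixin (compacts X).

Definition vietoris_subbase (X : topologicalType) : set (set (compacts X)) :=
  [set [set F : compacts X | F `&` C = set0] | C in closed] `|`
  [set [set F : compacts X | F `&` U !=set0] | U in open].

HB.instance Definition _ (X : topologicalType) :=
  @isSubBaseTopological.Build (compacts X)
    (set (compacts X)) (@vietoris_subbase X) id.

Section hausdorff_dimension.
Context {R : realType}.
Local Open Scope ereal_scope.

(* The diameter of set0 is -oo, which is harmless: see [diam_powR]. *)
Definition diam (U : set R) : \bar R :=
  ereal_sup [set `|x - y|%:E | x in U & y in U].

(* Empty members of a cover contribute 0 for every s; without the case split
   they would contribute 1 when s = 0. *)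
Definition diam_powR (s : R) (U : set R) : \bar R :=
  if U == set0 then 0 else poweR (diam U) s.

Definition hausdorff_premeasure (s delta : R) (A : set R) : \bar R :=
  ereal_inf [set \sum_(k <oo) diam_powR s (U k) | U in
    [set U : (set R)^nat |
      A `<=` \bigcup_k U k /\ forall k, diam (U k) <= delta%:E]].

Definition hausdorff_measure (s : R) (A : set R) : \bar R :=
  ereal_sup [set hausdorff_premeasure s delta A |
    delta in [set delta : R | (0 < delta)%R]].

(* [sup] is real-valued with [sup set0 = 0], which is the convention wanted
   here; the set is always bounded above, as H^s vanishes on the line for
   s > 1. *)
Definition hausdorff_dim (A : set R) : R :=
  sup [set s : R | (0 <= s)%R /\ 0 < hausdorff_measure s A].

End hausdorff_dimension.

Section fourier_dimension.
Context {R : realType}.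

Definition msupport (mu : probability (measurableTypeR R) R) : set R :=
  [set x | forall U : set R, open U -> U x -> (0 < mu U)%E].

(* e^(it) *)
Definition expi (t : R) : R[i] := (cos t +i* sin t)%C.

Definition complex_integral (mu : probability (measurableTypeR R) R)
    (f : R -> R[i]) : R[i] :=
  ((\int[mu]_x complex.Re (f x)) +i* (\int[mu]_x complex.Im (f x)))%C.

Definition fourier (mu : probability (measurableTypeR R) R) (xi : R) : R[i] :=
  complex_integral mu (fun x => expi (- (xi * x))).

(* The modulus of z : R[i] lives in R[i] (with zero imaginary part), where the
   order is partial; hence the embedding %:C of the bound. *)
Definition fourier_dim (A : set R) : R :=
  sup [set s : R | 0 <= s <= 1 /\
    exists mu : probability (measurableTypeR R) R, msupport mu `<=` A /\
    exists c : R, 0 < c /\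
    forall x : R, x != 0 ->
      `|fourier mu x| <= ((c * `|x| `^ (- (s / 2)))%:C)%C].

Definition salem (A : set R) := hausdorff_dim A = fourier_dim A.

End fourier_dimension.

(* The finite levels of the Borel hierarchy. There is no level 0 ([Sigma0 0 A]
   never holds), so below a level n > 1 the levels used are 1, ..., n - 1. *)
Inductive Sigma0 (X : topologicalType) : nat -> set X -> Prop :=
| Sigma0_open (A : set X) : open A -> Sigma0 1 A
| Sigma0_bigcup (n : nat) (m : nat -> nat) (F : nat -> set X) :
    (1 < n)%N -> (forall i, (m i < n)%N) ->
    (forall i, Sigma0 (m i) (~` F i)) ->
    Sigma0 n (\bigcup_i F i).

Definition pointclass := forall X : topologicalType, set X -> Prop.

Definition Pi0 (n : nat) : pointclass := fun X A => Sigma0 n (~` A).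

Definition wadge_le (X Y : topologicalType) (A : set X) (B : set Y) :=
  exists2 f : X -> Y, continuous f & forall x, A x <-> B (f x).

Definition polish (R : realType) (X : topologicalType) :=
  (exists2 D : set X, countable D & dense D) /\
  exists d : X -> X -> R,
    [/\ forall x y, d x y = 0 <-> x = y,
        forall x y, d x y = d y x,
        forall x y z, d x z <= d x y + d y z,
        forall x, nbhs x = nbhs_ball_ (fun y e => [set z | d y z < e]) x &
        forall u : nat -> X,
          (forall e : R, 0 < e -> \forall m & n \near \oo, d (u m) (u n) < e) ->
          exists x : X, u @ \oo --> x].

(* The library's [zero_dimensional] (points are separated by clopen sets) is
   weaker in general. *)
Definition clopen_basis (X : topologicalType) :=
  exists2 B : set (set X), basis B & B `<=` clopen.

Definition hard (R : realType) (Gamma : pointclass) (Y : topologicalType)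
    (B : set Y) :=
  forall X : topologicalType, polish R X -> clopen_basis X ->
  forall A : set X, Gamma X A -> wadge_le A B.

Definition complete (R : realType) (Gamma : pointclass) (Y : topologicalType)
    (B : set Y) :=
  hard R Gamma B /\ Gamma Y B.

(* Main.v *)
Require Import Defs.
From HB Require Import structures.
From mathcomp Require Import all_boot all_order all_algebra.
From mathcomp Require Import all_classical all_reals all_analysis.
From mathcomp Require Import finmap complex measurable_realfun.
From mathcomp Require Import zify ring lra.
Import Order.TTheory GRing.Theory Num.Theory.
Import numFieldNormedType.Exports.

Set Implicit Arguments.
Unset Strict Implicit.
Unset Printing Implicit Defensive.

Local Open Scope classical_set_scope.
Local Open Scope ring_scope.

(** Why the Salem sets form a Pi03-complete set.

    Membership ([Pi03_salem]). For every p >= 0 the sets {dim_H > p} and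
    {dim_F > p} are F_sigma in K([0,1]). Indeed dim_H F > p if and only if, for
    some rational q > p and some e > 0, every finite cover of F by open
    intervals has q-dimensional content at least e ([hausdorff_dim_gtP]); for
    fixed q and e this is a closed condition on F, because being covered by
    given open intervals is an open one. Likewise dim_F F > p if and only if,
    for some rational q > p and some c, the set F carries a probability measure
    whose transform is bounded by c|x|^(-q/2) ([fourier_dim_gtP]); for fixed q
    and c this is closed by weak compactness of the probability measures on
    [0,1] ([helly_selection], [closed_fourier_decay]). The two dimensions
    differ exactly when a rational p satisfies dim_H <= p < dim_F or
    dim_F <= p < dim_H, so that {dim_H <> dim_F} is a countable union of
    intersections of an F_sigma with a G_delta, hence Sigma03.

    Hardness. In a zero-dimensional Polish space X, a Pi03 set A is the set of
    the x for which r_j(x) tends to infinity, for suitable locally constant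
    functions r_j : X -> nat ([Pi03_limit]). It remains to code a sequence r
    continuously by a compact set which is Salem exactly when r tends to
    infinity. The code is the closure of [block_set n d], the set of the y in
    [0,1) such that, for every j, the binary digits of y at the positions
    n_j + 1, ..., n_j + d_j are not all zero, where n_j = 2^(j+3) and
    d_j = n_j - floor (n_j / 2^(r_j + 1)). Changing d_j for j >= J moves points
    by at most 2^(-n_J), whence the continuity in r
    ([block_compact_continuous]). The j-th condition removes 2^n_j intervals of
    total length at most 2^(-d_j), so that Lebesgue measure at least 3/4 remains
    and the Hausdorff dimension is 1. The Fourier dimension is decided by the
    ratios d_j / n_j:

    - If d_j / n_j tends to 1, then normalized Lebesgue measure on [block_set]
      witnesses dimension 1 ([block_fourier_dim_ge]). The intervals removed at
      step j contribute to the transform at x at most their total length 2^(-d_j)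
      and at most 2/|x| each, hence at most
      min(2^(-d_j), 2^n_j * 2/|x|) <= 2^(n_j t - d_j (1-t)) (2/|x|)^t
      for 0 <= t <= 1, and for t < 1/2 this is summable over j.

    - If d_j <= tau n_j for infinitely many j, with tau < 1, then the dimension
      is at most 2 tau / (1 + tau) < 1 ([block_fourier_dim_le]). The image on
      the circle of a measure on the code under y |-> 2^n_j y mod 1 gives no
      mass to an arc of length 2^(-d_j). A Turan-type inequality ([turan_gap])
      shows that this forces a fixed lower bound on the sum of the moduli of the
      Fourier coefficients at the frequencies 1, ..., 2^(d_j + 1) - 1. But decay
      of order s/2 bounds this sum by a constant multiple of
      2^(d_j (1 - s/2) - n_j s/2), which tends to 0 along these j as soon as
      s > 2 tau / (1 + tau). *)

(** * F_sigma sets and the Borel class Pi03 *)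

Section borel_classes.
Context {X : topologicalType}.

Definition Fsigma (A : set X) :=
  exists2 E : nat -> set X, (forall i, closed (E i)) & A = \bigcup_i E i.

Lemma Fsigma_bigcup (I : countType) (E : I -> set X) :
  (forall i, closed (E i)) -> Fsigma (\bigcup_i E i).
Proof.
move=> cE; exists (fun k => if choice.unpickle k is Some i then E i else set0).
  by move=> k; case: choice.unpickle => //; exact: closed0.
apply/seteqP; split=> [x [i _ Eix]|x [k _]].
  exists (choice.pickle i); first by [].
  by rewrite choice.pickleK.
by case: choice.unpickle => // i Eix; exists i.
Qed.

Lemma Fsigma_closed (A : set X) : closed A -> Fsigma A.
Proof.
move=> cA; exists (fun=> A) => //.
by apply/seteqP; split=> [x Ax|x [_ _]//]; exists 0%N.
Qed.

Lemma FsigmaU (A B : set X) : Fsigma A -> Fsigma B -> Fsigma (A `|` B).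
Proof.
move=> [E cE ->] [F cF ->].
have -> : \bigcup_i E i `|` \bigcup_i F i =
    \bigcup_(p in [set: bool * nat]) (if p.1 then E p.2 else F p.2).
  apply/seteqP; split=> [x [[i _ Ex]|[i _ Fx]]|x [[[] i] _ Ex]].
  - by exists (true, i).
  - by exists (false, i).
  - by left; exists i.
  - by right; exists i.
apply: (Fsigma_bigcup (E := fun p : bool * nat => if p.1 then E p.2 else F p.2)).
by move=> [[] i] /=.
Qed.

Lemma Fsigma_Sigma02 (A : set X) : Fsigma A -> Sigma0 2 A.
Proof.
move=> [E cE ->]; apply: (@Sigma0_bigcup _ 2 (fun=> 1%N)) => // i.
by apply: Sigma0_open; exact: closed_openC.
Qed.

(** Countable index types keep the later unions free of codings in nat. *)
Lemma Sigma03_bigcup (I : countType) (F : I -> set X) :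
  (forall i, Fsigma (~` F i)) -> Sigma0 3 (\bigcup_i F i).
Proof.
move=> FE; pose G k := if @choice.unpickle I k is Some i then F i else set0.
have -> : \bigcup_i F i = \bigcup_k G k.
  apply/seteqP; split=> [x [i _ Fx]|x [k _]].
    exists (choice.pickle i); first by [].
    by rewrite /G choice.pickleK.
  by rewrite /G; case: choice.unpickle => // i Fx; exists i.
apply: (@Sigma0_bigcup _ 3 (fun=> 2%N)) => // k; apply: Fsigma_Sigma02.
rewrite /G; case: choice.unpickle => [i|]; first exact: FE.
by apply: Fsigma_closed; rewrite setC0; exact: closedT.
Qed.

(** If u x <> v x, a rational p separates the two values: v x <= p < u x or
    u x <= p < v x. Each of these conditions is the intersection of an F_sigma
    set with the complement of one; writing the F_sigma part as a union of closed
    sets leaves countably many pieces whose complements are F_sigma, because open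
    sets are. *)
Lemma Pi03_eq (R : realType) (u v : X -> R) :
  (forall O : set X, open O -> Fsigma O) ->
  (forall x, 0 <= u x) -> (forall x, 0 <= v x) ->
  (forall p : R, 0 <= p -> Fsigma [set x | p < u x]) ->
  (forall p : R, 0 <= p -> Fsigma [set x | p < v x]) ->
  Pi0 3 [set x | u x = v x].
Proof.
move=> openF u0 v0 uF vF; rewrite /Pi0.
suff half (w z : X -> R) : (forall p : R, 0 <= p -> Fsigma [set x | p < w x]) ->
    (forall p : R, 0 <= p -> Fsigma [set x | p < z x]) ->
    exists2 F : rat * nat -> set X, (forall i, Fsigma (~` F i)) &
      \bigcup_i F i = [set x | exists2 p : rat, 0 <= ratr p :> R &
                          z x <= ratr p /\ ratr p < w x].
  have [F cF FE] := half u v uF vF; have [G cG GE] := half v u vF uF.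
  have -> : ~` [set x | u x = v x] =
      \bigcup_(k in [set: bool * (rat * nat)]) (if k.1 then F k.2 else G k.2).
    have between (a b : R) : 0 <= a -> a < b ->
        exists2 p : rat, 0 <= ratr p :> R & a <= ratr p /\ ratr p < b.
      move=> a0 ab; have [p] := rat_in_itvoo ab.
      by rewrite in_itv/= => /andP[ap pb]; exists p; [rewrite (le_trans a0)// ltW|rewrite ltW].
    apply/seteqP; split=> [x /= /eqP|x [[[] i] _ /= Fx] uv].
    - rewrite neq_lt => /orP[|] /between.
        move=> /(_ (u0 x)) vu; have : (\bigcup_i G i) x by rewrite GE.
        by move=> [i _ Gx]; exists (false, i).
      move=> /(_ (v0 x)) vu; have : (\bigcup_i F i) x by rewrite FE.
      by move=> [i _ Gx]; exists (true, i).
    - have : (\bigcup_i F i) x by exists i.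
      by rewrite FE => -[p _ []] /=; rewrite uv => /le_lt_trans h/h; rewrite ltxx.
    - have : (\bigcup_i G i) x by exists i.
      by rewrite GE => -[p _ []] /=; rewrite uv => /le_lt_trans h/h; rewrite ltxx.
  by apply: Sigma03_bigcup => -[[] i] /=.
move=> wF zF.
have /choice[E hE] : forall p : rat, exists E : nat -> set X, (forall i, closed (E i)) /\
    (0 <= ratr p :> R -> [set x | ratr p < w x] = \bigcup_i E i).
  move=> p; have [p0|p0] := boolP (0 <= ratr p :> R).
    by have [E cE EE] := wF _ p0; exists E.
  by exists (fun=> set0); split => // i; exact: closed0.
exists (fun k => if 0 <= ratr k.1 :> R then E k.1 k.2 `&` [set x | z x <= ratr k.1] else set0).
  move=> [p i] /=; case: ifPn => p0; last first.
    by rewrite setC0; apply: Fsigma_closed; exact: closedT.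
  rewrite setCI; apply: FsigmaU.
    by apply: openF; apply: closed_openC; exact: (hE p).1.
  rewrite (_ : ~` _ = [set x | ratr p < z x]); first exact: zF.
  apply/seteqP; split=> x /=; first by move=> /negP; rewrite -ltNge.
  by rewrite ltNge => /negP.
apply/seteqP; split=> [x [[p i] _] /=|x /= [p p0 [zp pw]]].
  case: ifPn => // p0 [Ex zx]; exists p => //; split=> //.
  have : (\bigcup_i E p i) x by exists i.
  by rewrite -(hE p).2.
have : (\bigcup_i E p i) x by rewrite -(hE p).2.
by move=> [i _ Ex]; exists (p, i) => //=; rewrite p0.
Qed.

End borel_classes.

(** * The Vietoris topology on the compact subsets of the unit interval *)

Lemma vietoris_open_subbase (X : topologicalType) (D : set (compacts X)) :
  vietoris_subbase D -> open D.
Proof.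
move=> sD; exists [set D]; last first.
  by rewrite predeqE => F; split=> [[_ -> //]|DF]; exists D.
move=> _ ->; exists [fset D]%fset; first by move=> E; rewrite inE => /eqP ->; apply/mem_set.
rewrite predeqE => F; split=> [/(_ D)|DF E /=]; first by apply; rewrite /= inE.
by rewrite inE => /eqP ->.
Qed.

(** The basis generated by the subbase, made explicit: finitely many
    subbasic conditions that hold at F imply membership in O. *)
Lemma vietoris_open_nbhs (X : topologicalType) (O : set (compacts X)) F :
  open O -> O F -> exists2 s : seq (set (compacts X)),
    (forall D, D \in s -> vietoris_subbase D /\ D F) &
    (forall G, (forall D, D \in s -> D G) -> O G).
Proof.
move=> [B sB <-] [b Bb bF].
have [s sub sb] := sB _ Bb.
exists s => [D Ds|G Gs].
  split; first exact: (set_mem (sub D Ds)).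
  by move: bF; rewrite -sb => /(_ D Ds).
have : b G by rewrite -sb => D /Gs.
by exists b.
Qed.

Section unit_interval_compacts.
Context {R : realType}.
Local Notation I01 := (set_type `[0 : R, 1 : R]).
Local Notation K01 := (compacts I01).
Implicit Types (F G : K01) (W C : set R).

(** The topology of the subtype is the initial one, for which this is the
    definition. *)
Lemma open_unit_interval (U : set I01) :
  open U -> exists2 W : set R, open W & set_val @^-1` W = U.
Proof. by []. Qed.

(** Compact subsets of the subtype [0,1] are handled through their images in
    R, where measures and dimensions live. *)
Definition trace F : set R := set_val @` F.

Lemma traceP F x : trace F x -> 0 <= x <= 1.
Proof. by case=> -[y yI] _ <-; move: (set_mem yI); rewrite /= in_itv. Qed.

Lemma compact_trace F : compact (trace F).
Proof.
apply: continuous_compact; last exact: compacts_compact.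
apply: continuous_subspaceT; exact: initial_continuous.
Qed.

Lemma open_meets W : open W -> open [set F | trace F `&` W !=set0].
Proof.
move=> oW; apply: vietoris_open_subbase; right.
exists (set_val @^-1` W); first by exists W.
rewrite predeqE => F; split=> [[y [Fy Wy]]|[_ [[y Fy <-] Wy]]].
  by exists (set_val y); split=> //; exists y.
by exists y.
Qed.

Lemma open_subset W : open W -> open [set F | trace F `<=` W].
Proof.
move=> oW; apply: vietoris_open_subbase; left.
exists (~` (set_val @^-1` W)).
  by apply: open_closedC; exists W.
rewrite predeqE => F; split=> [FW _ [y Fy <-]|FW].
  apply: contrapT => nW; have : (set0 : set I01) y by rewrite -FW.
  by [].
rewrite /= -subset0 => y [Fy]; apply; apply: FW.
by exists y.
Qed.

Lemma closed_subset C : closed C -> closed [set F | trace F `<=` C].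
Proof.
move=> cC; rewrite -openC; suff -> : ~` [set F | trace F `<=` C] =
    [set F | trace F `&` ~` C !=set0] by exact/open_meets/closed_openC.
rewrite predeqE => F; split=> [/= nFC|[x [Fx nCx]] FC]; last exact/nCx/FC.
apply: contrapT => FC; apply: nFC => x Fx; apply: contrapT => nCx.
by apply: FC; exists x.
Qed.

Lemma closed_meets C : closed C -> closed [set F | trace F `&` C !=set0].
Proof.
move=> cC; rewrite -openC; suff -> : ~` [set F | trace F `&` C !=set0] =
    [set F | trace F `<=` ~` C] by exact/open_subset/closed_openC.
rewrite predeqE => F; split=> [/= nFC x Fx Cx|FC [x [Fx Cx]]].
  by apply: nFC; exists x.
exact: (FC x).
Qed.

(** The sets A and B are at Hausdorff distance at most e. *)
Definition hausdorff_close (e : R) (A B : set R) :=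
  (forall x, A x -> exists2 y, B y & `|x - y| < e) /\
  (forall y, B y -> exists2 x, A x & `|x - y| < e).

(** By compactness, A keeps a positive distance from the complement of an
    open set around it. *)
Lemma compact_collar (A W : set R) : compact A -> open W -> A `<=` W ->
  exists2 e : R, 0 < e & forall x y, A x -> `|x - y| < e -> W y.
Proof.
move=> cA oW AW.
move/compact_near_coveringP : cA => /(_ R 0^'+
    (fun e x => forall y, `|x - y| < e -> W y) _) nc.
have : \forall e \near 0^'+, A `<=` (fun x => forall y, `|x - y| < e -> W y).
  apply: nc => x Ax.
  have /nbhs_ballP[d /= d0 dW] : nbhs x W by apply: open_nbhs_nbhs; split=> //; exact: AW.
  exists (ball x (d / 2), [set e | e < d / 2]) => /=.
    by split; [exact/nbhsx_ballx/divr_gt0|exact/nbhs_right_lt/divr_gt0].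
  move=> [z e] /= [xz ed] y zy; apply: dW; rewrite /ball/=.
  rewrite (le_lt_trans (ler_distD z _ _))// (splitr d) ltrD//.
  exact: lt_trans ed.
move=> [d /= d0 dA]; exists (d / 2); first exact: divr_gt0.
move=> x y Ax xy; apply: (dA (d / 2)) Ax _ xy; last exact: divr_gt0.
by rewrite /ball_/= sub0r normrN gtr0_norm ?divr_gt0// ltr_pdivrMr// ltr_pMr// ltr1n.
Qed.

(** Subbasic conditions are stable under small perturbations in the
    Hausdorff distance: those of the form F `&` C = set0 by [compact_collar], and
    those of the form F `&` U !=set0 because U contains a ball around a point of
    F. *)
Lemma vietoris_open_hausdorff (O : set K01) F : open O -> O F ->
  exists2 e : R, 0 < e & forall G, hausdorff_close e (trace F) (trace G) -> O G.
Proof.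
move=> oO OF; have [s sF sO] := vietoris_open_nbhs oO OF.
suff [e e0 es] : exists2 e : R, 0 < e & forall D G, D \in s ->
    hausdorff_close e (trace F) (trace G) -> D G.
  by exists e => // G FG; apply: sO => D Ds; apply: es.
elim: s sF {sO} => [|D s ih] sF; first by exists 1.
have [D' D's|d d0 ds] := ih; first by apply: sF; rewrite inE D's orbT.
suff [e e0 eD] : exists2 e : R, 0 < e & forall G,
    hausdorff_close e (trace F) (trace G) -> D G.
  exists (Num.min d e); first by rewrite lt_min d0.
  have lt_de x y : `|x - y| < Num.min d e -> `|x - y| < d /\ `|x - y| < e.
    by rewrite lt_min => /andP.
  move=> D' G; rewrite inE => /predU1P[->|D's] [h1 h2]; [apply: eD|apply: (ds _ _ D's)];
    split=> x => [/h1|/h2] [y Gy /lt_de[? ?]]; by exists y.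
have [[[U cU <- FU]|[W' oW' <-]]] := sF D (mem_head _ _).
  have /open_unit_interval[W oW WU] : open (~` U) by exact: closed_openC.
  have [|e e0 eW] := compact_collar (@compact_trace F) oW.
    move=> _ [y Fy <-]; have : (~` U) y.
      by move=> Uy; have : (set0 : set I01) y by rewrite -FU.
    by rewrite -WU.
  exists e => // G [_ FG]; rewrite /= -subset0 => y [Gy Uy].
  have [|x Fx xy] := FG (set_val y); first by exists y.
  have : (set_val @^-1` W) y by exact: eW Fx xy.
  by rewrite WU.
have /open_unit_interval[W oW <-] := oW' => -[y [Fy Uy]].
have /nbhs_ballP[e /= e0 eW] : nbhs (set_val y) W.
  exact: open_nbhs_nbhs.
exists e => // G [FG _].
have [|_ [z Gz <-] yz] := FG (set_val y); first by exists y.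
by exists z; split=> //; apply: eW.
Qed.

Lemma continuous_hausdorff (Y : topologicalType) (f : Y -> K01) :
  (forall y (e : R), 0 < e ->
     \forall z \near y, hausdorff_close e (trace (f y)) (trace (f z))) ->
  continuous f.
Proof.
move=> fh y O; rewrite nbhsE => -[P [oP Py] PO].
have [e e0 eP] := vietoris_open_hausdorff oP Py.
by apply: filterS (fh y e e0) => z /eP /PO.
Qed.

Let grid (n i : nat) : R := i%:R / n.+1%:R.
Let cell (n i : nat) : set R := `[grid n i, grid n i.+1].

(** K([0,1]) is metrizable, so its open sets are F_sigma. Concretely, O is
    the union of the closed cells that it contains, where a cell consists of the
    F which meet each of the finitely many grid intervals [i/(n+1), (i+1)/(n+1)],
    i in s, and which these intervals cover: two elements of a cell are
    Hausdorff-close. *)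
Lemma open_Fsigma (O : set K01) : open O -> Fsigma O.
Proof.
move=> oO.
pose W (p : nat * seq nat) : set K01 :=
  (\bigcap_(i in [set` p.2]) [set F | trace F `&` cell p.1 i !=set0]) `&`
  [set F | trace F `<=` \bigcup_(i in [set` p.2]) cell p.1 i].
have cell_closed n i : closed (cell n i) by exact: itv_closed.
have Wclosed p : closed (W p).
  apply: closedI.
    by apply: closed_bigI => i _; exact: closed_meets.
  by apply: closed_subset; apply: closed_bigcup => [|i _]; [exact: finite_seq|].
pose E i : set K01 := if @choice.unpickle (nat * seq nat)%type i is Some p then
              if `[< W p `<=` O >] then W p else set0 else set0.
exists E.
  move=> i; rewrite /E; case: choice.unpickle => [p|]; last exact: closed0.
  by case: ifP => _; [exact: Wclosed|exact: closed0].
rewrite predeqE => F; split=> [OF|[i _]]; last first.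
  by rewrite /E; case: choice.unpickle => // p; case: ifP => // /asboolP; apply.
have [e e0 eO] := vietoris_open_hausdorff oO OF.
(* A mesh 1/(n+1) below e; s lists the grid intervals that F meets. *)
pose n := Num.truncn e^-1.
have ne : n.+1%:R^-1 < e by rewrite invf_plt ?posrE// truncnS_gt.
pose s := [seq i <- iota 0 n.+2 | `[< trace F `&` cell n i !=set0 >]].
have cellP x : 0 <= x <= 1 -> exists2 i, (i < n.+2)%N & cell n i x.
  move=> /andP[x0 x1]; exists (Num.truncn (x * n.+1%:R)).
    rewrite truncn_lt_nat ?mulr_ge0// (@le_lt_trans _ _ n.+1%:R)//.
      by rewrite ler_piMl.
    by rewrite ltr_nat.
  rewrite /cell/= in_itv/= /grid ler_pdivrMr// ler_pdivlMr// truncn_le ?mulr_ge0//.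
  by rewrite ltW ?truncnS_gt.
have cell_small i x y : cell n i x -> cell n i y -> `|x - y| < e.
  have -> : cell n i = `[grid n i, grid n i + n.+1%:R^-1]%classic.
    by rewrite /cell {2}/grid -natr1 mulrDl mul1r.
  rewrite /= !in_itv/= => /andP[x1 x2] /andP[y1 y2].
  move: ne x1 x2 y1 y2; move: (grid n i) (_^-1) => a b.
  by move=> ne x1 x2 y1 y2; rewrite ltr_norml; apply/andP; split; lra.
have WF : W (n, s) F.
  split=> [i /=|x Fx]; first by rewrite mem_filter => /andP[/asboolP].
  have [i ni xi] := cellP x (traceP Fx).
  exists i => //=; rewrite mem_filter mem_iota/= ni andbT.
  by apply/asboolP; exists x.
exists (choice.pickle (n, s)) => //; rewrite /E choice.pickleK.
have -> : `[< W (n, s) `<=` O >]; last by [].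
apply/asboolP => G [GW sG]; apply: eO; split=> [x Fx|y Gy].
  have [i /= si xi] := WF.2 x Fx.
  have [y [Gy yi]] := GW i si.
  by exists y => //; exact: cell_small xi yi.
have [i /= si yi] := sG y Gy.
have [x [Fx xi]] := WF.1 i si.
by exists x => //; exact: cell_small xi yi.
Qed.

End unit_interval_compacts.

(** * Hausdorff dimension of compact sets by finite covers *)

Section hausdorff_dimension_compact.
Context {R : realType}.
Implicit Types (A U : set R) (s e p : R).

Lemma diam_ge0 U : U !=set0 -> (0 <= diam U)%E.
Proof.
by move=> [x Ux]; apply: ereal_sup_ubound; exists x => //; exists x => //; rewrite subrr normr0.
Qed.

Lemma diam_itv_oo (a b : R) : a < b -> (diam `]a, b[%classic <= (b - a)%:E)%E.
Proof.
move=> ab; apply: ge_ereal_sup => _ [x /= + [y /= + <-]].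
rewrite !in_itv/= lee_fin => /andP[ax xb] /andP[ay yb].
by rewrite ler_norml; apply/andP; split; lra.
Qed.

Lemma diam_powR_itv_oo (a b s : R) : 0 <= s -> a < b ->
  (diam_powR s `]a, b[%classic <= ((b - a) `^ s)%:E)%E.
Proof.
move=> s0 ab; rewrite /diam_powR; case: ifPn => [_|/set0P U0].
  by rewrite lee_fin powR_ge0.
have d0 := diam_ge0 U0.
have dab := diam_itv_oo ab.
rewrite -poweR_EFin gt0_ler_poweR ?in_itv/= ?leey ?andbT ?d0//.
by rewrite lee_fin subr_ge0 ltW.
Qed.

Lemma diam_powR_ge0 s U : (0 <= diam_powR s U)%E.
Proof. by rewrite /diam_powR; case: ifP => // _; exact: poweR_ge0. Qed.

(** For compact sets finite covers by open intervals suffice to compute the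
    dimension, and they make conditions on covers open in the Vietoris
    topology. *)
Definition finite_itv_cover n (a b : nat -> R) A :=
  (forall k, (k < n)%N -> a k < b k) /\ A `<=` \bigcup_(k < n) `]a k, b k[%classic.

(** The s-dimensional content of A with respect to finite covers is at least
    e. There is no bound on the lengths of the intervals: content and measure
    vanish simultaneously, and only the vanishing matters for the dimension. *)
Definition content_ge s e A := forall n a b, finite_itv_cover n a b A ->
  e <= \sum_(k < n) (b k - a k) `^ s.

Lemma hausdorff_premeasure_le_cover s delta A n a b : 0 <= s ->
  finite_itv_cover n a b A -> (forall k, (k < n)%N -> b k - a k <= delta) ->
  (hausdorff_premeasure s delta A <= (\sum_(k < n) (b k - a k) `^ s)%:E)%E.
Proof.
move=> s0 [ab Acov] abd; apply: ge_ereal_inf.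
pose U k := if (k < n)%N then `]a k, b k[%classic else set0 : set R.
exists (\sum_(k <oo) diam_powR s (U k))%E.
  exists U => //; split=> [x /Acov[k /= kn xk]|k].
    by exists k => //; rewrite /U kn.
  rewrite /U; case: ifPn => kn.
    by rewrite (le_trans (diam_itv_oo (ab _ kn)))// lee_fin abd.
  rewrite (_ : diam _ = -oo%E) ?leNye//.
  by rewrite -ereal_sup0; congr ereal_sup; apply/seteqP; split => // z [].
rewrite (nneseries_split 0 n); last by move=> k _; exact: diam_powR_ge0.
rewrite [X in (_ + X)%E]eseries0 ?adde0; last first.
  by move=> k nk _; rewrite /U ltnNge nk/= /diam_powR eqxx.
rewrite add0n big_mkord -sumEFin; apply: lee_sum => k _.
by rewrite /U ltn_ord; apply: diam_powR_itv_oo => //; exact: ab.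
Qed.

(** A positive s0-measure gives a positive s-content for s < s0: a cover
    with small s-sum has short intervals, hence is admissible for some
    premeasure, and its s0-sum is at most its s-sum. *)
Lemma content_ge_hausdorff s0 s A : 0 < s -> s < s0 ->
  (0 < hausdorff_measure s0 A)%E -> exists2 e, 0 < e & content_ge s e A.
Proof.
move=> s_gt0 ss0 /ereal_sup_gt[_ [delta /= delta0 <-] h0].
set h := hausdorff_premeasure _ _ _ in h0.
have [h1 h10 h1h] : exists2 h1 : R, 0 < h1 & (h1%:E <= h)%E.
  move: h0; case: h => [r|_|//]; last by exists 1 => //; rewrite leey.
  by rewrite lte_fin => r0; exists r.
(* A sum below delta^s and below 1 forces every interval to be shorter than
   delta and 1; a sum below h1 then contradicts the lower bound h1 on the
   s0-premeasure. *)
exists (Num.min (Num.min 1 (delta `^ s)) h1).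
  by rewrite !lt_min ltr01 h10 powR_gt0.
move=> n a b [ab Acov]; rewrite leNgt; apply/negP; rewrite !lt_min.
move=> /andP[/andP[sum1 sumd] sumh].
have term k : (k < n)%N -> (b k - a k) `^ s <= \sum_(k < n) (b k - a k) `^ s.
  move=> kn; rewrite (bigD1 (Ordinal kn))//= lerDl sumr_ge0// => i _.
  exact: powR_ge0.
have abd k : (k < n)%N -> b k - a k <= delta.
  move=> kn; rewrite leNgt; apply/negP => dk.
  have : delta `^ s <= (b k - a k) `^ s.
    by apply: ge0_ler_powR; rewrite ?nnegrE ?ltW// subr_gt0 ab.
  by move=> /le_trans /(_ (term k kn)); rewrite leNgt sumd.
have ab1 k : (k < n)%N -> b k - a k <= 1.
  move=> kn; rewrite leNgt; apply/negP => dk.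
  have : 1 `^ s <= (b k - a k) `^ s.
    by apply: ge0_ler_powR; rewrite ?nnegrE ?ltW// subr_gt0 ab.
  by rewrite powR1 => /le_trans /(_ (term k kn)); rewrite leNgt sum1.
have := @hausdorff_premeasure_le_cover s0 delta A n a b _ (conj ab Acov) abd.
move=> /(_ (ltW (lt_trans s_gt0 ss0))); rewrite -/h => hle.
suff : h1 < h1 by rewrite ltxx.
apply: le_lt_trans sumh; rewrite -lee_fin (le_trans h1h)// (le_trans hle)// lee_fin.
apply: ler_sum => k _; apply: ger_powR; last exact: ltW.
by rewrite subr_gt0 ab//= ab1.
Qed.

(** A countable cover by arbitrary sets is replaced by a finite cover by
    open intervals: each set of diameter r lies in an interval of length about
    4r, and compactness extracts a finite subcover. Sets of diameter 0 have no
    such interval; they get intervals whose contributions g k have sum at most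
    e/2. *)
Lemma countable_cover_content s e A (U : nat -> set R) : compact A -> 0 < s -> 0 < e ->
  content_ge s e A -> A `<=` \bigcup_k U k -> (forall k, (diam (U k) <= 1%:E)%E) ->
  ((e / 2 / 4 `^ s)%:E <= \sum_(k <oo) diam_powR s (U k))%E.
Proof.
move=> cA s0 e0 eA AU dU.
pose g k := e / 2 * (1 / 2) ^+ k.+1.
have g0 k : 0 < g k by rewrite mulr_gt0 ?divr_gt0 ?exprn_gt0.
have ball_cover k : exists2 c : R * R, 0 < c.2 &
    U k `<=` `]c.1 - c.2, c.1 + c.2[%classic /\
    (((2 * c.2) `^ s)%:E <= (4 `^ s)%:E * diam_powR s (U k) + (g k)%:E)%E.
  (* The radius for which an interval of length 2t has s-content g k. *)
  pose t := (g k) `^ s^-1 / 2.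
  have t0 : 0 < t by rewrite divr_gt0 ?powR_gt0.
  have ts : (2 * t) `^ s = g k.
    by rewrite /t mulrCA divff ?mulr1 -?powRrM ?mulVf ?powRr1 ?lt0r_neq0 ?ltW.
  have [Uk0|/set0P[u Uu]] := eqVneq (U k) set0.
    exists (0, t) => //; split; first by rewrite Uk0.
    by rewrite ts /diam_powR Uk0 eqxx mule0 add0e.
  have := dU k; have := diam_ge0 (ex_intro _ u Uu).
  case dk : (diam (U k)) => [r| |]//; rewrite !lee_fin => r0 r1.
  exists (u, Num.max (2 * r) t); first by rewrite lt_max t0 orbT.
  split=> [x Ux|] /=.
    have xur : `|x - u| <= r.
      by rewrite -lee_fin -dk; apply: ereal_sup_ubound; exists x => //; exists u.
    have : r < Num.max (2 * r) t.
      rewrite lt_max; have [->|rn0] := eqVneq r 0; first by rewrite t0 orbT.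
      by rewrite ltr_pMl ?ltr1n// lt_neqAle eq_sym rn0.
    move=> /(le_lt_trans xur); rewrite ltr_norml in_itv/= => /andP[x1 x2].
    by apply/andP; split; lra.
  rewrite /diam_powR ifF; last by apply/negP => /eqP Uk0; move: Uu; rewrite Uk0.
  rewrite dk poweR_EFin -EFinM -EFinD lee_fin -powRM// -ts.
  have [h|h] := leP (2 * r) t; first by rewrite lerDr powR_ge0.
  by rewrite mulrA -natrM lerDl powR_ge0.
have [c /all_and2[c0 /all_and2[Uc lc]]] : exists c : nat -> R * R, forall k,
   0 < (c k).2 /\ (U k `<=` `](c k).1 - (c k).2, (c k).1 + (c k).2[%classic /\
    (((2 * (c k).2) `^ s)%:E <= (4 `^ s)%:E * diam_powR s (U k) + (g k)%:E)%E).
  have /choice[c hc] : forall k, exists c : R * R, 0 < c.2 /\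
    (U k `<=` `]c.1 - c.2, c.1 + c.2[%classic /\
    (((2 * c.2) `^ s)%:E <= (4 `^ s)%:E * diam_powR s (U k) + (g k)%:E)%E).
    by move=> k; have [d d0 d1] := ball_cover k; exists d.
  by exists c.
pose a k := (c k).1 - (c k).2; pose b k := (c k).1 + (c k).2.
have ab k : a k < b k by rewrite /a /b; have := c0 k; lra.
have [n Acov] : exists n, A `<=` \bigcup_(k < n) `]a k, b k[%classic.
  have : cover_compact A by rewrite -compact_cover.
  move=> /(_ nat setT (fun k => `]a k, b k[%classic)) Acover.
  have [k _|x /AU[k _ /Uc xk]|D _ AD] := Acover; first exact: itv_open.
    by exists k.
  exists (\max_(k <- D) k).+1 => x /AD[k /= kD xk]; exists k => //=.
  by rewrite ltnS (big_fsetD1 k)//= leq_maxl.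
have := eA n a b (conj (fun k _ => ab k) Acov).
rewrite -lee_fin -sumEFin => eS.
set S := (\sum_(k <oo) _)%E.
have {}eS : (e%:E <= (4 `^ s)%:E * S + (e / 2)%:E)%E.
  apply: le_trans eS _.
  apply: (@le_trans _ _ (\sum_(k < n) ((4 `^ s)%:E * diam_powR s (U k) + (g k)%:E))%E).
    apply: lee_sum => k _; rewrite (_ : b k - a k = 2 * (c k).2)//.
    by rewrite /a /b; lra.
  rewrite big_split/= leeD//.
    rewrite -ge0_sume_distrr; last by move=> k _; exact: diam_powR_ge0.
    rewrite lee_pmul2l ?lte_fin ?powR_gt0//.
    rewrite -(big_mkord xpredT (fun k => diam_powR s (U k))).
    by apply: nneseries_lim_ge => k _ _; exact: diam_powR_ge0.
  rewrite sumEFin lee_fin -mulr_sumr; apply: ler_piMr; first by rewrite divr_ge0 ?ltW.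
  have -> : \sum_(i < n) (1 / 2 : R) ^+ i.+1 = 1 - (1 / 2) ^+ n.
    elim: n {Acov} => [|m ih]; first by rewrite big_ord0 expr0 subrr.
    by rewrite big_ord_recr/= ih exprS; lra.
  by rewrite gerBl exprn_ge0.
move: eS; have : (0 <= S)%E by apply: nneseries_ge0 => k _ _; exact: diam_powR_ge0.
case: S => [r| |]//; last by move=> _ _; exact: leey.
rewrite -EFinM -EFinD !lee_fin => r0 er.
rewrite ler_pdivrMr ?powR_gt0//; lra.
Qed.

Lemma hausdorff_measure_gt0 s e A : compact A -> 0 < s -> 0 < e ->
  content_ge s e A -> (0 < hausdorff_measure s A)%E.
Proof.
move=> cA s0 e0 eA.
apply: (@lt_le_trans _ _ (hausdorff_premeasure s 1 A)); last first.
  by apply: ereal_sup_ubound; exists 1 => //; exact: ltr01.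
apply: (@lt_le_trans _ _ (e / 2 / 4 `^ s)%:E).
  by rewrite lte_fin !divr_gt0 ?powR_gt0.
apply: le_ereal_inf_tmp => _ [U [AU dU] <-].
exact: countable_cover_content eA AU dU.
Qed.

(** Covering [0,1] by n + 1 intervals of length 3/(n+1) gives an s-sum of
    order (n+1)^(1-s), which tends to 0. Thus the
    exponents that define the dimension form a bounded set. *)
Lemma hausdorff_measure_unit_itv s A : 1 < s -> A `<=` `[0, 1]%classic ->
  hausdorff_measure s A = 0%E.
Proof.
move=> s1 A01.
have s0 : 0 < s by exact: lt_trans s1.
apply/eqP; rewrite eq_le; apply/andP; split; last first.
  apply: (@le_trans _ _ (hausdorff_premeasure s 1 A)); last first.
    by apply: ereal_sup_ubound; exists 1 => //; exact: ltr01.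
  apply: le_ereal_inf_tmp => _ [U _ <-].
  by apply: nneseries_ge0 => k _ _; exact: diam_powR_ge0.
apply: ge_ereal_sup => _ [delta /= d0 <-].
have cov n : finite_itv_cover n.+1 (fun k => (k%:R - 1) / n.+1%:R) (fun k => (k.+2)%:R / n.+1%:R) A.
  split=> [k _|x /A01/=]; first by rewrite ltr_pM2r// -natr1 -natr1; lra.
  rewrite in_itv/= => /andP[x0 x1].
  have [xn|xn] := ltP x 1.
    exists (Num.truncn (x * n.+1%:R)) => /=.
      by rewrite truncn_lt_nat ?mulr_ge0// gtr_pMl.
    rewrite in_itv/= ltr_pdivrMr// ltr_pdivlMr//.
    have /andP[h1 h2] := truncn_itv (mulr_ge0 x0 (ler0n _ n.+1)).
    rewrite -[X in _ && (_ < X)]natr1; apply/andP; split; last by lra.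
    by rewrite ltrBlDr (le_lt_trans h1)// ltrDl.
  exists n => //=; rewrite in_itv/= ltr_pdivrMr// ltr_pdivlMr//.
  have -> : x = 1 by apply/eqP; rewrite eq_le x1.
  by rewrite !mul1r ltr_nat ltnSn andbT -natr1; lra.
have bound n : 3 / n.+1%:R <= delta ->
   (hausdorff_premeasure s delta A <= (3 `^ s * n.+1%:R `^ (1 - s))%:E)%E.
  move=> nd.
  have eqd (k : nat) : (k.+2)%:R / n.+1%:R - (k%:R - 1) / n.+1%:R = 3 / n.+1%:R :> R.
    by rewrite -mulrBl; congr (_ / _); rewrite -natr1 -natr1; lra.
  have := hausdorff_premeasure_le_cover (ltW s0) (cov n) _.
  move=> /(_ delta) h; apply: le_trans (h _) _.
    by move=> k _; rewrite eqd.
  rewrite lee_fin (eq_bigr (fun _ => (3 / n.+1%:R) `^ s)); last by move=> k _; rewrite eqd.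
  rewrite sumr_const card_ord powRM// -[leLHS]mulr_natr -mulrA ler_pM2l ?powR_gt0//.
  rewrite -powR_inv1// -powRrM mulN1r mulrC -[X in X * _](@powRr1 _ n.+1%:R)// -powRD//.
  by rewrite pnatr_eq0 implybT.
apply/lee_addgt0Pr => e e0; rewrite add0e.
(* Beyond m the intervals are shorter than delta and the s-sum is below e. *)
pose m : R := Num.max (3 / delta) ((3 `^ s / e) `^ (s - 1)^-1).
have m0 : 0 <= m by rewrite le_max divr_ge0// ltW.
pose n := Num.truncn m.
have mn : m < n.+1%:R by rewrite truncnS_gt.
have /andP[mn1 mn2] : (3 / delta < n.+1%:R) && ((3 `^ s / e) `^ (s - 1)^-1 < n.+1%:R).
  by move: mn; rewrite /m gt_max.
apply: le_trans (bound n _) _.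
  by rewrite ler_pdivrMr// mulrC -ler_pdivrMr// ltW.
rewrite lee_fin -(opprB s) powRN ler_pdivrMr ?powR_gt0// mulrC -ler_pdivrMr//.
have : ((3 `^ s / e) `^ (s - 1)^-1) `^ (s - 1) <= n.+1%:R `^ (s - 1).
  by apply: ge0_ler_powR; rewrite ?nnegrE ?powR_ge0 ?ltW ?subr_ge0 ?subr_gt0.
have sn0 : s - 1 != 0 by rewrite subr_eq0 gt_eqF.
by rewrite -powRrM mulVf// powRr1// divr_ge0 ?powR_ge0// ltW.
Qed.

Let dims A := [set s : R | (0 <= s)%R /\ (0 < hausdorff_measure s A)%E].

Let dims_ub A : A `<=` `[0, 1]%classic -> ubound (dims A) 1.
Proof.
move=> A01 s [s0]; apply: contraPT; rewrite -ltNge => s1.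
by rewrite hausdorff_measure_unit_itv// ltxx.
Qed.

Lemma hausdorff_dim_le1 A : A `<=` `[0, 1]%classic -> hausdorff_dim A <= 1.
Proof.
move=> A01; rewrite /hausdorff_dim -/(dims A); have [->|/set0P d0] := eqVneq (dims A) set0.
  by rewrite sup0.
by apply: ge_sup => //; exact: dims_ub.
Qed.

Lemma hausdorff_dim_ge0 A : A `<=` `[0, 1]%classic -> 0 <= hausdorff_dim A.
Proof.
move=> A01; rewrite /hausdorff_dim -/(dims A); have [->|/set0P[s ds]] := eqVneq (dims A) set0.
  by rewrite sup0.
apply: le_trans (proj1 ds) _; apply: ub_le_sup ds.
by exists 1; exact: dims_ub.
Qed.

Lemma content_ge_hausdorff_dim s e A : compact A -> A `<=` `[0, 1]%classic ->
  0 < s -> 0 < e -> content_ge s e A -> s <= hausdorff_dim A.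
Proof.
move=> cA A01 s0 e0 eA; apply: ub_le_sup; first by exists 1; exact: dims_ub.
by split; [exact: ltW|exact: hausdorff_measure_gt0 e0 eA].
Qed.

(** The quantifiers range over countable sets, so that the condition on A is
    a countable union of conditions on its finite covers. *)
Lemma hausdorff_dim_gtP A p : compact A -> A `<=` `[0, 1]%classic -> 0 <= p ->
  p < hausdorff_dim A <->
  exists q : rat, exists n : nat, p < ratr q /\ content_ge (ratr q) n.+1%:R^-1 A.
Proof.
move=> cA A01 p0; split; last first.
  move=> [q [n [pq qA]]]; apply: (lt_le_trans pq).
  apply: content_ge_hausdorff_dim qA => //; exact: le_lt_trans pq.
move=> pA.
have [s [s0 sA] ps] : exists2 s, dims A s & p < s.
  apply: (sup_gt _ pA); apply/set0P/eqP => d0; move: pA.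
  by rewrite /hausdorff_dim d0 sup0 ltNge p0.
have [q /= ] := rat_in_itvoo ps; rewrite in_itv/= => /andP[pq qs].
have [e e0 eA] := content_ge_hausdorff (le_lt_trans p0 pq) qs sA.
exists q, (Num.truncn e^-1); split=> // n a b cab; apply: le_trans (eA _ _ _ cab).
by rewrite ltW// invf_plt ?posrE// truncnS_gt.
Qed.

(** The 1-content of A is at least its Lebesgue measure. *)
Lemma lebesgue_gt0_hausdorff_dim A : compact A -> A `<=` `[0, 1]%classic ->
  (0 < lebesgue_measure A)%E -> hausdorff_dim A = 1.
Proof.
move=> cA A01 lA; apply/eqP; rewrite eq_le hausdorff_dim_le1//=.
have mA : measurable A.
  by apply: measurable_realfun.closed_measurable; apply: compact_closed cA; exact: Rhausdorff.
have lA1 : (lebesgue_measure A <= 1)%E.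
  apply: (@le_trans _ _ (lebesgue_measure (`[0%R, 1%R]%classic : set R))).
    by apply: le_measure => //; apply/mem_set => //; exact: measurable_itv.
  by rewrite lebesgue_measure_itv/= lte_fin ltr01 sube0.
have : lebesgue_measure A \is a fin_num.
  by rewrite ge0_fin_numE ?ltW// (le_lt_trans lA1) ?ltry.
move=> lAfin; apply: (@content_ge_hausdorff_dim 1 (fine (lebesgue_measure A))) => //.
  by rewrite fine_gt0// lA ltey_eq lAfin.
move=> n a b [ab Acov]; rewrite -lee_fin fineK// -sumEFin.
have mitv k : `I_n k -> measurable (`]a k, b k[%classic : set R).
  by move=> _; exact: measurable_itv.
have /(content_subadditive lebesgue_measure mitv mA) lAab :
    A `<=` \big[setU/set0]_(k < n) `]a k, b k[%classic by rewrite -(bigcup_mkord n (fun k => `]a k, b k[%classic : set R)).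
apply: (le_trans lAab).
apply: lee_sum => k _; rewrite /= lebesgue_measure_itv/= lte_fin ab// powRr1//.
by rewrite subr_ge0 ltW// ab.
Qed.

End hausdorff_dimension_compact.

(** * Integrals against Borel probability measures *)

Section probability_integrals.
Context {R : realType}.
Local Notation borel_probability := (probability (measurableTypeR R) R).
Implicit Types (mu nu : borel_probability) (g : R -> R) (L C : R).

Lemma prob_integrable mu (A : set R) g C : measurable A ->
  measurable_fun setT g -> (forall x, `|g x| <= C) -> mu.-integrable A (EFin \o g).
Proof.
move=> mA mg gC; apply: measurable_bounded_integrable => //.
- exact: le_lt_trans (probability_le1 mu mA) (ltry _).
- exact: measurable_funS mg.
- exists C; split; first exact: num_real.
  by move=> D CD x _; apply: le_trans (gC x) (ltW CD).
Qed.

Lemma prob_full_Rintegral mu (A : set R) g C : measurable A ->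
  measurable_fun setT g -> (forall x, `|g x| <= C) -> mu (~` A) = 0%E ->
  \int[mu]_x g x = \int[mu]_(x in A) g x.
Proof.
move=> mA mg gC muA; have mA' : measurable (~` A) by exact: measurableC.
rewrite -(setUv A) Rintegral_setU//; last 2 first.
- by rewrite setUv; exact: prob_integrable gC.
- by apply/disj_set2P; rewrite setICr.
rewrite [X in _ + X](_ : _ = 0) ?addr0// /Rintegral null_set_integral//.
by apply/measurable_EFinP; exact: measurable_funS mg.
Qed.

(** Every point outside the support lies in a null interval with rational
    end points, and there are countably many of these. *)
Lemma msupport_null mu (B : set R) : measurable B -> B `&` msupport mu = set0 ->
  mu B = 0%E.
Proof.
move=> mB Bsupp.
pose N (p : rat * rat) : set R :=
  if mu `]ratr p.1, ratr p.2[%classic == 0%E then `]ratr p.1, ratr p.2[%classic else set0.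
have Nnull p : mu.-negligible (N p).
  rewrite /N; case: ifPn => [/eqP p0|_]; last exact: negligible_set0.
  by apply/negligibleP => //; exact: measurable_itv.
pose F k := if @choice.unpickle (rat * rat)%type k is Some p then N p else set0.
have : mu.-negligible (\bigcup_k F k).
  apply: negligible_bigcup => k; rewrite /F.
  by case: choice.unpickle => [p|]; [exact: Nnull|exact: negligible_set0].
move=> /(@negligibleS _ _ _ mu _ B) BN; apply/negligibleP => //; apply: BN.
move=> x Bx; have : ~ msupport mu x.
  by move=> sx; have : (set0 : set R) x by rewrite -Bsupp.
rewrite /msupport/= => /existsNP[U /not_implyP[oU /not_implyP[Ux muU]]].
have /nbhs_ballP[e /= e0 eU] : nbhs x U by exact: open_nbhs_nbhs.
have [q1 /=] := @rat_in_itvoo _ (x - e) x ltac:(by rewrite ltrBlDr ltrDl).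
rewrite in_itv/= => /andP[q11 q12].
have [q2 /=] := @rat_in_itvoo _ x (x + e) ltac:(by rewrite ltrDl).
rewrite in_itv/= => /andP[q21 q22].
exists (choice.pickle (q1, q2)); first by [].
rewrite /F choice.pickleK /N/=.
have sub : `]ratr q1, ratr q2[%classic `<=` U.
  move=> y /=; rewrite in_itv/= => /andP[y1 y2]; apply: eU; rewrite /ball/=.
  by rewrite ltr_norml; apply/andP; split; lra.
rewrite ifT; first by rewrite /= in_itv/= q12 q21.
rewrite -measure_le0; apply: le_trans (_ : (mu U <= 0)%E).
  by apply: le_measure => //; apply/mem_set; [exact: measurable_itv|exact: open_measurable].
by rewrite leNgt; apply/negP.
Qed.

End probability_integrals.

Section lipschitz_functions.
Context {R : realType}.
Local Notation borel_probability := (probability (measurableTypeR R) R).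
Implicit Types (mu nu : borel_probability) (g : R -> R) (L C : R).

Definition lip (L : R) g := forall x y, `|g x - g y| <= L * `|x - y|.

Lemma lip_continuous L g : lip L g -> continuous g.
Proof.
move=> gL x; apply/cvgrPdist_lt => e e0.
have L1 : 0 < `|L| + 1 by rewrite ltr_wpDl.
near=> y; apply: le_lt_trans (gL x y) _.
apply: (@le_lt_trans _ _ ((`|L| + 1) * `|x - y|)).
  by apply: ler_wpM2r => //; rewrite (le_trans (ler_norm L))// lerDl.
rewrite mulrC -ltr_pdivlMr//; near: y.
exact: (cvgrPdist_lt _ _).1 cvg_id _ (divr_gt0 e0 L1).
Unshelve. all: by end_near. Qed.

Lemma lip_measurable L g : lip L g -> measurable_fun setT g.
Proof. by move=> /lip_continuous; exact: continuous_measurable_fun. Qed.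

Lemma derive_lip (f df : R -> R) : (forall x : R, is_derive x (1 : R) f (df x)) ->
  (forall x, `|df x| <= 1) -> lip 1 f.
Proof.
move=> fdf df1.
suff h (x y : R) : x <= y -> `|f x - f y| <= 1 * `|x - y|.
  by move=> x y; have [|/ltW] := leP x y => /h// ; rewrite distrC (distrC y).
move=> xy; have fc : {within `[x, y], continuous f}.
  apply: continuous_subspaceT => z; apply: differentiable_continuous.
  by apply/derivable1_diffP; have [] := fdf z.
have [c _ fE] := MVT_segment xy (fun z _ => fdf z) fc.
by rewrite distrC fE normrM (distrC x) ler_wpM2r.
Qed.

Lemma lip_scale (xi : R) f : lip 1 f -> lip `|xi| (fun x => f (xi * x)).
Proof. by move=> fl x y; rewrite (le_trans (fl _ _))// mul1r -mulrBr normrM. Qed.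

Lemma cos_lip (xi : R) : lip `|xi| (fun x => cos (xi * x)).
Proof.
apply: lip_scale; apply: (@derive_lip cos (fun x => - sin x)) => x.
by rewrite normrN sin_max.
Qed.

Lemma sin_lip (xi : R) : lip `|xi| (fun x => sin (xi * x)).
Proof. by apply: lip_scale; apply: (@derive_lip sin cos) => x; exact: cos_max. Qed.

(** The modulus of the transform is compared through its squared real and
    imaginary parts, which keeps the rest of the development inside R. *)
Lemma fourier_leP mu (xi c : R) : 0 <= c -> `|fourier mu xi| <= (c%:C)%C <->
  (\int[mu]_x cos (xi * x)) ^+ 2 + (\int[mu]_x sin (xi * x)) ^+ 2 <= c ^+ 2.
Proof.
move=> c0; rewrite normc_def lecR /fourier /complex_integral /expi /=.
have -> : \int[mu]_x cos (- (xi * x)) = \int[mu]_x cos (xi * x).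
  by apply: eq_Rintegral => x _; rewrite cosN.
have -> : \int[mu]_x sin (- (xi * x)) = - \int[mu]_x sin (xi * x).
  rewrite -mulN1r -RintegralZl//; first by apply: eq_Rintegral => x _; rewrite sinN mulN1r.
  apply: (@prob_integrable _ _ _ _ 1) => //; first exact: lip_measurable (sin_lip xi).
  by move=> x; exact: sin_max.
rewrite sqrrN; set a := _ + _.
have a0 : 0 <= a by rewrite addr_ge0// sqr_ge0.
by rewrite -(ler_pXn2r (ltn0Sn 1)) ?nnegrE ?sqrtr_ge0// sqr_sqrtr.
Qed.

Lemma itv_oc_setU (u v w : R) : u <= v -> v <= w ->
  `]u, w]%classic = `]u, v] `|` `]v, w] :> set R.
Proof. by move=> uv vw; apply: itv_bndbnd_setU; rewrite bnd_simp. Qed.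

Lemma itv_oc_disj (u v w : R) : [disjoint `]u, v]%classic & `]v, w]%classic].
Proof.
apply/disj_set2P; rewrite -subset0 => x [] /=; rewrite !in_itv/=.
by move=> /andP[_ xv] /andP[/lt_le_trans/(_ xv)]; rewrite ltxx.
Qed.

(** On a cell of length v - u the function g differs from its value at v by
    at most L (v - u). *)
Lemma cell_integral mu g L C (u v : R) : lip L g -> (forall x, `|g x| <= C) ->
  0 <= L -> `|\int[mu]_(x in `]u, v]) g x - g v * fine (mu `]u, v]%classic)| <=
  L * `|v - u| * fine (mu `]u, v]%classic).
Proof.
move=> gL gC L0.
have mI : measurable (`]u, v]%classic : set R) by exact: measurable_itv.
have mg := lip_measurable gL.
have icst (c : R) : mu.-integrable `]u, v] (EFin \o (fun _ => c)).
  by apply: (@prob_integrable _ _ _ _ `|c|).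
have ig : mu.-integrable `]u, v] (EFin \o g) by exact: prob_integrable gC.
rewrite -Rintegral_cst// -RintegralB//.
have ib : mu.-integrable `]u, v] (EFin \o (fun x => g x - g v)).
  apply: (@prob_integrable _ _ _ _ (C + C)) => //; first exact: measurable_funB.
  by move=> x; rewrite (le_trans (ler_normB _ _))// lerD.
apply: le_trans (le_normr_Rintegral _ ib) _ => //.
rewrite -Rintegral_cst//; apply: le_Rintegral => //.
  apply: (@prob_integrable _ _ _ _ (C + C)) => //.
    by apply: measurableT_comp => //; exact: measurable_funB.
  by move=> x; rewrite normr_id (le_trans (ler_normB _ _))// lerD.
move=> x /=; rewrite in_itv/= => /andP[ux xv]; apply: le_trans (gL _ _) _.
apply: ler_wpM2l => //; rewrite distrC !ger0_norm ?subr_ge0//.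
  by rewrite lerD2l lerN2 ltW.
by rewrite ltW// (lt_le_trans ux).
Qed.

(** The error is proportional to the step h and does not depend on the
    measure, so that convergence of the masses of the cells implies convergence
    of the integrals. *)
Lemma riemann_sum mu g L C (a h : R) n : lip L g -> (forall x, `|g x| <= C) ->
  0 <= L -> 0 <= h ->
  `|\int[mu]_(x in `]a, a + n%:R * h]) g x -
    \sum_(i < n) g (a + i.+1%:R * h) *
      fine (mu `]a + i%:R * h, a + i.+1%:R * h]%classic)| <=
  L * h * fine (mu `]a, a + n%:R * h]%classic).
Proof.
move=> gL gC L0 h0; elim: n => [|n ih].
  by rewrite big_ord0 mul0r addr0 set_itvoc0 Rintegral_set0 measure0 subr0 normr0 mulr0.
have le1 : a <= a + n%:R * h by rewrite lerDl mulr_ge0.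
have le2 : a + n%:R * h <= a + n.+1%:R * h by rewrite lerD2l ler_wpM2r// ler_nat.
have mI (u v : R) : measurable (`]u, v]%classic : set R) by exact: measurable_itv.
rewrite big_ord_recr/= (itv_oc_setU le1 le2) Rintegral_setU//; last 2 first.
- by apply: prob_integrable gC; [exact: measurableU|exact: lip_measurable gL].
- exact: itv_oc_disj.
rewrite opprD addrACA (le_trans (ler_normD _ _))//.
have dis : `]a, a + n%:R * h] `&` `]a + n%:R * h, a + n.+1%:R * h] = set0 :> set R.
  by apply/disj_set2P; exact: itv_oc_disj.
rewrite measureU//= fineD ?fin_num_measure// mulrDr lerD//.
apply: le_trans (cell_integral mu _ _ gL gC L0) _.
apply: ler_wpM2r; first exact: fine_ge0.
apply: ler_wpM2l => //.
by rewrite opprD addrACA subrr add0r -mulrBl -natr1 addrAC subrr add0r mul1r ger0_norm.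
Qed.

End lipschitz_functions.

(** * Weak compactness of the probability measures on the unit interval *)

Section lebesgue_stieltjes_probability.
Context {R : realType} (G : R -> R).
Local Notation borel_probability := (probability (measurableTypeR R) R).
Hypothesis G_nd : nondecreasing G.
Hypothesis G_rc : right_continuous G.
Hypothesis G_lt0 : forall t, t < 0 -> G t = 0.
Hypothesis G_ge1 : forall t, 1 <= t -> G t = 1.

#[local] HB.instance Definition _ := isCumulative.Build R _ R G G_nd G_rc.

Let G_Ny : G @ -oo --> (0 : R).
Proof.
apply: cvg_near_cst; near=> t; apply: G_lt0; near: t.
exact: nbhs_ninfty_lt.
Unshelve. all: by end_near. Qed.

Let G_y : G @ +oo --> (1 : R).
Proof.
apply: cvg_near_cst; near=> t; apply: G_ge1; near: t.
exact: nbhs_pinfty_ge.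
Unshelve. all: by end_near. Qed.

#[local] HB.instance Definition _ := isCumulativeBounded.Build R 0 1 G G_Ny G_y.

(** A distribution function determines a Lebesgue-Stieltjes measure; its
    limits 0 and 1 at infinity are attained, because all the mass lies in [0,1]. *)
Lemma probability_of_cdf : exists nu : borel_probability,
  forall u v, u <= v -> nu `]u, v]%classic = (G v - G u)%:E.
Proof.
exists (lebesgue_stieltjes_measure G) => u v uv.
rewrite /= /lebesgue_stieltjes_measure.
rewrite /measure_extension measurable_mu_extE/=; last exact: is_ocitv.
by rewrite wlength_itv_bnd// EFinB.
Qed.

End lebesgue_stieltjes_probability.

Section helly.
Context {R : realType}.
Local Notation borel_probability := (probability (measurableTypeR R) R).
Implicit Types (mu nu : borel_probability) (g : R -> R) (L C : R).

(* The grid divides (-1, 2] into N cells, so that distribution functions of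
   measures on [0,1] are 0 at its first point and 1 at its last one. *)
Let h (N : nat) : R := 3 / N%:R.
Let t (N i : nat) : R := -1 + i%:R * h N.

Let t_end N : (0 < N)%N -> t N N = 2.
Proof.
by move=> N0; rewrite /t /h mulrC divfK ?pnatr_eq0 -?lt0n//; lra.
Qed.

Let h_ge0 N : 0 <= h N. Proof. by rewrite divr_ge0. Qed.

Let t_le N i : t N i <= t N i.+1.
Proof. by rewrite lerD2l ler_wpM2r// ler_nat. Qed.

Lemma riemann_unit mu (F : R -> R) g L C N : (0 < N)%N -> lip L g ->
  (forall x, `|g x| <= C) -> 0 <= L -> F (-1) = 0 -> F 2 = 1 ->
  (forall u v, u <= v -> mu `]u, v]%classic = (F v - F u)%:E) ->
  `|\int[mu]_x g x - \sum_(i < N) g (t N i.+1) * (F (t N i.+1) - F (t N i))| <= L * h N.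
Proof.
move=> N0 gL gC L0 F1 F2 muF.
have mI (u v : R) : measurable (`]u, v]%classic : set R) by exact: measurable_itv.
have mu1 : mu `]-1, 2]%classic = 1%E by rewrite muF ?F1 ?F2 ?subr0//; lra.
have mu0 : mu (~` `]-1, 2]%classic) = 0%E.
  by rewrite probability_setC// mu1 subee.
rewrite (prob_full_Rintegral (mI _ _) (lip_measurable gL) gC mu0).
have := riemann_sum mu (-1) N gL gC L0 (h_ge0 N).
rewrite -/(t N N) t_end// mu1 /= mulr1; apply: le_trans.
rewrite le_eqVlt; apply/orP; left; apply/eqP; congr (`|_ - _|).
by apply: eq_bigr => i _; rewrite -/(t N i.+1) -/(t N i) muF//= t_le.
Qed.

(** Summation by parts, for a sequence that vanishes at both ends. *)
Lemma abel_sum (N : nat) (c D : nat -> R) : D 0 = 0 -> D N = 0 ->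
  \sum_(i < N) c i.+1 * (D i.+1 - D i) = - \sum_(i < N) (c i.+1 - c i) * D i.
Proof.
move=> D0 DN; apply/eqP; rewrite -subr_eq0 opprK -big_split/=.
rewrite (eq_bigr (fun i : 'I_N => c i.+1 * D i.+1 - c i * D i)); last first.
  by move=> i _; ring.
rewrite -(big_mkord xpredT (fun i => c i.+1 * D i.+1 - c i * D i)).
by rewrite (telescope_sumr (fun i => c i * D i))// D0 DN !mulr0 subr0.
Qed.

Lemma cvg_sum_ord (T : Type) (U : set_system T) (FU : Filter U) (N : nat)
    (f : nat -> T -> R) (l : nat -> R) :
  (forall i, f i x @[x --> U] --> l i) ->
  \sum_(i < N) f i x @[x --> U] --> \sum_(i < N) l i.
Proof.
move=> fl; elim: N => [|N ih].
  by rewrite big_ord0 (_ : (fun _ => _) = cst 0) ?(funext (fun=> _))//; last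
     first; [apply/funext => x; rewrite big_ord0|exact: cvg_cst].
rewrite big_ord_recr/= (_ : (fun _ => _) = fun x => \sum_(i < N) f i x + f N x).
  exact: cvgD.
by apply/funext => x; rewrite big_ord_recr.
Qed.

(** Limits along an ultrafilter replace the diagonal extraction of a
    subsequence: they exist at all points simultaneously. *)
Lemma ultra_cvg_unit (U : set_system nat) (f : nat -> R) : UltraFilter U ->
  (forall n, 0 <= f n <= 1) -> exists l : R, f n @[n --> U] --> l.
Proof.
move=> ultraU f01.
have : compact (`[0, 1]%classic : set R) by exact: segment_compact.
rewrite compact_ultra => /(_ (f @ U)) [].
- apply: Build_UltraFilter => G PG fUG.
  apply/seteqP; split=> [A GA|]; last exact: fUG.
  have [//|UA] := in_ultra_setVsetC (f @^-1` A) ultraU.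
  have := @filter_ex _ _ PG _ (filterI GA (fUG (~` A) UA)).
  by case=> x [].
- by apply: (@filterE _ U _ (f @^-1` `[0, 1]%classic)) => n /=; rewrite in_itv; exact: f01.
- by move=> l [_ fl]; exists l.
Qed.

(** Helly's theorem along an ultrafilter U. The distribution functions F n
    converge along U at every point to a monotone function Fl, and the
    right-continuous regularization G of Fl is the distribution function of the
    limit nu. The integral of a Lipschitz function against a measure is, up to
    O(h), a Riemann-Stieltjes sum of the distribution function. The sums for Fl
    and for G differ by O(h) as well: after summation by parts the differences
    G - Fl at the grid points are multiplied by increments of g, and they are
    bounded by the increments of Fl, whose sum is 1. *)
Lemma helly_selection (mu : nat -> borel_probability) :
  (forall n, mu n (~` `[0, 1]%classic) = 0%E) ->
  exists U : set_system nat, [/\ ProperFilter U, \oo `<=` U &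
  exists nu : borel_probability, forall g L C, lip L g -> 0 <= L ->
    (forall x, `|g x| <= C) -> \int[mu n]_x g x @[n --> U] --> \int[nu]_x g x].
Proof.
move=> mu01.
have [U [ultraU ooU]] : exists U : set_system nat, UltraFilter U /\ \oo `<=` U.
  exact: ultraFilterLemma.
have PU : ProperFilter U by exact: ultra_proper.
exists U; split=> //.
pose F n x := fine (mu n `]-oo, x]%classic).
have mray (x : R) : measurable (`]-oo, x]%classic : set R) by exact: measurable_itv.
have mI (u v : R) : measurable (`]u, v]%classic : set R) by exact: measurable_itv.
have mu_fin n (A : set R) : measurable A -> mu n A \is a fin_num.
  by move=> mA; exact: fin_num_measure.
have F_incr n u v : u <= v -> mu n `]u, v]%classic = (F n v - F n u)%:E.
  move=> uv; have uvE : `]-oo, v]%classic = `]-oo, u] `|` `]u, v] :> set R.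
    by apply: itv_bndbnd_setU; rewrite bnd_simp.
  rewrite EFinB !fineK ?mu_fin// uvE measureU//; last first.
    rewrite -subset0 => x [] /=; rewrite !in_itv/=.
    by move=> xu /andP[/lt_le_trans/(_ xu)]; rewrite ltxx.
  by rewrite addeAC subee ?mu_fin// add0e.
have F_nd n u v : u <= v -> F n u <= F n v.
  by move=> uv; rewrite -subr_ge0 -lee_fin -F_incr.
have F_lt0 n x : x < 0 -> F n x = 0.
  move=> x0; rewrite /F (_ : mu n _ = 0%E)//; apply: subset_measure0 (mu01 n) => //.
    by apply: measurableC; exact: measurable_itv.
  move=> y /=; rewrite !in_itv/= => yx /andP[y0 _].
  by have := lt_le_trans (le_lt_trans yx x0) y0; rewrite ltxx.
have F_ge1 n x : 1 <= x -> F n x = 1.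
  move=> x1; have : mu n (~` `]-oo, x]%classic) = 0%E.
    apply: subset_measure0 (mu01 n); [exact: measurableC| |].
      by apply: measurableC; exact: measurable_itv.
    move=> y /=; rewrite !in_itv/= => yx /andP[y0 y1]; apply: yx.
    exact: le_trans y1 x1.
  rewrite probability_setC// -[mu n _]fineK ?mu_fin// -EFinB => -[/eqP].
  by rewrite subr_eq0 eq_sym => /eqP.
have F01 n x : 0 <= F n x <= 1.
  rewrite fine_ge0//= -lee_fin fineK ?mu_fin//; exact: probability_le1.
have /choice[Fl Fl_cvg] : forall x, exists l : R, F n x @[n --> U] --> l.
  by move=> x; apply: ultra_cvg_unit => n; exact: F01.
have Fl_nd u v : u <= v -> Fl u <= Fl v.
  move=> uv; apply: (ler_cvg_to (Fl_cvg u) (Fl_cvg v)).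
  by apply: filterE => n; exact: F_nd.
have Fl_cst x c : (forall n, F n x = c) -> Fl x = c.
  move=> Fc; apply: (cvg_unique _ (Fl_cvg x)) => //.
  by apply: cvg_near_cst; apply: filterE.
have Fl_lt0 x : x < 0 -> Fl x = 0 by move=> x0; apply: Fl_cst => n; exact: F_lt0.
have Fl_ge1 x : 1 <= x -> Fl x = 1 by move=> x1; apply: Fl_cst => n; exact: F_ge1.
have Fl01 x : 0 <= Fl x <= 1.
  apply/andP; split.
    by apply: (cvgr_to_ge (Fl_cvg x)); apply: filterE => n; have /andP[] := F01 n x.
  by apply: (cvgr_to_le (Fl_cvg x)); apply: filterE => n; have /andP[] := F01 n x.
(* The right-continuous regularization of Fl. *)
pose G x := inf [set Fl u | u in [set u | x < u]].
have G_inf x : has_inf [set Fl u | u in [set u | x < u]].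
  split; first by exists (Fl (x + 1)); exists (x + 1) => //=; rewrite ltrDl.
  by exists 0 => _ [u _ <-]; have /andP[] := Fl01 u.
have G_le x u : x < u -> G x <= Fl u.
  by move=> xu; apply: ge_inf; [exact: (G_inf x).2|exists u].
have le_G x : Fl x <= G x.
  apply: lb_le_inf; first exact: (G_inf x).1.
  by move=> _ [u /= xu <-]; apply: Fl_nd; exact: ltW.
have G_nd : nondecreasing G.
  move=> x y xy; apply: lb_le_inf; first exact: (G_inf y).1.
  by move=> _ [u /= yu <-]; apply: G_le; exact: le_lt_trans yu.
have G_rc : right_continuous G.
  move=> x; apply/cvgrPdist_lt => e e0.
  have [_ [u /= xu <-] Gu] := inf_adherent e0 (G_inf x).
  near=> y.
  have xy : x < y by near: y; exact: nbhs_right_gt.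
  have yu : y < u by near: y; exact: nbhs_right_lt.
  rewrite distrC ger0_norm ?subr_ge0 ?G_nd ?ltW// ltrBlDl.
  exact: le_lt_trans (G_le _ _ yu) Gu.
have G_lt0 x : x < 0 -> G x = 0.
  move=> x0; apply/eqP; rewrite eq_le; apply/andP; split.
    by rewrite -(Fl_lt0 (x / 2)) ?G_le//; lra.
  by apply: le_trans (le_G x); have /andP[] := Fl01 x.
have G_ge1 x : 1 <= x -> G x = 1.
  move=> x1; apply/eqP; rewrite eq_le; apply/andP; split.
    by rewrite -(Fl_ge1 (x + 1)) ?G_le//; lra.
  by rewrite -(Fl_ge1 _ x1).
have [nu nuG] := probability_of_cdf G_nd G_rc G_lt0 G_ge1.
exists nu => g L C gL L0 gC.
apply/cvgrPdist_lt => e e0.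
(* Three comparisons with error L h(N) take up e/2; the convergence of the sums
   for the fixed N takes up the other half. *)
have [N N0 hN] : exists2 N, (0 < N)%N & L * h N < e / 6.
  exists (Num.truncn (L * 18 / e)).+1 => //.
  rewrite /h mulrA ltr_pdivrMr//.
  have := truncnS_gt (L * 18 / e); set T := _.+1%:R; rewrite ltr_pdivrMr// => hT.
  by rewrite mulrAC ltr_pdivlMr//; lra.
pose S (H : R -> R) := \sum_(i < N) g (t N i.+1) * (H (t N i.+1) - H (t N i)).
have SF : S (F n) @[n --> U] --> S Fl.
  apply: (@cvg_sum_ord _ _ _ N (fun i n => g (t N i.+1) * (F n (t N i.+1) - F n (t N i)))
    (fun i => g (t N i.+1) * (Fl (t N i.+1) - Fl (t N i)))) => i.
  by apply: cvgMr; apply: cvgB; exact: Fl_cvg.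
have tN := t_end N0.
have t0 : t N 0 = -1 by rewrite /t mul0r addr0.
have hN0 : 0 < h N by rewrite divr_gt0// ltr0n.
have tlt i : t N i < t N i.+1 by rewrite ltrD2l ltr_pM2r// ltr_nat.
have SG : `|S G - S Fl| <= L * h N.
  pose D i := G (t N i) - Fl (t N i).
  have -> : S G - S Fl = \sum_(i < N) g (t N i.+1) * (D i.+1 - D i).
    by rewrite /S -sumrB; apply: eq_bigr => i _; rewrite /D; ring.
  rewrite (@abel_sum N (fun i => g (t N i)) D); last 2 first.
  - by rewrite /D t0 G_lt0 ?Fl_lt0 ?subrr//; lra.
  - by rewrite /D tN G_ge1 ?Fl_ge1 ?subrr//; lra.
  rewrite normrN (le_trans (ler_norm_sum _ _ _))//.
  apply: (@le_trans _ _ (\sum_(i < N) L * h N * (Fl (t N i.+1) - Fl (t N i)))).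
    apply: ler_sum => i _; rewrite normrM; apply: ler_pM => //.
      apply: le_trans (gL _ _) _; rewrite ler_wpM2l//.
      by rewrite /t opprD addrACA subrr add0r -mulrBl -natr1 addrAC subrr add0r mul1r ger0_norm.
    rewrite /D ger0_norm ?subr_ge0 ?le_G// lerD2r; exact: G_le.
  rewrite -mulr_sumr -(big_mkord xpredT (fun i => Fl (t N i.+1) - Fl (t N i))).
  rewrite (telescope_sumr (fun i => Fl (t N i)))// tN t0 Fl_ge1 ?Fl_lt0 ?subr0 ?mulr1//; lra.
have RG : `|\int[nu]_x g x - S G| <= L * h N.
  by apply: (riemann_unit N0 gL gC L0) => //; [apply: G_lt0|apply: G_ge1]; lra.
near=> n.
have RF : `|\int[mu n]_x g x - S (F n)| <= L * h N.
  by apply: (riemann_unit N0 gL gC L0) => //; [apply: F_lt0|apply: F_ge1|exact: F_incr]; lra.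
have Sn : `|S Fl - S (F n)| < e / 2.
  by near: n; apply: (cvgrPdist_lt _ _).1 SF _ _; rewrite divr_gt0.
move: hN SG RG RF Sn; set a := L * h N; set x1 := \int[nu]_x _; set x2 := \int[mu n]_x _.
set y1 := S G; set y2 := S Fl; set y3 := S (F n); move: a x1 x2 y1 y2 y3.
move=> a x1 x2 y1 y2 y3 hN.
rewrite !ler_norml !ltr_norml => /andP[? ?] /andP[? ?] /andP[? ?] /andP[? ?].
by apply/andP; split; lra.
Unshelve. all: by end_near. Qed.

End helly.

(** * Fourier decay and Fourier dimension of compact sets *)

Section fourier_dimension_compact.
Context {R : realType}.
Local Notation borel_probability := (probability (measurableTypeR R) R).
Local Notation K01 := (compacts (set_type `[0 : R, 1 : R])).
Implicit Types (mu nu : borel_probability) (A : set R) (s c p : R).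

(** The condition on mu in the definition of the Fourier dimension, with the
    constant explicit. *)
Definition fourier_decay mu s c :=
  forall x : R, x != 0 -> `|fourier mu x| <= ((c * `|x| `^ (- (s / 2)))%:C)%C.

Lemma Rintegral_cos_le1 mu (xi : R) : `|\int[mu]_x cos (xi * x)| <= 1.
Proof.
have i1 := prob_integrable mu measurableT (lip_measurable (cos_lip xi)) (fun x => cos_max _).
apply: le_trans (le_normr_Rintegral _ i1) _ => //.
rewrite -[leRHS]mulr1 -[X in _ <= 1 * X]/(fine 1%E) -(probability_setT mu).
rewrite -Rintegral_cst//; apply: le_Rintegral => //.
- apply: (@prob_integrable _ _ _ _ 1) => //; last by move=> x; rewrite normr_id cos_max.
  by apply: measurableT_comp => //; exact: lip_measurable (cos_lip xi).
- by apply: (@prob_integrable _ _ _ _ 1) => // x; rewrite normr1.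
- by move=> x _; exact: cos_max.
Qed.

Lemma Rintegral_sin_le1 mu (xi : R) : `|\int[mu]_x sin (xi * x)| <= 1.
Proof.
have i1 := prob_integrable mu measurableT (lip_measurable (sin_lip xi)) (fun x => sin_max _).
apply: le_trans (le_normr_Rintegral _ i1) _ => //.
rewrite -[leRHS]mulr1 -[X in _ <= 1 * X]/(fine 1%E) -(probability_setT mu).
rewrite -Rintegral_cst//; apply: le_Rintegral => //.
- apply: (@prob_integrable _ _ _ _ 1) => //; last by move=> x; rewrite normr_id sin_max.
  by apply: measurableT_comp => //; exact: lip_measurable (sin_lip xi).
- by apply: (@prob_integrable _ _ _ _ 1) => // x; rewrite normr1.
- by move=> x _; exact: sin_max.
Qed.

Lemma fourier_le2 mu (xi : R) : `|fourier mu xi| <= (2%:C)%C.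
Proof.
apply/fourier_leP => //.
have h (a : R) : `|a| <= 1 -> a ^+ 2 <= 1.
  by move=> a1; rewrite -real_normK ?num_real// exprn_ile1.
have := h _ (Rintegral_cos_le1 mu xi); have := h _ (Rintegral_sin_le1 mu xi).
by move: (_ ^+ 2) (_ ^+ 2) => a b; lra.
Qed.

(** Away from the origin a smaller exponent is weaker; near the origin the
    trivial bound by 2 takes over. *)
Lemma fourier_decayW mu s s' c : 0 <= s' -> s' <= s -> 0 <= c ->
  fourier_decay mu s c -> forall c', c <= c' -> 2 <= c' -> fourier_decay mu s' c'.
Proof.
move=> s'0 s's c0 dec c' cc' c'2 x x0.
have x_gt0 : 0 < `|x| by rewrite normr_gt0.
have [x1|x1] := leP 1 `|x|.
  apply: le_trans (dec x x0) _; rewrite lecR ler_pM ?powR_ge0//.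
  by rewrite ler_powR// lerN2 ler_pM2r.
apply: le_trans (fourier_le2 mu x) _; rewrite lecR.
rewrite (le_trans c'2)// ler_peMr//; first by rewrite (le_trans _ c'2).
rewrite -[leLHS](powRr0 `|x|) ger_powR//; first by rewrite x_gt0 ltW.
by rewrite oppr_le0 divr_ge0.
Qed.

Let dims A := [set s : R | 0 <= s <= 1 /\
  exists mu, msupport mu `<=` A /\ exists c, 0 < c /\ fourier_decay mu s c].

Let dims_ub A : ubound (dims A) 1. Proof. by move=> s [/andP[]]. Qed.

Lemma fourier_dim_le1 A : fourier_dim A <= 1.
Proof.
rewrite /fourier_dim -/(dims A); have [->|/set0P d0] := eqVneq (dims A) set0.
  by rewrite sup0.
by apply: ge_sup => //; exact: dims_ub.
Qed.

Lemma fourier_dim_ge0 A : 0 <= fourier_dim A.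
Proof.
rewrite /fourier_dim -/(dims A); have [->|/set0P[s ds]] := eqVneq (dims A) set0.
  by rewrite sup0.
apply: (@le_trans _ _ s); first by case: ds => /andP[].
by apply: ub_le_sup ds; exists 1; exact: dims_ub.
Qed.

Lemma fourier_decay_dim mu s c A : 0 <= s <= 1 -> 0 < c -> msupport mu `<=` A ->
  fourier_decay mu s c -> s <= fourier_dim A.
Proof.
move=> s01 c0 muA dec; apply: ub_le_sup; first by exists 1; exact: dims_ub.
by split=> //; exists mu; split=> //; exists c.
Qed.

Lemma fourier_dim_gt A p : 0 <= p -> p < fourier_dim A -> exists2 s, p < s <= 1 &
  exists mu c, [/\ 0 < c, msupport mu `<=` A & fourier_decay mu s c].
Proof.
move=> p0 pA; have [s ds ps] : exists2 s, dims A s & p < s.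
  apply: (sup_gt _ pA); apply/set0P/eqP => d0; move: pA.
  by rewrite /fourier_dim d0 sup0 ltNge p0.
case: ds => /andP[s0 s1] [mu [muA [c [c0 dec]]]].
by exists s; [rewrite ps|exists mu, c].
Qed.

(** As for the Hausdorff dimension, exponent and constant can be taken from
    countable sets. *)
Lemma fourier_dim_gtP A p : 0 <= p -> p < fourier_dim A <->
  exists q : rat, exists n : nat, [/\ p < ratr q, ratr q <= 1 :> R &
    exists mu, msupport mu `<=` A /\ fourier_decay mu (ratr q) n.+1%:R].
Proof.
move=> p0; split=> [pA|[q [n [pq q1 [mu [muA dec]]]]]]; last first.
  apply: (lt_le_trans pq); apply: fourier_decay_dim muA dec => //.
  by rewrite q1 (le_trans p0)// ltW.
have [s /andP[ps s1] [mu [c [c0 muA dec]]]] := fourier_dim_gt p0 pA.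
have [q /= ] := rat_in_itvoo ps; rewrite in_itv/= => /andP[pq qs].
exists q, (Num.truncn (c + 2)); split=> //; first by rewrite (le_trans _ s1)// ltW.
exists mu; split=> //; have ct := truncnS_gt (c + 2).
apply: (fourier_decayW _ _ (ltW c0) dec); rewrite ?(ltW qs)//; last 2 first.
- by rewrite (le_trans _ (ltW ct))// lerDl.
- by rewrite (le_trans _ (ltW ct))// lerDr ltW.
by rewrite (le_trans p0)// ltW.
Qed.

Lemma tent_lip (a r : R) : lip 1 (fun x => Num.max 0 (r - `|x - a|)).
Proof.
move=> x y; rewrite mul1r.
have h : `| `|x - a| - `|y - a| | <= `|x - y|.
  by rewrite (le_trans (ler_dist_dist _ _))// opprB addrA subrK.
move: h; rewrite ler_norml => /andP[]; move: `|x - a| `|y - a| `|x - y| => u v w.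
by move=> h1 h2; rewrite ler_norml; case: (leP 0 (r - u)); case: (leP 0 (r - v)) => *; apply/andP; split; lra.
Qed.

Lemma msupport_sub_closed mu A : closed A -> mu (~` A) = 0%E -> msupport mu `<=` A.
Proof.
move=> cA muA x sx; apply: contrapT => nAx.
by have := sx (~` A) (closed_openC cA) nAx; rewrite muA ltxx.
Qed.

Lemma closed_msupport_null mu A : closed A -> msupport mu `<=` A -> mu (~` A) = 0%E.
Proof.
move=> cA muA; apply: msupport_null; first by apply: open_measurable; exact: closed_openC.
by rewrite -subset0 => x [nAx /muA].
Qed.

(** If F is in the closure, measures mu n with the required decay exist on
    sets contained in the 1/(n+1)-neighbourhood of F. A weak limit nu inherits
    the decay, since cosines and sines are Lipschitz. It is supported in F: at a
    point y outside F, the integral of a tent function around y is 0 for mu n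
    with n large, hence for nu, and y is not in the support of nu. *)
Lemma closed_fourier_decay s c : 0 <= c -> closed [set F : K01 |
  exists mu, msupport mu `<=` trace F /\ fourier_decay mu s c].
Proof.
move=> c0 F clF.
have cF : closed (trace F) by apply: compact_closed (@compact_trace _ F); exact: Rhausdorff.
pose W (n : nat) : set R := \bigcup_(a in trace F) ball a (n.+1%:R^-1).
have oW n : open (W n) by apply: bigcup_open => a _; exact: ball_open.
have FW n : trace F `<=` W n by move=> a Fa; exists a => //; exact: ballxx.
have /choice[mu hmu] : forall n, exists mu, [/\ mu (~` `[0, 1]%classic) = 0%E,
    mu (~` W n) = 0%E & fourier_decay mu s c].
  move=> n; have [|G [[mu [muG dec]] GW]] := clF [set G | trace G `<=` W n].
    by apply: open_nbhs_nbhs; split; [exact: open_subset|exact: FW].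
  exists mu; split=> //.
    apply: closed_msupport_null; first exact: interval_closed.
    by move=> x /muG /traceP x01; rewrite /= in_itv.
  apply: msupport_null; first by apply: measurableC; exact: open_measurable.
  by rewrite -subset0 => x [nW /muG/GW].
have [U [PU ooU [nu nuP]]] := helly_selection (fun n => let: And3 h _ _ := hmu n in h).
exists nu; split; last first.
  move=> x x0; apply/fourier_leP; first by rewrite mulr_ge0 ?powR_ge0.
  have lc := nuP _ _ _ (cos_lip x) (normr_ge0 _) (fun y => cos_max _).
  have ls := nuP _ _ _ (sin_lip x) (normr_ge0 _) (fun y => sin_max _).
  have l2 : (\int[mu n]_y cos (x * y)) ^+ 2 + (\int[mu n]_y sin (x * y)) ^+ 2
      @[n --> U] --> (\int[nu]_y cos (x * y)) ^+ 2 + (\int[nu]_y sin (x * y)) ^+ 2.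
    exact: cvgD (cvgM lc lc) (cvgM ls ls).
  apply: (cvgr_to_le l2); apply: filterE => n.
  have [_ _ /(_ x x0)/fourier_leP] := hmu n; apply.
  by rewrite mulr_ge0 ?powR_ge0.
move=> y sy; apply: contrapT => nFy.
have /nbhs_ballP[r /= r0 rF] : nbhs y (~` trace F).
  by apply: open_nbhs_nbhs; split=> //; exact: closed_openC.
pose g x : R := Num.max 0 (r / 2 - `|x - y|).
have gl : lip 1 g := tent_lip y (r / 2).
have gr x : `|g x| <= r / 2.
  rewrite /g ger0_norm ?le_max ?lexx//.
  by rewrite ge_max gerBl normr_ge0 andbT divr_ge0// ltW.
have g0 : \int[nu]_x g x = 0.
  apply: (cvg_unique _ (nuP g 1 _ gl ler01 gr)) => //.
  apply: cvg_near_cst; apply: ooU.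
  exists (Num.truncn (r / 2)^-1) => // n /= nr.
  have [_ muW _] := hmu n.
  rewrite (prob_full_Rintegral (open_measurable (oW n)) (lip_measurable gl) gr muW).
  rewrite (@eq_Rintegral _ _ _ _ _ (cst 0)) ?Rintegral_cst ?mul0r//.
    exact: open_measurable.
  move=> x /set_mem[a Fa]; rewrite /ball/= => ax.
  have an : n.+1%:R^-1 < r / 2.
    rewrite invf_plt ?posrE ?divr_gt0//.
    by apply: lt_le_trans (truncnS_gt _) _; rewrite ler_nat ltnS.
  have ya : r <= `|y - a|.
    by rewrite leNgt; apply/negP => /rF; apply.
  rewrite /g; apply/max_idPl; rewrite subr_le0.
  have := ler_distD x y a; rewrite (distrC y x) (distrC x a).
  by move: ax an ya; move: `|a - x| `|y - a| `|x - y| n.+1%:R^-1 => *; lra.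
pose B : set R := ball y (r / 4).
have mB : measurable B by apply: open_measurable; exact: ball_open.
have nuB : (0 < nu B)%E by apply: sy; [exact: ball_open|apply: ballxx; exact: divr_gt0].
have : r / 4 * fine (nu B) <= \int[nu]_x g x.
  have ig D : measurable D -> nu.-integrable D (EFin \o g).
    by move=> mD; exact: prob_integrable mD (lip_measurable gl) gr.
  rewrite -Rintegral_cst// -(setUv B) Rintegral_setU//; last 3 first.
  - exact: measurableC.
  - by rewrite setUv; exact: ig.
  - by apply/disj_set2P; rewrite setICr.
  rewrite -[leLHS]addr0 lerD//; last first.
    by apply: Rintegral_ge0 => x _; rewrite /g le_max lexx.
  apply: le_Rintegral => //; [|exact: ig|].
    by apply: (@prob_integrable _ _ _ _ `|r / 4|).
  move=> x; rewrite /B/ball/= => yx; rewrite /g le_max; apply/orP; right.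
  by move: yx; rewrite distrC; move: `|x - y| => z; lra.
rewrite g0 leNgt => /negP; apply; rewrite mulr_gt0 ?divr_gt0// fine_gt0// nuB/=.
by rewrite ltey_eq fin_num_measure.
Unshelve. all: by end_near. Qed.

End fourier_dimension_compact.

(** * The Salem sets form a Pi03 set *)

Section salem_Pi03.
Context {R : realType}.
Local Notation K01 := (compacts (set_type `[0 : R, 1 : R])).

Lemma trace_unit (F : K01) : trace F `<=` `[0, 1]%classic.
Proof. by move=> x /traceP x01; rewrite /= in_itv. Qed.

(** The complement is a union, over the covers with small sum, of the open
    sets of the F which they cover. *)
Lemma closed_content_ge s e : closed [set F : K01 | content_ge s e (trace F)].
Proof.
rewrite -openC.
have -> : ~` [set F : K01 | content_ge s e (trace F)] =
    \bigcup_(k in [set k : nat * ((nat -> R) * (nat -> R)) |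
        (forall i, (i < k.1)%N -> k.2.1 i < k.2.2 i) /\
        \sum_(i < k.1) (k.2.2 i - k.2.1 i) `^ s < e])
      [set F : K01 | trace F `<=` \bigcup_(i < k.1) `]k.2.1 i, k.2.2 i[%classic].
  apply/seteqP; split=> [F /= nF|F [[n [a b]] /= [ab sume]] Fcov Fe].
    apply: contrapT => nk; apply: nF => n a b [ab Fcov].
    rewrite leNgt; apply/negP => sume; apply: nk.
    by exists (n, (a, b)).
  by have := Fe n a b (conj ab Fcov); rewrite leNgt sume.
apply: bigcup_open => k _; apply: open_subset.
by apply: bigcup_open => i _; exact: interval_open.
Qed.

Lemma Fsigma_hausdorff_dim (p : R) : 0 <= p ->
  Fsigma [set F : K01 | p < hausdorff_dim (trace F)].
Proof.
move=> p0.
have -> : [set F : K01 | p < hausdorff_dim (trace F)] =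
    \bigcup_(k in [set: rat * nat]) (if p < ratr k.1 then
       [set F : K01 | content_ge (ratr k.1) k.2.+1%:R^-1 (trace F)] else set0).
  have gtP (F : K01) := hausdorff_dim_gtP (@compact_trace _ F) (@trace_unit F) p0.
  apply/seteqP; split=> [F /= /gtP[q [n [pq qF]]]|F [[q n] _] /=].
    by exists (q, n) => //=; rewrite pq.
  by case: ifPn => // pq qF; apply/gtP; exists q, n.
apply: Fsigma_bigcup => -[q n] /=; case: ifP => _; last exact: closed0.
exact: closed_content_ge.
Qed.

Lemma Fsigma_fourier_dim (p : R) : 0 <= p ->
  Fsigma [set F : K01 | p < fourier_dim (trace F)].
Proof.
move=> p0.
have -> : [set F : K01 | p < fourier_dim (trace F)] =
    \bigcup_(k in [set: rat * nat]) (if (p < ratr k.1) && (ratr k.1 <= 1 :> R) then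
       [set F : K01 | exists mu, msupport mu `<=` trace F /\
          fourier_decay mu (ratr k.1) k.2.+1%:R] else set0).
  apply/seteqP; split=> [F /= /(fourier_dim_gtP _ p0)[q [n [pq q1 qF]]]|F [[q n] _] /=].
    by exists (q, n) => //=; rewrite pq q1.
  by case: ifPn => // /andP[pq q1] qF; apply/(fourier_dim_gtP _ p0); exists q, n.
apply: Fsigma_bigcup => -[q n] /=; case: ifP => _; last exact: closed0.
exact: closed_fourier_decay.
Qed.

Lemma Pi03_salem : Pi0 3 [set F : K01 | salem (set_val @` F)].
Proof.
apply: Pi03_eq; first exact: open_Fsigma.
- by move=> F; apply: hausdorff_dim_ge0; exact: trace_unit.
- by move=> F; exact: fourier_dim_ge0.
- exact: Fsigma_hausdorff_dim.
- exact: Fsigma_fourier_dim.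
Qed.

End salem_Pi03.

(** * Pi03 subsets of zero-dimensional Polish spaces *)

Section zero_dimensional_polish.
Context {R : realType} {X : topologicalType}.
Hypotheses (polishX : polish R X) (clopenX : clopen_basis X).

(** A second countable space with a clopen basis: for each ball of a
    countable family that lies in some clopen subset of O, one such clopen set is
    chosen. The family consists of the balls b q n of radius 1/(n+1) around the
    points q of a countable dense set D, and f numbers them injectively. *)
Lemma open_clopen_bigcup (O : set X) : open O ->
  exists2 V : nat -> set X, (forall i, clopen (V i)) & O = \bigcup_i V i.
Proof.
move=> oO; have [[D cD dD] [d [d0 dsym dtri nbhsd _]]] := polishX.
have [B [Bo Bn] Bc] := clopenX.
have dnn x : d x x = 0 by apply/d0.
have /countable_injP[f finj] := cD.
pose b q (n : nat) := [set z | d q z < n.+1%:R^-1].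
have /choice[V hV] : forall k : nat * nat, exists V : set X, [/\ clopen V, V `<=` O &
    forall q, D q -> f q = k.1 -> (exists C, [/\ clopen C, C `<=` O & b q k.2 `<=` C]) ->
      b q k.2 `<=` V].
  move=> [m n] /=.
  have [[q [Dq fq [C [cC CO bC]]]]|nq] := pselect (exists q, [/\ D q, f q = m &
      exists C, [/\ clopen C, C `<=` O & b q n `<=` C]]).
    exists C; split=> // q' Dq' fq' _.
    by have -> // : q' = q by apply: finj; [exact: mem_set|exact: mem_set|rewrite fq].
  exists set0; split=> //; first by split; [exact: open0|exact: closed0].
  by move=> q Dq fq hC; exfalso; apply: nq; exists q.
exists (fun k => if @choice.unpickle (nat * nat)%type k is Some k then V k else set0).
  move=> k; case: choice.unpickle => [k'|]; first by have [] := hV k'.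
  by split; [exact: open0|exact: closed0].
apply/seteqP; split=> [x Ox|x [k _]]; last first.
  by case: choice.unpickle => // k' Vx; have [_ VO _] := hV k'; exact: VO.
have [C [BC Cx] CO] : exists2 C, B C /\ C x & C `<=` O.
  by have [C] := Bn x O (open_nbhs_nbhs (conj oO Ox)); exists C.
have : nbhs x C by apply: open_nbhs_nbhs; split=> //; exact: Bo.
rewrite nbhsd => -[e /= e0 eC].
pose n := Num.truncn (e / 2)^-1.
have ne : n.+1%:R^-1 < e / 2 by rewrite invf_plt ?posrE ?divr_gt0// truncnS_gt.
have n0 : 0 < n.+1%:R^-1 :> R by rewrite invr_gt0.
have : nbhs x (b x n) by rewrite nbhsd; exists n.+1%:R^-1.
rewrite nbhsE => -[W [oW Wx] Wb].
have [q [Wq Dq]] := dD W (ex_intro _ x Wx) oW.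
have xq : d x q < n.+1%:R^-1 := Wb q Wq.
exists (choice.pickle (f q, n)); first by [].
rewrite choice.pickleK; have [_ _ hq] := hV (f q, n).
apply: (hq q) => //=; last by rewrite /b/= dsym.
exists C; split=> //; first exact: Bc.
move=> z /= qz; apply: eC => /=; apply: le_lt_trans (dtri x q z) _.
by rewrite (splitr e) ltrD// (lt_trans _ ne).
Qed.

(** Inversion of the inductive definition with the level kept as a
    variable. *)
Lemma Sigma0_inv n (S : set X) : Sigma0 n S -> (n = 1%N /\ open S) \/
  ((1 < n)%N /\ exists (m : nat -> nat) (F : nat -> set X), [/\ forall i, (m i < n)%N,
     forall i, Sigma0 (m i) (~` F i) & S = \bigcup_i F i]).
Proof.
case=> [A oA|{}n m F n1 mn mF]; first by left.
by right; split=> //; exists m, F.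
Qed.

Lemma Sigma0_lt3_Fsigma n (S : set X) : (n < 3)%N -> Sigma0 n S -> Fsigma S.
Proof.
move=> n3 /Sigma0_inv[[_ oS]|[n1 [m [F [mn mF ->]]]]].
  have [V cV ->] := open_clopen_bigcup oS.
  by exists V => // i; have [] := cV i.
exists F => // i; rewrite -openC.
have [[_ //]|[m1 _]] := Sigma0_inv (mF i).
by have := mn i; rewrite ltnNge (leq_trans _ m1)//.
Qed.

Lemma near_clopen (V : set X) x : clopen V -> \forall y \near x, V y <-> V x.
Proof.
move=> [oV cV]; have [Vx|nVx] := pselect (V x).
  by apply: filterS (open_nbhs_nbhs (conj oV Vx)) => y Vy.
by apply: filterS (open_nbhs_nbhs (conj (closed_openC cV) nVx)) => y nVy; split.
Qed.

Let ecst (u : nat -> nat) := exists J, forall j, (J <= j)%N -> u j.+1 = u j.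

(** The set of the x such that x avoids V k l for all l, for some k, is a
    general F_sigma set. At time j, kappa is the least k <= j such that x avoids
    V k l for all l <= j, and j + 1 if there is none: it depends on finitely many
    clopen conditions and is nondecreasing in j, and it is bounded, equivalently
    eventually constant, exactly when some k works forever. *)
Lemma Fsigma_witness (V : nat -> nat -> set X) : (forall k l, clopen (V k l)) ->
  exists kappa : nat -> X -> nat,
    (forall j x, \forall y \near x, kappa j y = kappa j x) /\
    (forall x, (exists k, forall l, ~ V k l x) <-> ecst (kappa^~ x)).
Proof.
move=> cV; pose p j x k := `[< forall l, (l <= j)%N -> ~ V k l x >].
have pS i j x k : (i <= j)%N -> p j x k -> p i x k.
  by move=> ij /asboolP h; apply/asboolP => l li; apply: h; exact: leq_trans ij.
pose kappa j x := find (p j x) (iota 0 j.+1).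
have kappa_le j x k : p j x k -> (k <= j)%N -> (kappa j x <= k)%N.
  move=> pk kj; rewrite leqNgt; apply/negP => /(before_find 0).
  by rewrite nth_iota// add0n pk.
have kappa_gt j x k : (forall i, (i <= k)%N -> ~~ p j x i) -> (k <= j)%N -> (k < kappa j x)%N.
  move=> npk kj; rewrite ltnNge; apply/negP => kk.
  have : has (p j x) (iota 0 j.+1) by rewrite has_find size_iota ltnS (leq_trans kk).
  by move=> /(nth_find 0); rewrite nth_iota ?ltnS ?(leq_trans kk)// add0n; exact/negP/npk.
have kappa_nd i j x : (i <= j)%N -> (kappa i x <= kappa j x)%N.
  move=> ij; case k : (kappa i x) => [//|k'].
  apply: kappa_gt; last first.
    apply: leq_trans ij; have := find_size (p i x) (iota 0 i.+1).
    by rewrite -/(kappa i x) k size_iota.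
  move=> i' i'k; apply/negP => /(pS i _ _ _ ij) pi.
  have ki : (kappa i x <= i.+1)%N by rewrite -[leqRHS](size_iota 0) find_size.
  have : (kappa i x <= i')%N by apply: kappa_le => //; rewrite (leq_trans i'k)// -ltnS -k.
  by rewrite k ltnNge i'k.
exists kappa; split=> [j x|x].
  have : \forall y \near x, forall kl : 'I_j.+1 * 'I_j.+1, V kl.1 kl.2 y <-> V kl.1 kl.2 x.
    by apply: filter_forall => kl; exact: near_clopen.
  apply: filterS => y yx; apply: eq_in_find => k; rewrite mem_iota/= add0n => kj.
  apply/asboolP/asboolP => h l lj; have := h l lj.
    by have /= [_] := yx (Ordinal kj, Ordinal (lj : (l < j.+1)%N)); exact: contra_not.
  by have /= [+ _] := yx (Ordinal kj, Ordinal (lj : (l < j.+1)%N)); exact: contra_not.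
split=> [[k kV]|[J Jcst]].
  have bnd j : (k <= j)%N -> (kappa j x <= k)%N.
    by move=> kj; apply: kappa_le => //; apply/asboolP.
  apply: contrapT => nec.
  (* A nondecreasing sequence that changes infinitely often is unbounded. *)
  have grow n : exists2 j, (k <= j)%N & (n <= kappa j x)%N.
    elim: n => [|n [j kj nj]]; first by exists k.
    have : ~ forall j', (j <= j')%N -> kappa j'.+1 x = kappa j' x.
      by move=> h; apply: nec; exists j.
    move=> /existsNP[i /not_implyP[ji /eqP ki]]; exists i.+1; first by rewrite (leq_trans kj)// (leq_trans ji).
    rewrite (leq_ltn_trans nj)// (leq_ltn_trans (kappa_nd _ _ x ji))//.
    by rewrite ltn_neqAle eq_sym ki kappa_nd.
  have [j kj] := grow k.+1.
  by rewrite leqNgt ltnS bnd.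
apply: contrapT => nk.
have V_ex k : exists l, V k l x.
  apply: contrapT => nl; apply: nk; exists k => l Vx; apply: nl; by exists l.
have [l hl] := choice V_ex.
pose M := kappa J x.
(* At this time all the candidates k <= M have been refuted. *)
pose j := (J + M + \sum_(k < M.+1) l k)%N.
have Jj : (J <= j)%N by rewrite /j -addnA leq_addr.
have kj : kappa j x = M.
  rewrite -(subnK Jj); elim: (j - J)%N => [|n ih]; first by rewrite add0n.
  by rewrite addSn Jcst// leq_addl.
have : (M < kappa j x)%N.
  apply: kappa_gt => [i iM|]; last by rewrite /j addnAC leq_addl.
  apply/negP => /asboolP/(_ (l i)); apply => //.
  rewrite /j (leq_trans _ (leq_addl _ _))//.
  have iM' : (i < M.+1)%N by [].
  by rewrite (bigD1 (Ordinal iM'))//= leq_addr.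
by rewrite kj ltnn.
Qed.

(** A is a countable intersection of F_sigma sets, each with its sequence
    kappa i of witnesses. The number r j x is the first i <= j such that the i-th
    witness changes between times j and j + 1 (j + 1 if there is none): it is at
    least m from some time on exactly when the first m witnesses become
    constant. *)
Lemma Pi03_limit (A : set X) : Pi0 3 A ->
  exists r : nat -> X -> nat,
    (forall j x, \forall y \near x, r j y = r j x) /\
    (forall x, A x <-> forall m, exists J, forall j, (J <= j)%N -> (m <= r j x)%N).
Proof.
move=> /Sigma0_inv[[]//|[_ [n [F [n3 nF AF]]]]].
have /choice[kappa /all_and2[kc kA]] : forall i, exists kappa : nat -> X -> nat,
    (forall j x, \forall y \near x, kappa j y = kappa j x) /\
    (forall x, (~` F i) x <-> ecst (kappa^~ x)).
  move=> i; have [G cG GE] := Sigma0_lt3_Fsigma (n3 i) (nF i).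
  have /choice[V hV] : forall k, exists V : nat -> set X, (forall l, clopen (V l)) /\
      ~` G k = \bigcup_l V l.
    by move=> k; have [V cV VE] := open_clopen_bigcup (closed_openC (cG k)); exists V.
  have [kappa [kc kE]] := Fsigma_witness (fun k l => (hV k).1 l).
  exists kappa; split=> // x; rewrite -kE GE; split=> [[k _ Gk]|[k nV]].
    exists k => l Vx; have : (~` G k) x by rewrite (hV k).2; exists l.
    by apply.
  exists k => //; apply: contrapT => nG.
  by have : (~` G k) x by []; rewrite (hV k).2 => -[l _ /nV].
pose c j x i := kappa i j.+1 x != kappa i j x.
exists (fun j x => find (c j x) (iota 0 j.+1)); split=> [j x|x].
  have : \forall y \near x, forall i : 'I_j.+1,
      kappa i j.+1 y = kappa i j.+1 x /\ kappa i j y = kappa i j x.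
    by apply: filter_forall => i; apply: filterI; exact: kc.
  apply: filterS => y yx; apply: eq_in_find => i; rewrite mem_iota/= add0n => ij.
  by rewrite /c; have /= [-> ->] := yx (Ordinal ij).
have Ax : A x <-> forall i, ecst (kappa i ^~ x).
  rewrite -[A]setCK AF setC_bigcup; split=> [h i|h i _]; last exact/kA.
  by apply/kA; exact: h.
rewrite Ax; split=> [h m|h i].
  have [J hJ] := choice h.
  exists (m + \sum_(i < m) J i)%N => j mj.
  rewrite leqNgt; apply/negP => fm.
  have mj' : (m <= j)%N by rewrite (leq_trans _ mj)// leq_addr.
  have : has (c j x) (iota 0 j.+1) by rewrite has_find size_iota ltnS ltnW// (leq_trans fm).
  move=> /(nth_find 0); rewrite nth_iota ?ltnS ?(leq_trans (ltnW fm))// add0n /c.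
  move: (find _ _) fm => i im; rewrite hJ ?eqxx//.
  apply: leq_trans mj; rewrite (bigD1 (Ordinal im))//= addnCA leq_addr//.
have [J hJ] := h i.+1; exists (i + J)%N => j ij.
have /hJ : (J <= j)%N by rewrite (leq_trans _ ij)// leq_addl.
move=> /(before_find 0); rewrite nth_iota ?add0n; first by move=> /negbT; rewrite negbK => /eqP.
by rewrite ltnS (leq_trans _ ij)// leq_addr.
Qed.

End zero_dimensional_polish.

(** * Sets defined by nonzero blocks of binary digits *)

Section block_sets.
Context {R : realType}.
Local Notation I01 := (set_type `[0 : R, 1 : R]).
Local Notation K01 := (compacts I01).

(** Compactness is transferred through the inclusion by means of
    ultrafilters: a limit in R of the image ultrafilter lies in [0,1]. *)
Lemma compact_preimage_unit (C : set R) : closed C ->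
  compact ((set_val : I01 -> R) @^-1` C).
Proof.
move=> cC; rewrite compact_ultra => U ultraU UC.
have : compact (C `&` `[0, 1]%classic : set R).
  apply: (@subclosed_compact _ _ (`[0, 1]%classic : set R)) => //.
  - by apply: closedI => //; exact: interval_closed.
  - exact: segment_compact.
rewrite compact_ultra => /(_ (set_val @ U)) [].
- apply: Build_UltraFilter => G PG fUG.
  apply/seteqP; split=> [A GA|]; last exact: fUG.
  have [//|UA] := in_ultra_setVsetC (set_val @^-1` A) ultraU.
  have := @filter_ex _ _ PG _ (filterI GA (fUG (~` A) UA)).
  by case=> x [].
- apply: (@filterS _ U _ _ _ _ UC) => x Cx; split=> //.
  exact: set_valP.
move=> l [[Cl l01] Ul].
exists (exist _ l (mem_set l01)); split=> //.
move=> A [B [[W oW <-] Wl BA]].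
apply: (@filterS _ U _ _ _ BA).
by apply: Ul; exact: open_nbhs_nbhs.
Qed.

Definition unit_compact (C : set R) (cC : closed C) : K01 := Compacts (compact_preimage_unit cC).

Lemma trace_unit_compact (C : set R) (cC : closed C) : C `<=` `[0, 1]%classic ->
  trace (unit_compact cC) = C.
Proof.
move=> C01; apply/seteqP; split=> [_ [x Cx <-]//|x Cx].
by exists (exist _ x (mem_set (C01 _ Cx))).
Qed.

(** The binary digits of y at the positions m + 1, ..., m + d are not all
    zero: the fractional part of 2^m y is at least 2^(-d). The integer a is the
    integral part; for y >= 0 it is a natural number. *)
Definition keep (m d : nat) : set R :=
  [set y | exists a : nat, a%:R + 2 ^- d <= 2 ^+ m * y < a.+1%:R].

(** The dyadic interval of length 2^(-m) with index k, that is the y >= 0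
    whose expansion up to the position m is that of k/2^m. *)
Definition cell (m k : nat) : set R := [set y | k%:R <= 2 ^+ m * y < k.+1%:R].

Lemma cell_ex m y : 0 <= y < 1 -> exists2 k, (k < 2 ^ m)%N & cell m k y.
Proof.
move=> /andP[y0 y1]; exists (Num.truncn (2 ^+ m * y)).
  by rewrite truncn_lt_nat ?mulr_ge0 ?exprn_ge0// natrX gtr_pMr ?exprn_gt0.
by apply: truncn_itv; rewrite mulr_ge0 ?exprn_ge0.
Qed.

(** Only the digits up to the position m + d matter. *)
Lemma keep_cell m d m' k y y' : (m + d <= m')%N -> cell m' k y -> cell m' k y' ->
  keep m d y -> keep m d y'.
Proof.
move=> mdm' /andP[ky yk] /andP[ky' yk'] [a /andP[ay ya]]; exists a.
(* Multiplied by 2^(d+e), the conditions compare integers with 2^m' y, and only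
   its integral part k matters. *)
pose e := (m' - (m + d))%N.
have pe : 0 < 2 ^+ (d + e) :> R by rewrite exprn_gt0.
have em' : 2 ^+ m' = 2 ^+ (d + e) * 2 ^+ m :> R.
  by rewrite -exprD; congr (_ ^+ _); rewrite /e; lia.
have lowE : 2 ^+ (d + e) * (a%:R + 2 ^- d) = (2 ^ (d + e) * a + 2 ^ e)%:R :> R.
  rewrite mulrDr natrD natrM natrX; congr (_ + _).
  by rewrite exprD mulrAC divff ?mul1r ?natrX// expf_neq0.
have upE : 2 ^+ (d + e) * a.+1%:R = (2 ^ (d + e) * a.+1)%:R :> R.
  by rewrite natrM natrX.
have lowk : (2 ^ (d + e) * a + 2 ^ e <= k)%N.
  rewrite -ltnS -(ltr_nat R) -lowE; apply: le_lt_trans yk.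
  by rewrite em' -mulrA ler_pM2l.
have upk : (k < 2 ^ (d + e) * a.+1)%N.
  rewrite -(ltr_nat R) -upE; apply: le_lt_trans ky _.
  by rewrite em' -mulrA ltr_pM2l.
apply/andP; split.
  rewrite -(ler_pM2l pe) lowE mulrA -em'; apply: le_trans ky'.
  by rewrite ler_nat.
rewrite -(ltr_pM2l pe) upE mulrA -em'; apply: lt_le_trans yk' _.
by rewrite ler_nat.
Qed.

Lemma pow2_mod3 e : ((2 ^ e) %% 3 = 1 \/ (2 ^ e) %% 3 = 2)%N.
Proof.
elim: e => [|e ih]; first by left.
by rewrite expnS -modnMmr; case: ih => ->; [right|left].
Qed.

(** The expansion of 1/3 is 0.010101..., so that after the position m any
    two consecutive digits of (k + 1/3)/2^m contain a one. These numbers serve as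
    points of the block sets that realize any given initial digits. *)
Lemma third_keep m m' d (k : nat) : (m <= m')%N -> (1 < d)%N ->
  keep m' d ((k%:R + 3^-1) / 2 ^+ m).
Proof.
move=> mm' d1; pose e := (m' - m)%N; rewrite /keep/=.
have -> : 2 ^+ m' * ((k%:R + 3^-1) / 2 ^+ m) = (2 ^ e * k)%:R + (2 ^ e)%:R / 3 :> R.
  have -> : 2 ^+ m' = 2 ^+ e * 2 ^+ m :> R by rewrite -exprD /e subnK.
  by rewrite natrM natrX -mulrA [2 ^+ m * _]mulrC divfK ?expf_neq0// mulrDr.
exists (2 ^ e * k + 2 ^ e %/ 3)%N.
have d4 : 2 ^- d <= 4^-1 :> R.
  rewrite lef_pV2 ?posrE ?exprn_gt0// -natrX ler_nat.
  by rewrite -[4%N]/(2 ^ 2)%N leq_exp2l.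
have E3 : (2 ^ e)%:R = (2 ^ e %/ 3)%:R * 3 + ((2 ^ e) %% 3)%:R :> R.
  by rewrite {1}(divn_eq (2 ^ e) 3) natrD natrM.
rewrite -[X in _ && (_ < X)]natr1 natrD E3.
by have [->|->] := pow2_mod3 e; apply/andP; split; lra.
Qed.

Definition block_set (n d : nat -> nat) : set R :=
  [set y | 0 <= y < 1 /\ forall j, keep (n j) (d j) y].

Section admissible.
Context (n d d' : nat -> nat).
Hypotheses (d_gt1 : forall j, (1 < d j)%N) (d'_gt1 : forall j, (1 < d' j)%N).
Hypotheses (nd : forall j, (n j + d j <= n j.+1)%N).

Lemma level_mono i j : (i < j)%N -> (n i + d i <= n j)%N.
Proof.
elim: j => // j ih; rewrite ltnS leq_eqVlt => /predU1P[->|/ih h]; first exact: nd.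
by rewrite (leq_trans h)// (leq_trans _ (nd j))// leq_addr.
Qed.

Lemma level_ge j : (j <= n j)%N.
Proof. by elim: j => // j ih; have := nd j; have := d_gt1 j; lia. Qed.

(** A point y' of the second set close to y is obtained by keeping the
    first n_J digits of y and continuing with the digits of 1/3. *)
Lemma block_set_close J y : (forall j, (j < J)%N -> d' j = d j) ->
  block_set n d y -> exists2 y', block_set n d' y' & `|y - y'| <= 2 ^- n J.
Proof.
move=> dd' [y01 ky]; have [k kn kc] := cell_ex (n J) y01.
have N0 : 0 < 2 ^+ n J :> R by rewrite exprn_gt0.
pose y' : R := (k%:R + 3^-1) / 2 ^+ n J.
have y'E : 2 ^+ n J * y' = k%:R + 3^-1 by rewrite mulrC divfK// lt0r_neq0.
have kc' : cell (n J) k y' by rewrite /cell/= y'E -[k.+1%:R]natr1; apply/andP; split; lra.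
have kN : k.+1%:R <= 2 ^+ n J :> R by rewrite -natrX ler_nat.
exists y'.
  split.
    rewrite /y' divr_ge0 ?addr_ge0 ?exprn_ge0//= ltr_pdivrMr// mul1r.
    by apply: lt_le_trans kN; rewrite -[k.+1%:R]natr1; lra.
  move=> j; have [jJ|Jj] := ltnP j J.
    by rewrite dd'//; apply: keep_cell kc kc' (ky j); exact: level_mono.
  apply: third_keep => //; case: ltngtP Jj => // [Jj _|-> _]; last by [].
  by rewrite (leq_trans _ (level_mono Jj))// leq_addr.
rewrite -[leRHS]mul1r ler_pdivlMr// -[X in _ * X]gtr0_norm// -normrM mulrBl.
rewrite ![_ * 2 ^+ _]mulrC y'E.
move: kc; rewrite /cell/= -[k.+1%:R]natr1 => /andP[h1 h2].
by rewrite ler_norml; apply/andP; split; lra.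
Qed.

End admissible.

(** The block sets are not closed (1 is a limit of numbers whose expansions
    start with many ones); passing to the closure
    affects neither bound on the dimension. *)
Definition block_closure n d : set R := closure (block_set n d).

Lemma block_closure_unit n d : block_closure n d `<=` `[0, 1]%classic.
Proof.
have c01 : closed (`[0, 1]%classic : set R) by exact: interval_closed.
rewrite [X in _ `<=` X](closure_id _).1//; apply: closure_subset.
by move=> y [/andP[y0 y1] _]; rewrite /= in_itv/= y0 ltW.
Qed.

Definition block_compact n d : K01 := unit_compact (@closed_closure _ (block_set n d)).

Lemma trace_block_compact n d : trace (block_compact n d) = block_closure n d.
Proof. by apply: trace_unit_compact; exact: block_closure_unit. Qed.

Lemma closure_close (A B : set R) (e : R) : 0 < e ->
  (forall x, A x -> exists2 y, B y & `|x - y| <= e / 2) ->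
  forall x, closure A x -> exists2 y, closure B y & `|x - y| < e.
Proof.
move=> e0 AB x Ax.
have [z [Az xz]] := Ax _ (nbhsx_ballx x (e / 2) (divr_gt0 e0 (ltr0Sn R 1))).
have [y By zy] := AB z Az.
exists y; first exact: subset_closure.
rewrite (le_lt_trans (ler_distD z _ _))// (splitr e) ltr_leD//.
Qed.

Lemma block_compact_continuous (X : topologicalType) (n : nat -> nat) (d : X -> nat -> nat) :
  (forall x j, (1 < d x j)%N) -> (forall x j, (n j + d x j <= n j.+1)%N) ->
  (forall x j, \forall y \near x, d y j = d x j) ->
  continuous (fun x => block_compact n (d x)).
Proof.
move=> d1 nd dc; apply: continuous_hausdorff => x e e0.
pose J := Num.truncn (e / 2)^-1.
have He : 2 ^- n J.+1 <= e / 2 :> R.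
  rewrite invf_ple ?posrE ?exprn_gt0 ?divr_gt0//.
  apply: le_trans (ltW (truncnS_gt _)) _; rewrite -natrX ler_nat.
  by rewrite (leq_trans (level_ge (d1 x) (nd x) J.+1))// ltnW// ltn_expl.
have : \forall y \near x, forall j : 'I_J.+1, d y j = d x j.
  by apply: filter_forall => j; exact: dc.
apply: filterS => y yx.
have dyx j : (j < J.+1)%N -> d y j = d x j by move=> jJ; exact: (yx (Ordinal jJ)).
rewrite /hausdorff_close !trace_block_compact; split=> z.
  move: z; apply: (closure_close (A := block_set n (d x)) (B := block_set n (d y))) => // u hu.
  have [v yv uv] := block_set_close (d1 y) (nd x) dyx hu.
  by exists v => //; exact: le_trans uv He.
move=> hz.
have [|w hw zw] := @closure_close (block_set n (d y)) (block_set n (d x)) e e0 _ z hz; last first.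
  by exists w; [exact: hw|rewrite distrC].
move=> u hu.
have [v yv uv] := block_set_close (d1 x) (nd y) (fun j jJ => esym (dyx j jJ)) hu.
by exists v => //; exact: le_trans uv He.
Qed.

End block_sets.

(** * Lebesgue measure of the block sets *)

Section block_measure.
Context {R : realType}.
Implicit Types (m d k : nat) (y : R).
Local Notation leb := (@lebesgue_measure R).

(** The part of the m-cell with index k where the next d digits vanish. *)
Definition piece m d k : set R := `[k%:R / 2 ^+ m, (k%:R + 2 ^- d) / 2 ^+ m[%classic.

Lemma pieceP m d k y : piece m d k y <-> k%:R <= 2 ^+ m * y < k%:R + 2 ^- d.
Proof.
by rewrite /piece/= in_itv/= ler_pdivrMr ?exprn_gt0// ltr_pdivlMr ?exprn_gt0// (mulrC y).
Qed.

Lemma invpow2_le1 d : 2 ^- d <= 1 :> R.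
Proof. by rewrite invf_le1 ?exprn_gt0// exprn_ege1// ler1n. Qed.

Lemma invpow2_gt0 d : 0 < 2 ^- d :> R. Proof. by rewrite invr_gt0 exprn_gt0. Qed.

Lemma piece_cell m d k y : piece m d k y -> cell m k y.
Proof.
move=> /pieceP /andP[h1 h2]; rewrite /cell/= -[k.+1%:R]natr1 h1/= (lt_le_trans h2)//.
by rewrite lerD2l invpow2_le1.
Qed.

Lemma cell_inj m k k' y : cell m k y -> cell m k' y -> k = k'.
Proof.
move=> /andP[h1 h2] /andP[h3 h4]; apply/eqP; rewrite eqn_leq -ltnS -(ltnS k') -!(ltr_nat R).
by rewrite (le_lt_trans h1)// (le_lt_trans h3).
Qed.

Lemma not_keepP m d y : 0 <= y < 1 ->
  ~ keep m d y <-> exists2 k, (k < 2 ^ m)%N & piece m d k y.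
Proof.
move=> y01; split=> [nk|[k km pk] [a /andP[h1 h2]]].
  have [k km kc] := cell_ex m y01; exists k => //; apply/pieceP.
  move: kc => /andP[h1 h2]; rewrite h1/= ltNge; apply/negP => h3; apply: nk.
  by exists k; rewrite h3.
have ca : cell m a y.
  by rewrite /cell/= h2 andbT (le_trans _ h1)// lerDl ltW// invpow2_gt0.
have ka := cell_inj ca (piece_cell pk); move/pieceP : pk; rewrite -ka => /andP[_].
by rewrite ltNge h1.
Qed.

Lemma lebesgue_piece m d k : leb (piece m d k) = (2 ^- d / 2 ^+ m)%:E.
Proof.
rewrite /piece lebesgue_measure_itv/= lte_fin ltr_pM2r ?invr_gt0 ?exprn_gt0//.
by rewrite ltrDl invpow2_gt0 -EFinB -mulrBl [_ + 2 ^- d]addrC addrK.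
Qed.

Lemma measurable_piece m d k : measurable (piece m d k).
Proof. exact: measurable_itv. Qed.

Context (n d : nat -> nat).
Hypothesis (nd : forall j, (n j + d j <= n j.+1)%N).

Definition stage J : set R :=
  [set y | 0 <= y < 1 /\ forall j, (j < J)%N -> keep (n j) (d j) y].

(** Membership in [stage] J is constant on the cells of level n J, so that
    testing the left end point decides whether the whole piece is removed at step
    J. *)
Definition removed J k : set R :=
  if `[< stage J (k%:R / 2 ^+ n J) >] then piece (n J) (d J) k else set0.

Definition removed_upto J M : set R := \big[setU/set0]_(k < M) removed J k.

Lemma measurable_removed J k : measurable (removed J k).
Proof. by rewrite /removed; case: ifP => _; [exact: measurable_piece|]. Qed.

Lemma measurable_removed_upto J M : measurable (removed_upto J M).
Proof. by apply: bigsetU_measurable => k _; exact: measurable_removed. Qed.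

Lemma stage_cell J k y y' : (k < 2 ^ n J)%N -> cell (n J) k y -> cell (n J) k y' ->
  stage J y -> stage J y'.
Proof.
move=> kn ky ky' [y01 sy]; split.
  have N0 : 0 < 2 ^+ n J :> R by rewrite exprn_gt0.
  move: ky' => /andP[h1 h2]; rewrite -(ler_pM2l N0) mulr0 (le_trans _ h1)//=.
  by rewrite -(ltr_pM2l N0) mulr1 (lt_le_trans h2)// -natrX ler_nat.
by move=> j jJ; apply: keep_cell ky ky' (sy j jJ); exact: level_mono.
Qed.

Lemma stageS J : stage J = stage J.+1 `|` removed_upto J (2 ^ n J).
Proof.
have N0 : 2 ^+ n J != 0 :> R by rewrite expf_neq0.
have kc k : cell (n J) k (k%:R / 2 ^+ n J : R).
  apply/andP; rewrite mulrC divfK// lexx; split => //; by rewrite ltr_nat.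
rewrite /removed_upto -bigcup_mkord; apply/seteqP; split=> [y [y01 sy]|y [[y01 sy]|]].
- have [ky|/(not_keepP _ _ y01)[k kn pk]] := pselect (keep (n J) (d J) y).
    left; split=> // j; rewrite ltnS leq_eqVlt => /predU1P[->//|]; exact: sy.
  right; exists k => //=; rewrite /removed ifT//; apply/asboolP.
  by apply: (stage_cell kn (piece_cell pk) (kc k)); split.
- by split=> // j jJ; apply: sy; exact: ltnW.
- move=> [k /= kn]; rewrite /removed; case: ifPn => // /asboolP sk pk.
  exact: stage_cell (kc k) (piece_cell pk) sk.
Qed.

Lemma stageS_disj J : stage J.+1 `&` removed_upto J (2 ^ n J) = set0.
Proof.
rewrite /removed_upto -bigcup_mkord -subset0 => y [[y01 sy] [k /= kn]].
rewrite /removed; case: ifPn => // _ pk.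
by apply: ((not_keepP (n J) (d J) y01).2 _ (sy J (ltnSn J))); exists k.
Qed.

Lemma stage0 : stage 0 = `[0, 1[%classic.
Proof. by apply/seteqP; split=> y /=; rewrite in_itv/=; [case|split]. Qed.

Lemma measurable_stage J : measurable (stage J).
Proof.
elim: J => [|J ih]; first by rewrite stage0; exact: measurable_itv.
suff -> : stage J.+1 = stage J `\` removed_upto J (2 ^ n J).
  by apply: measurableD => //; exact: measurable_removed_upto.
rewrite [in RHS]stageS setDUl setDv setU0.
by apply/esym/setDidl; exact: stageS_disj.
Qed.

Lemma block_set_stage : block_set n d = \bigcap_J stage J.
Proof.
apply/seteqP; split=> [y [y01 sy] J _|y sy]; first by split=> // j _; exact: sy.
split=> [|j]; first by have [] := sy 0%N I.
by have [_] := sy j.+1 I; apply.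
Qed.

Lemma measurable_block_set : measurable (block_set n d : set R).
Proof. by rewrite block_set_stage; apply: bigcap_measurable => // J _; exact: measurable_stage. Qed.

Lemma lebesgue_removed J : (leb (removed_upto J (2 ^ n J)) <= (2 ^- d J)%:E)%E.
Proof.
apply: le_trans (content_subadditive leb (fun k _ => measurable_removed J k)
  (measurable_removed_upto _ _) (@subset_refl _ _)) _.
apply: (@le_trans _ _ (\sum_(k < 2 ^ n J) (2 ^- d J / 2 ^+ n J)%:E)%E).
  apply: lee_sum => k _; rewrite /removed; case: ifP => _; first by rewrite /= lebesgue_piece.
  by rewrite measure0 lee_fin divr_ge0 ?exprn_ge0// ltW// invpow2_gt0.
by rewrite sumEFin lee_fin sumr_const card_ord -[leLHS]mulr_natr natrX divfK ?expf_neq0.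
Qed.

Lemma lebesgue_stage_fin J : leb (stage J) \is a fin_num.
Proof.
rewrite ge0_fin_numE//; apply: (@le_lt_trans _ _ (leb `[0, 1[%classic)).
  apply: le_measure; [apply/mem_set; exact: measurable_stage|apply/mem_set; exact: measurable_itv|].
  by move=> y [y01 _]; rewrite /= in_itv.
by rewrite lebesgue_measure_itv/= lte_fin ltr01 ltry.
Qed.

Lemma lebesgue_stageS J :
  (leb (stage J) = leb (stage J.+1) + leb (removed_upto J (2 ^ n J)))%E.
Proof.
rewrite {1}stageS measureU//; [exact: measurable_stage|exact: measurable_removed_upto|].
exact: stageS_disj.
Qed.

Hypothesis (d_ge : forall j, (j + 3 <= d j)%N).

(** Step j removes at most 2^(-d j) <= 2^(-j-3), in total at most 1/4. *)
Lemma lebesgue_stage_ge J : ((3 / 4 : R)%:E <= leb (stage J))%E.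
Proof.
(* The partial sums of 2^(-j-3), in a form suited to induction. *)
suff h : ((1 - 4^-1 * (1 - (1 / 2) ^+ J) : R)%:E <= leb (stage J))%E.
  apply: le_trans h; rewrite lee_fin.
  have : 0 <= (1 / 2 : R) ^+ J by rewrite exprn_ge0.
  by lra.
elim: J => [|J ih].
  by rewrite expr0 subrr mulr0 subr0 stage0 lebesgue_measure_itv/= lte_fin ltr01 sube0.
have := lebesgue_removed J; have := lebesgue_stageS J.
rewrite -(fineK (lebesgue_stage_fin J)) -(fineK (lebesgue_stage_fin J.+1)) in ih *.
have rf : leb (removed_upto J (2 ^ n J)) \is a fin_num.
  by rewrite ge0_fin_numE// (le_lt_trans (lebesgue_removed J))// ltry.
rewrite -(fineK rf) -EFinD => -[e1]; rewrite !lee_fin => h1.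
move: ih; rewrite lee_fin e1 => h2.
have : 2 ^- d J <= 8^-1 * (1 / 2) ^+ J :> R.
  have -> : 8^-1 * (1 / 2) ^+ J = 2 ^- (J + 3) :> R.
    by rewrite div1r exprVn -invfM mulrC exprD; congr (_ * _)^-1; lra.
  by rewrite lef_pV2 ?posrE ?exprn_gt0// ler_weXn2l// ler1n.
move: h2 h1; rewrite exprS; move: ((1 / 2) ^+ J) (2 ^- d J) => a b.
by move=> h2 h1 h3; lra.
Qed.

Lemma lebesgue_stage_cvg : leb (stage J) @[J --> \oo] --> leb (block_set n d).
Proof.
rewrite block_set_stage; apply: nonincreasing_cvg_mu.
- by rewrite ltey_eq lebesgue_stage_fin.
- exact: measurable_stage.
- by rewrite -block_set_stage; exact: measurable_block_set.
- move=> i j ij; apply/subsetPset => y [y01 sy]; split=> // k ki.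
  by apply: sy; exact: leq_trans ij.
Qed.

Lemma lebesgue_block_set_ge : ((3 / 4 : R)%:E <= leb (block_set n d))%E.
Proof.
apply: (cvge_ge _ lebesgue_stage_cvg); apply: filterE => J.
exact: lebesgue_stage_ge.
Qed.

End block_measure.

(** * Oscillatory integrals over the block sets *)

Section interval_integrals.
Context {R : realType}.
Local Notation leb := (@lebesgue_measure R).

Lemma lebesgue_bounded_integrable (A : set R) (f : R -> R) C : measurable A ->
  (leb A < +oo)%E -> measurable_fun setT f -> (forall x, `|f x| <= C) ->
  leb.-integrable A (EFin \o f).
Proof.
move=> mA fA mf fC; apply: measurable_bounded_integrable => //.
  exact: measurable_funS mf.
by exists C; split=> [|D CD x _]; [exact: num_real|exact: le_trans (fC x) (ltW CD)].
Qed.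

Lemma Rintegral_itv_FTC (F f : R -> R) (a b : R) : a <= b ->
  (forall x : R, is_derive x (1 : R) F (f x)) -> continuous f ->
  (forall x, `|f x| <= 1) -> \int[leb]_(x in `[a, b[) f x = F b - F a.
Proof.
rewrite le_eqVlt => /predU1P[->|ab] dF cf f1.
  by rewrite set_itvco0 Rintegral_set0 subrr.
have mf : measurable_fun setT f by exact: continuous_measurable_fun.
rewrite Rintegral_itv_bndo_bndc; last first.
  apply: (@lebesgue_bounded_integrable _ _ 1) => //.
  by rewrite lebesgue_measure_itv/=; case: ifP => _; rewrite -?EFinB ltry.
have cF : continuous F.
  move=> z; apply: differentiable_continuous.
  by apply/derivable1_diffP; have [] := dF z.
rewrite /Rintegral (@continuous_FTC2 _ f F)//.
- exact: continuous_subspaceT.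
- split.
  + by move=> z _; have [] := dF z.
  + exact/cvg_at_right_filter/cF.
  + exact/cvg_at_left_filter/cF.
- by move=> z _; rewrite derive1E; exact: derive_val.
Qed.

(** The primitive of f (xi x) is g (xi x) / xi, which is bounded by
    1/|xi|. This covers cosines and sines alike. *)
Lemma Rintegral_scale_le (f g : R -> R) (xi a b : R) : xi != 0 -> a <= b ->
  (forall x : R, is_derive x (1 : R) g (f x)) -> continuous f ->
  (forall x, `|f x| <= 1) -> (forall x, `|g x| <= 1) ->
  `|\int[leb]_(x in `[a, b[) f (xi * x)| <= 2 / `|xi|.
Proof.
move=> xi0 ab dg cf f1 g1.
have dF (x : R) : is_derive x (1 : R) (fun x => xi^-1 * g (xi * x)) (f (xi * x)).
  have dm : is_derive x (1 : R) (fun x => xi * x) (xi * 1) by exact: is_deriveZ.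
  have h := is_deriveZ xi^-1 (is_derive1_comp (dg (xi * x)) dm).
  by apply: is_derive_eq h _; rewrite /GRing.scale/=; field.
have cfx : continuous (fun x => f (xi * x)).
  by move=> x; apply: continuous_comp; [exact: mulrl_continuous|exact: cf].
rewrite (Rintegral_itv_FTC ab dF cfx (fun x => f1 _)).
rewrite -mulrBr normrM mulrC normfV ler_wpM2r ?invr_ge0//.
by rewrite (le_trans (ler_normB _ _))// -[2]/(1 + 1) lerD.
Qed.

Lemma Rintegral_cos_itv (xi a b : R) : xi != 0 -> a <= b ->
  `|\int[leb]_(x in `[a, b[) cos (xi * x)| <= 2 / `|xi|.
Proof.
move=> xi0 ab; apply: (@Rintegral_scale_le cos sin) => //.
- exact: continuous_cos.
- exact: cos_max.
- exact: sin_max.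
Qed.

Lemma Rintegral_sin_itv (xi a b : R) : xi != 0 -> a <= b ->
  `|\int[leb]_(x in `[a, b[) sin (xi * x)| <= 2 / `|xi|.
Proof.
move=> xi0 ab; apply: (@Rintegral_scale_le sin (fun x => - cos x)) => //.
- by move=> x; apply: is_derive_eq (is_deriveN _) _; rewrite opprK.
- exact: continuous_sin.
- exact: sin_max.
- by move=> x; rewrite normrN; exact: cos_max.
Qed.

End interval_integrals.

Section block_integral.
Context {R : realType}.
Local Notation leb := (@lebesgue_measure R).
Context (n d : nat -> nat).
Hypothesis (nd : forall j, (n j + d j <= n j.+1)%N).
Context (h : R -> R) (K : R).
Hypotheses (mh : measurable_fun setT h) (h1 : forall x, `|h x| <= 1).
Hypothesis (hK : forall a b, a <= b -> `|\int[leb]_(x in `[a, b[) h x| <= K).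
Local Notation stage := (@stage R n d).
Local Notation removed := (@removed R n d).
Local Notation removed_upto := (@removed_upto R n d).
Local Notation block_set := (@block_set R n d).

Let K0 : 0 <= K. Proof. exact: le_trans (normr_ge0 _) (hK (lexx 0)). Qed.

Let stage_fin J : (leb (stage J) < +oo)%E.
Proof. by rewrite -ge0_fin_numE//; exact: lebesgue_stage_fin. Qed.

Let sub_fin (A B : set R) : measurable A -> measurable B -> A `<=` B ->
  (leb B < +oo)%E -> (leb A < +oo)%E.
Proof. by move=> mA mB AB; apply: le_lt_trans; apply: le_measure => //; apply/mem_set. Qed.

Let removed_fin J M : (leb (removed_upto J M) < +oo)%E.
Proof.
apply: le_lt_trans (content_subadditive leb (fun k _ => measurable_removed n d J k)
  (measurable_removed_upto _ _ _ _) (@subset_refl _ _)) _.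
rewrite lte_sum_pinfty// => k _; rewrite /removed.
by case: ifP => _; [rewrite /= lebesgue_piece ltry|rewrite measure0 ltry].
Qed.

Lemma Rintegral_removed_count J M : `|\int[leb]_(x in removed_upto J M) h x| <= M%:R * K.
Proof.
elim: M => [|M ih]; first by rewrite /removed_upto big_ord0 Rintegral_set0 normr0 mul0r.
have mM := @measurable_removed_upto R n d J M.
have mr := @measurable_removed R n d J M.
rewrite /removed_upto big_ord_recr/= -/(removed_upto J M) Rintegral_setU//; last 2 first.
- apply: lebesgue_bounded_integrable mh h1; first exact: measurableU.
  by have := removed_fin J M.+1; rewrite /removed_upto big_ord_recr.
- apply/disj_set2P; rewrite /removed_upto -bigcup_mkord -subset0 => y [[k /= kM]].
  rewrite /removed; case: ifP => // _ pk; case: ifP => // _ pM.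
  by have := cell_inj (piece_cell pk) (piece_cell pM) => kME; rewrite kME ltnn in kM.
rewrite -natr1 mulrDl mul1r (le_trans (ler_normD _ _))// lerD//.
rewrite /removed; case: ifP => _; last by rewrite Rintegral_set0 normr0.
by apply: hK; rewrite ler_pM2r ?invr_gt0 ?exprn_gt0// lerDl ltW// invpow2_gt0.
Qed.

Let le_measure_Rintegral (A : set R) : measurable A -> (leb A < +oo)%E ->
  `|\int[leb]_(x in A) h x| <= fine (leb A).
Proof.
move=> mA fA; have ih := lebesgue_bounded_integrable mA fA mh h1.
apply: le_trans (le_normr_Rintegral _ ih) _ => //.
rewrite -[leRHS]mul1r -Rintegral_cst//; apply: le_Rintegral => //.
- apply: lebesgue_bounded_integrable (_ : forall x, `| `|h x| | <= 1) => //.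
    by apply: measurableT_comp.
  by move=> x; rewrite normr_id.
- by apply: lebesgue_bounded_integrable (_ : forall x, `|1| <= 1) => // _; rewrite normr1.
Qed.

(** The set removed at step J is a union of 2^n_J intervals and has total
    length at most 2^(-d_J). *)
Lemma Rintegral_removed_min J : `|\int[leb]_(x in removed_upto J (2 ^ n J)) h x| <=
  Num.min (2 ^- d J) (2 ^+ n J * K).
Proof.
rewrite le_min; apply/andP; split; last by rewrite -natrX Rintegral_removed_count.
apply: le_trans (le_measure_Rintegral _ (removed_fin _ _)) _.
  exact: measurable_removed_upto.
rewrite -lee_fin fineK; first exact: lebesgue_removed.
by rewrite ge0_fin_numE.
Qed.

Lemma Rintegral_stage J : `|\int[leb]_(x in stage J) h x| <=
  K + \sum_(j < J) Num.min (2 ^- d j) (2 ^+ n j * K).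
Proof.
elim: J => [|J ih]; first by rewrite big_ord0 addr0 stage0; exact: hK.
have mS := @measurable_stage R n d nd J.+1.
have mr := @measurable_removed_upto R n d J (2 ^ n J).
have : \int[leb]_(x in stage J) h x = \int[leb]_(x in stage J.+1) h x +
    \int[leb]_(x in removed_upto J (2 ^ n J)) h x.
  rewrite (stageS nd J) Rintegral_setU//.
    by rewrite -stageS//; apply: lebesgue_bounded_integrable mh h1 => //; exact: measurable_stage.
  by apply/disj_set2P; exact: stageS_disj.
move=> /eqP; rewrite -subr_eq => /eqP <-.
rewrite big_ord_recr/= addrA (le_trans (ler_normB _ _))// lerD//.
exact: Rintegral_removed_min.
Qed.

(** The function h has integral at most K over every interval; the case of
    interest is a cosine or a sine of frequency xi, with K = 2/|xi|. *)
Lemma Rintegral_block_set (B : R) :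
  (forall J, \sum_(j < J) Num.min (2 ^- d j) (2 ^+ n j * K) <= B) ->
  `|\int[leb]_(x in block_set) h x| <= K + B.
Proof.
move=> sB; have mE := @measurable_block_set R n d nd.
have ES J : (block_set : set R) `<=` stage J.
  by rewrite block_set_stage => y; apply.
have Efin : (leb (block_set) < +oo)%E
  by exact: (sub_fin mE (@measurable_stage R n d nd 0%N) (ES 0%N) (stage_fin 0)).
have bnd J : `|\int[leb]_(x in block_set) h x| <=
    K + B + (fine (leb (stage J)) - fine (leb (block_set))).
  have mS := @measurable_stage R n d nd J.
  have mD : measurable (stage J `\` block_set) by exact: measurableD.
  have SE : stage J = block_set `|` (stage J `\` block_set).
    by rewrite setDUK//; exact: ES.
  have Dfin : (leb (stage J `\` block_set) < +oo)%E.
    by apply: sub_fin (stage_fin J) => //; exact: subDsetl.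
  have disj : block_set `&` (stage J `\` block_set) = set0 by rewrite -subset0 => y [? []].
  have iE : \int[leb]_(x in stage J) h x = \int[leb]_(x in block_set) h x +
      \int[leb]_(x in stage J `\` block_set) h x.
    rewrite {1}SE Rintegral_setU//; last by apply/disj_set2P.
    by rewrite -SE; exact: lebesgue_bounded_integrable mh h1.
  have lE : fine (leb (stage J)) = fine (leb (block_set)) +
      fine (leb (stage J `\` block_set)).
    by rewrite -fineD ?ge0_fin_numE// -measureU// -SE.
  have -> : \int[leb]_(x in block_set) h x =
      \int[leb]_(x in stage J) h x - \int[leb]_(x in stage J `\` block_set) h x.
    by rewrite iE addrK.
  rewrite lE [X in _ <= _ + X]addrAC subrr add0r (le_trans (ler_normB _ _))// lerD//.
    by rewrite (le_trans (Rintegral_stage J))// lerD2l.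
  exact: le_measure_Rintegral.
have lim : K + B + (fine (leb (stage J)) - fine (leb (block_set))) @[J --> \oo] --> K + B.
  rewrite -[X in _ --> X]addr0; apply: cvgD; first exact: cvg_cst.
  rewrite -(subrr (fine (leb (block_set)))); apply: cvgB; last exact: cvg_cst.
  apply: fine_cvg; rewrite fineK ?ge0_fin_numE//; exact: lebesgue_stage_cvg.
by apply: (cvgr_to_ge lim); apply: filterE => J; exact: bnd.
Qed.

End block_integral.

(** * Lower bound for the Fourier dimension of the block sets *)

Section normalized_lebesgue.
Context {R : realType}.
Local Notation leb := (@lebesgue_measure R).
Local Notation borel_probability := (probability (measurableTypeR R) R).

(** Integration against a rescaled measure is first carried out for the
    nonnegative function 1 + h, which h >= -1 permits; the constant 1 is then
    subtracted. *)
Lemma normalized_lebesgue (E : set R) : measurable E -> (0 < leb E < +oo)%E ->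
  exists mu : borel_probability, mu (~` E) = 0%E /\
    forall h : R -> R, measurable_fun setT h -> (forall x, `|h x| <= 1) ->
      \int[mu]_x h x = (fine (leb E))^-1 * \int[leb]_(x in E) h x.
Proof.
move=> mE /andP[E0 Eoo].
have Efin : leb E \is a fin_num by rewrite ge0_fin_numE// ltW.
pose c := fine (leb E).
have c0 : 0 < c by rewrite fine_gt0// E0.
(* The Dirac mass is the default value of the normalization of a measure of mass
   0 or infinity. *)
pose mu : borel_probability := mnormalize (mrestr leb mE) (@dirac _ (measurableTypeR R) (0 : R) R).
have rT : mrestr leb mE [set: measurableTypeR R] = leb E by rewrite /mrestr setTI.
have muE A : measurable A -> mu A = (leb (A `&` E) * c^-1%:E)%E.
  move=> mA; rewrite /mu /= /mnormalize /= rT ifF//.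
  by apply/negP => /orP[/eqP h|/eqP h]; [move: E0|move: Eoo]; rewrite h ltxx.
have muC : mu (~` E) = 0%E.
  by rewrite muE; [rewrite setICl measure0 mul0e|exact: measurableC].
exists mu; split=> // h mh h1.
have m1 : measurable_fun setT (fun x => 1 + h x) by exact: measurable_funD.
have k0 : 0 <= c^-1 by rewrite invr_ge0 ltW.
have I1 : (\int[mu]_(x in E) (1 + h x)%:E = c^-1%:E * \int[leb]_(x in E) (1 + h x)%:E)%E.
  rewrite (@eq_measure_integral _ (measurableTypeR R) _ E (mscale (NngNum k0) leb)); last first.
    move=> A mA AE; apply: (etrans (muE A mA)); rewrite (setIidl AE) /mscale/=.
    by rewrite muleC.
  rewrite ge0_integral_mscale//.
    by apply/measurable_EFinP; exact: measurable_funS m1.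
  by move=> x _; rewrite lee_fin; have := h1 x; rewrite ler_norml => /andP[]; lra.
have ih : leb.-integrable E (EFin \o h) by exact: lebesgue_bounded_integrable mh h1.
have i1 : leb.-integrable E (EFin \o (fun=> 1)).
  by apply: (@lebesgue_bounded_integrable _ _ _ 1) => // x; rewrite normr1.
have mih : mu.-integrable E (EFin \o h) by exact: prob_integrable h1.
have mi1 : mu.-integrable E (EFin \o (fun=> 1)).
  by apply: (@prob_integrable _ _ _ _ 1) => // x; rewrite normr1.
rewrite (prob_full_Rintegral mE mh h1 muC).
have i1h : leb.-integrable E (EFin \o (fun x => 1 + h x)).
  apply: (@lebesgue_bounded_integrable _ _ _ 2) => // x.
  by rewrite (le_trans (ler_normD _ _))// normr1 -[leRHS]/(1 + 1) lerD2l.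
have : \int[mu]_(x in E) (1 + h x) = c^-1 * \int[leb]_(x in E) (1 + h x).
  by rewrite /Rintegral I1 fineM// integrable_fin_num.
rewrite !RintegralD// !Rintegral_cst// !mul1r mulrDr.
set z := (X in X + _ = _ -> _).
have -> : z = 1.
  have muE1 : mu E = 1%E by rewrite (muE E mE) setIid -(fineK Efin) -EFinM divff ?gt_eqF.
  by rewrite /z -[RHS]/(fine 1%E) -muE1.
by rewrite mulVf ?gt_eqF// => /addrI.
Qed.

End normalized_lebesgue.

Section block_fourier_lower.
Context {R : realType}.
Local Notation leb := (@lebesgue_measure R).

(** A minimum is below every weighted geometric mean. *)
Lemma min_le_geometric (a b t : R) : 0 <= a -> 0 <= b -> 0 <= t <= 1 ->
  Num.min a b <= a `^ (1 - t) * b `^ t.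
Proof.
move=> a0 b0 /andP[t0 t1]; have m0 : 0 <= Num.min a b by rewrite le_min a0.
have [->|mn0] := eqVneq (Num.min a b) 0; first by rewrite mulr_ge0 ?powR_ge0.
rewrite -{1}(powRr1 m0) -{1}(subrK t 1) powRD; last by rewrite mn0 implybT.
by apply: ler_pM; rewrite ?powR_ge0//; apply: ge0_ler_powR;
  rewrite ?nnegrE ?subr_ge0// ge_min lexx ?orbT.
Qed.

Lemma sum_le_geometric (u : nat -> R) j0 : (forall j, 0 <= u j) ->
  (forall j, (j0 <= j)%N -> u j <= (1 / 2) ^+ j) ->
  forall J, \sum_(j < J) u j <= \sum_(j < j0) u j + 2.
Proof.
move=> u0 uj0 J.
(* The geometric tail, in a form suited to induction on J. *)
suff : \sum_(j < J) u j <= \sum_(j < j0) u j + (2 - 2 * (1 / 2) ^+ J).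
  by move=> /le_trans; apply; rewrite lerD2l gerBl mulr_ge0 ?exprn_ge0.
elim: J => [|J ih].
  by rewrite big_ord0 expr0 mulr1 subrr addr0 sumr_ge0.
have [Jj0|j0J] := ltnP J j0.
  apply: (@le_trans _ _ (\sum_(j < j0) u j)); last first.
    rewrite lerDl subr_ge0 -[leRHS]mulr1 ler_wpM2l// exprn_ile1//; lra.
  rewrite -!(big_mkord xpredT u) (big_cat_nat (n := J.+1) (p := j0))//=.
  by rewrite lerDl sumr_ge0.
rewrite big_ord_recr/=; have := uj0 J j0J; rewrite exprS.
by move: ih; move: (_ ^+ J) (u J) (\sum_(_ < _) _) (\sum_(_ < _) _) => *; lra.
Qed.

(** The contribution of step j to the transform at x is at most a constant
    times 2^(n_j t - d_j (1-t)) |x|^(-t), and the hypothesis makes the first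
    factor at most 2^(-j) for large j. *)
Lemma block_fourier_dim_ge (n d : nat -> nat) (t : R) :
  (forall j, (n j + d j <= n j.+1)%N) -> (forall j, (j + 3 <= d j)%N) ->
  0 <= t <= 1 / 2 ->
  (exists j0, forall j, (j0 <= j)%N -> (n j)%:R * t + j%:R <= (d j)%:R * (1 - t)) ->
  2 * t <= fourier_dim (block_closure n d : set R).
Proof.
move=> nd dge /andP[t0 t1] [j0 hj0].
have t01 : 0 <= t <= 1 by rewrite t0 (le_trans t1)//; lra.
pose u j : R := 2 `^ ((n j)%:R * t - (d j)%:R * (1 - t)).
have u0 j : 0 <= u j by exact: powR_ge0.
have uj0 j : (j0 <= j)%N -> u j <= (1 / 2) ^+ j.
  move=> /hj0 h; have -> : (1 / 2) ^+ j = 2 `^ (- j%:R) :> R.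
    by rewrite powRN powR_mulrn// div1r exprVn.
  by rewrite ler_powR ?ler1n//; lra.
pose B := \sum_(j < j0) u j + 2.
have B0 : 0 <= B by rewrite addr_ge0// sumr_ge0.
have uB J : \sum_(j < J) u j <= B := sum_le_geometric u0 uj0 J.
pose E : set R := block_set n d.
have E34 : ((3 / 4 : R)%:E <= leb E)%E := @lebesgue_block_set_ge R n d nd dge.
have Eoo : (leb E < +oo)%E.
  apply: (@le_lt_trans _ _ (leb (stage n d 0))); last first.
    by rewrite -ge0_fin_numE//; exact: lebesgue_stage_fin.
  apply: le_measure; [apply/mem_set; exact: measurable_block_set|apply/mem_set; exact: measurable_stage|].
  by rewrite /E block_set_stage => y; apply.
have [||mu [muE muI]] := @normalized_lebesgue R E.
- exact: measurable_block_set.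
- by rewrite Eoo andbT (lt_le_trans _ E34)// lte_fin; lra.
have minu (x : R) J : 1 <= `|x| -> \sum_(j < J) Num.min (2 ^- d j) (2 ^+ n j * (2 / `|x|)) <=
    2 * B * `|x| `^ (- t).
  move=> x1; have x0 : 0 < `|x| by exact: lt_le_trans x1.
  apply: (@le_trans _ _ (\sum_(j < J) u j * (2 * `|x| `^ (- t)))).
    apply: ler_sum => j _.
    apply: le_trans (min_le_geometric _ _ t01) _.
    - by rewrite invr_ge0 exprn_ge0.
    - by rewrite mulr_ge0 ?exprn_ge0 ?divr_ge0.
    have -> : 2 ^- d j = 2 `^ (- (d j)%:R) :> R by rewrite powRN powR_mulrn.
    rewrite -powRrM !powRM ?exprn_ge0 ?invr_ge0 ?mulr_ge0//.
    rewrite -powR_mulrn// -powRrM !mulrA -powRD ?(pnatr_eq0 _ 2) ?implybT//.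
    rewrite -(powR_inv1 (ltW x0)) -powRrM mulN1r [X in 2 `^ X]addrC mulNr.
    rewrite -/(u j) ler_wpM2r ?powR_ge0// ler_wpM2l// -[leRHS]powRr1//.
    by apply: ler_powR; rewrite ?ler1n//; case/andP: t01.
  rewrite -mulr_suml mulrA [2 * B]mulrC ler_wpM2r ?powR_ge0// ler_wpM2r//.
have hbound (h : R -> R) (x : R) : measurable_fun setT h -> (forall y, `|h y| <= 1) ->
    (forall a b, a <= b -> `|\int[leb]_(y in `[a, b[) h y| <= 2 / `|x|) -> 1 <= `|x| ->
    `|\int[mu]_y h y| <= 4 / 3 * (2 + 2 * B) * `|x| `^ (- t).
  move=> mh h1 hK x1; have x0 : 0 < `|x| by exact: lt_le_trans x1.
  have := Rintegral_block_set nd mh h1 hK (fun J => minu x J x1).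
  rewrite muI// normrM -/E => hE.
  have c34 : `|(fine (leb E))^-1| <= 4 / 3.
    have cE : 3 / 4 <= fine (leb E) by rewrite -lee_fin fineK ?ge0_fin_numE.
    rewrite ger0_norm ?invr_ge0//; last by apply: le_trans cE; lra.
    by rewrite -[4 / 3]invf_div lef_pV2 ?posrE ?divr_gt0// (lt_le_trans _ cE)// divr_gt0.
  rewrite -mulrA; apply: ler_pM => //; apply: le_trans hE _.
  rewrite [leRHS]mulrDl lerD2r ler_pM2l// -(powR_inv1 (ltW x0)) ler_powR// lerN2.
  by case/andP: t01.
pose C := 2 * (4 / 3 * (2 + 2 * B)).
have C2 : 2 <= C by rewrite /C; lra.
apply: (@fourier_decay_dim _ mu (2 * t) C).
- by rewrite mulr_ge0//=; lra.
- exact: lt_le_trans C2.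
- apply: msupport_sub_closed; first exact: closed_closure.
  apply: subset_measure0 muE.
  + by apply: measurableC; apply: measurable_realfun.closed_measurable; exact: closed_closure.
  + by apply: measurableC; exact: measurable_block_set.
  + by apply: subsetC; exact: subset_closure.
move=> x x0.
have -> : 2 * t / 2 = t by rewrite mulrAC divff ?mul1r.
have nx0 : 0 < `|x| by rewrite normr_gt0.
have [x1|x1] := leP 1 `|x|; last first.
  apply: le_trans (fourier_le2 mu x) _; rewrite lecR (le_trans C2)// ler_peMr//.
    exact: le_trans C2.
  rewrite -[leLHS](powRr0 `|x|) ger_powR//; first by rewrite nx0 ltW.
  by rewrite oppr_le0.
apply/fourier_leP; first by rewrite mulr_ge0 ?powR_ge0// (le_trans _ C2).
have hc := hbound _ x (lip_measurable (cos_lip x)) (fun y => cos_max _)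
  (fun a b ab => Rintegral_cos_itv x0 ab) x1.
have hs := hbound _ x (lip_measurable (sin_lip x)) (fun y => sin_max _)
  (fun a b ab => Rintegral_sin_itv x0 ab) x1.
have sq (a b : R) : `|a| <= b -> a ^+ 2 <= b ^+ 2.
  move=> ab; rewrite -real_normK ?num_real// ler_pXn2r// nnegrE.
  exact: le_trans ab.
have := sq _ _ hc; have := sq _ _ hs.
rewrite /C -!mulrA [X in _ -> _ -> _ <= X]exprMn.
move: (_ ^+ 2) (_ ^+ 2) => a b.
set c := (_ ^+ 2) => ac bc.
have c0 : 0 <= c by exact: sqr_ge0.
by lra.
Qed.

End block_fourier_lower.

(** * Trigonometric polynomials with sine coefficients *)

Section trigonometric_identities.
Context {R : realType}.
Implicit Types (a g : nat -> R) (L : nat) (x th : R).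

(** The real part, and with [ssum] the imaginary part, of the trigonometric
    polynomial A(x) = sum_j a_j e^(ijx); [energy] is the squared l2-norm of its
    coefficients. *)
Definition csum L a x := \sum_(j < L) a j * cos (j%:R * x).
Definition ssum L a x := \sum_(j < L) a j * sin (j%:R * x).
Definition energy L a := \sum_(j < L) a j ^+ 2.

(** The boundary terms of the shift vanish because a is zero at 0 and L. *)
Lemma shift_sum L a g : a 0%N = 0 -> a L = 0 ->
  \sum_(j < L) a j.+1 * g j.+1 = \sum_(j < L) a j * g j.
Proof.
move=> a0 aL; have : \sum_(j < L.+1) a j * g j = \sum_(j < L.+1) a j * g j by [].
by rewrite {1}big_ord_recl big_ord_recr/= a0 aL !mul0r add0r addr0.
Qed.

(** Taking differences of the coefficients multiplies A(x) by
    e^(-ix) - 1, whose squared modulus is 2 (1 - cos x). *)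
Lemma difference_transform L a x : a 0%N = 0 -> a L = 0 ->
  csum L (fun j => a j.+1 - a j) x ^+ 2 + ssum L (fun j => a j.+1 - a j) x ^+ 2 =
  2 * (1 - cos x) * (csum L a x ^+ 2 + ssum L a x ^+ 2).
Proof.
move=> a0 aL.
have -> : csum L (fun j => a j.+1 - a j) x =
    (cos x - 1) * csum L a x + sin x * ssum L a x.
  have := shift_sum (fun j => cos (j%:R * x - x)) a0 aL.
  rewrite (eq_bigr (fun j : 'I_L => a j.+1 * cos (j%:R * x))); last first.
    by move=> j _; rewrite -natr1 mulrDl mul1r addrK.
  move=> h; rewrite /csum (eq_bigr (fun j : 'I_L => a j.+1 * cos (j%:R * x) - a j * cos (j%:R * x))).
    rewrite sumrB h /ssum !mulr_sumr -sumrB -big_split/=.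
    by apply: eq_bigr => j _; rewrite cosB; ring.
  by move=> j _; rewrite mulrBl.
have -> : ssum L (fun j => a j.+1 - a j) x =
    (cos x - 1) * ssum L a x - sin x * csum L a x.
  have := shift_sum (fun j => sin (j%:R * x - x)) a0 aL.
  rewrite (eq_bigr (fun j : 'I_L => a j.+1 * sin (j%:R * x))); last first.
    by move=> j _; rewrite -natr1 mulrDl mul1r addrK.
  move=> h; rewrite /ssum (eq_bigr (fun j : 'I_L => a j.+1 * sin (j%:R * x) - a j * sin (j%:R * x))).
    rewrite sumrB h /csum !mulr_sumr -!sumrB.
    by apply: eq_bigr => j _; rewrite sinB; ring.
  by move=> j _; rewrite mulrBl.
have := cos2Dsin2 x; move: (cos x) (sin x) (csum L a x) (ssum L a x) => c s A B cs.
have : ((c - 1) * A + s * B) ^+ 2 + ((c - 1) * B - s * A) ^+ 2 =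
    ((c - 1) ^+ 2 + s ^+ 2) * (A ^+ 2 + B ^+ 2) by ring.
by move=> ->; have -> : s ^+ 2 = 1 - c ^+ 2 by [rewrite -cs addrAC subrr add0r]; ring.
Qed.

(** The vector (sin (j pi/L))_j is an eigenvector of the discrete Dirichlet
    Laplacian, since a_(j+1) + a_(j-1) = 2 cos (pi/L) a_j. *)
Lemma sine_energy L : (0 < L)%N -> let a j : R := sin (j%:R * (pi / L%:R)) in
  energy L (fun j => a j.+1 - a j) = 2 * (1 - cos (pi / L%:R)) * energy L a.
Proof.
move=> L0 a; set th := pi / L%:R.
have a0 : a 0%N = 0 by rewrite /a mul0r sin0.
have aL : a L = 0 by rewrite /a mulrC divfK ?pnatr_eq0 -?lt0n// sinpi.
have S1 : \sum_(j < L) a j.+1 ^+ 2 = energy L a.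
  by rewrite /energy; under [RHS]eq_bigr do rewrite expr2; rewrite -shift_sum.
have S2 : \sum_(j < L) a j.+1 * a j = cos th * energy L a.
  have h := shift_sum (fun j => sin (j%:R * th - th)) a0 aL.
  have {}h : \sum_(j < L) a j.+1 * a j = \sum_(j < L) a j * sin (j%:R * th - th).
    by rewrite -h; apply: eq_bigr => j _; rewrite -natr1 mulrDl mul1r addrK.
  have h2 : \sum_(j < L) a j * (a j.+1 + sin (j%:R * th - th)) = 2 * cos th * energy L a.
    rewrite /energy mulr_sumr; apply: eq_bigr => j _.
    rewrite /a -/th -natr1 mulrDl mul1r sinD sinB; ring.
  move: h2; under eq_bigr do rewrite mulrDr; rewrite big_split/= -h.
  under eq_bigr do rewrite mulrC.
  by move: (\sum_(_ < _) _) (energy _ _) (cos th) => u v w; lra.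
rewrite /energy (eq_bigr (fun j : 'I_L => a j.+1 ^+ 2 + a j ^+ 2 - 2 * (a j.+1 * a j))).
  by rewrite sumrB big_split/= -mulr_sumr S1 S2 -/(energy L a); ring.
by move=> j _; ring.
Qed.

Lemma sine_energy_gt0 L : (1 < L)%N -> 0 < energy L (fun j => sin (j%:R * (pi / L%:R)) : R).
Proof.
move=> L1; rewrite /energy (bigD1 (Ordinal L1))//= ltr_wpDr//.
  by apply: sumr_ge0 => j _; exact: sqr_ge0.
rewrite mul1r exprn_gt0// sin_gt0_pi// divr_gt0 ?pi_gt0 ?ltr0n ?(ltn_trans _ L1)//=.
by rewrite ltr_pdivrMr ?ltr0n ?(ltn_trans _ L1)// ltr_pMr ?pi_gt0// ltr1n.
Qed.

(** The cosine decreases with the distance to 0 on the circle, and the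
    hypotheses place z at distance at least th from 0. *)
Lemma cos_gap th (z : R) : 0 <= th <= z -> z <= 2 * pi - th -> cos z <= cos th.
Proof.
move=> /andP[th0 thz] zth.
pose p := (z + th) / 2; pose q := (z - th) / 2.
have -> : z = p + q by rewrite /p /q; lra.
have -> : th = p - q by rewrite /p /q; lra.
rewrite cosB cosD -subr_ge0 [leRHS](_ : _ = 2 * (sin p * sin q)); last by ring.
rewrite !mulr_ge0//; apply: sin_ge0_pi; rewrite /p /q; apply/andP; split; lra.
Qed.

End trigonometric_identities.

(** * A gap inequality for measures on the circle *)

Section toeplitz.
Context {R : realType}.
Implicit Types (u g : nat -> R) (L : nat).

Lemma toeplitz_row g L j : (forall k, 0 <= g k) -> g 0%N = 0 -> (j < L)%N ->
  \sum_(l < L) (g (j - l)%N + g (l - j)%N) <= 2 * \sum_(k < L) g k.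
Proof.
move=> g0 g00 jL; rewrite big_split/= mulr_natl mulr2n; apply: lerD.
  rewrite -!(big_mkord xpredT) -(big_mkord xpredT (fun l => g (j - l)%N)).
  rewrite (big_cat_nat (n := j.+1))//= [X in _ + X]big1_seq ?addr0; last first.
    by move=> l /=; rewrite mem_index_iota => /andP[/ltnW jl _]; rewrite (eqP jl) g00.
  rewrite big_nat_rev/= add0n [leRHS](big_cat_nat (n := j.+1))//=.
  rewrite -[leLHS]addr0; apply: lerD; last exact: sumr_ge0.
  rewrite le_eqVlt; apply/orP; left; apply/eqP; apply: eq_big_nat => l /andP[_ lj].
  by rewrite subSS subKn.
rewrite -(big_mkord xpredT g) -(big_mkord xpredT (fun l => g (l - j)%N)).
rewrite (big_cat_nat (n := j))//=; last exact: ltnW.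
rewrite [X in X + _]big1_seq ?add0r; last first.
  by move=> l /=; rewrite mem_index_iota => /andP[_ /ltnW jl]; rewrite (eqP jl) g00.
rewrite -{1}(add0n j) big_addn.
rewrite [leRHS](big_cat_nat (n := (L - j)%N))//=; last exact: leq_subr.
rewrite -[leLHS]addr0; apply: lerD; last exact: sumr_ge0.
by rewrite le_eqVlt; apply/orP; left; apply/eqP; apply: eq_bigr => l _; rewrite addnK.
Qed.

(** A matrix with ones on the diagonal and small Toeplitz off-diagonal
    entries is close to the identity as a quadratic form (Schur's test). In
    g (j - l) + g (l - j) one of the truncated differences is 0 and g 0 = 0, so
    that the sum is g |j - l|. *)
Lemma toeplitz_form L u g (m : nat -> nat -> R) : (forall k, 0 <= g k) -> g 0%N = 0 ->
  (forall j, m j j = 1) ->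
  (forall j l, j != l -> `|m j l| <= g (j - l)%N + g (l - j)%N) ->
  `|\sum_(j < L) \sum_(l < L) u j * u l * m j l - energy L u| <=
    (2 * \sum_(k < L) g k) * energy L u.
Proof.
move=> g0 g00 m1 mg; pose w j l := g (j - l)%N + g (l - j)%N.
have wC j l : w j l = w l j by rewrite /w addrC.
have -> : \sum_(j < L) \sum_(l < L) u j * u l * m j l - energy L u =
    \sum_(j < L) \sum_(l < L) (if j == l then 0 else u j * u l * m j l).
  rewrite /energy -sumrB; apply: eq_bigr => j _.
  rewrite (bigD1 j)//= m1 mulr1 -expr2 addrAC subrr add0r.
  rewrite [RHS](bigD1 j)//= eqxx add0r; apply: eq_bigr => l lj.
  by rewrite eq_sym (negbTE lj).
(* Schur's test: |u_j u_l| <= (u_j^2 + u_l^2)/2 and the row sums of w are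
   bounded by [toeplitz_row]. *)
have half : \sum_(j < L) \sum_(l < L) u j ^+ 2 * w j l <= (2 * \sum_(k < L) g k) * energy L u.
  rewrite /energy mulr_sumr; apply: ler_sum => j _; rewrite -mulr_sumr mulrC.
  by rewrite ler_wpM2r ?sqr_ge0//; exact: toeplitz_row.
apply: le_trans half; apply: le_trans (ler_norm_sum _ _ _) _.
have -> : \sum_(j < L) \sum_(l < L) u j ^+ 2 * w j l =
    \sum_(j < L) \sum_(l < L) (u j ^+ 2 + u l ^+ 2) / 2 * w j l.
  have e : \sum_(j < L) \sum_(l < L) u l ^+ 2 * w j l = \sum_(j < L) \sum_(l < L) u j ^+ 2 * w j l.
    rewrite exchange_big/=; apply: eq_bigr => j _; apply: eq_bigr => l _; by rewrite wC.
  under [RHS]eq_bigr do under eq_bigr do rewrite mulrAC mulrDl mulrDl.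
  under [RHS]eq_bigr do rewrite big_split/= -!mulr_suml.
  by rewrite big_split/= -!mulr_suml e -splitr.
apply: ler_sum => j _; apply: le_trans (ler_norm_sum _ _ _) _.
apply: ler_sum => l _; case: eqP => [->|/eqP jl].
  by rewrite normr0 mulr_ge0 ?divr_ge0 ?addr_ge0 ?sqr_ge0.
rewrite normrM; apply: ler_pM => //; last exact: mg.
rewrite normrM -(real_normK (num_real (u j))) -(real_normK (num_real (u l))).
have : 0 <= (`|u j| - `|u l|) ^+ 2 by exact: sqr_ge0.
by move: `|u j| `|u l| => x y; rewrite sqrrB => h; rewrite ler_pdivlMr//; lra.
Qed.

End toeplitz.

Section turan.
Context {R : realType}.
Local Notation borel_probability := (probability (measurableTypeR R) R).
Context (mu : borel_probability).

(** A class of functions integrable against every probability measure and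
    closed under sums and products. *)
Definition bounded_measurable (f : R -> R) :=
  measurable_fun setT f /\ exists C, forall x, `|f x| <= C.

Lemma bounded_measurable_integrable f : bounded_measurable f ->
  mu.-integrable setT (EFin \o f).
Proof. by move=> [mf [C fC]]; exact: prob_integrable fC. Qed.

Lemma bounded_measurableD f g : bounded_measurable f -> bounded_measurable g ->
  bounded_measurable (fun x => f x + g x).
Proof.
move=> [mf [C fC]] [mg [D gD]]; split; first exact: measurable_funD.
by exists (C + D) => x; rewrite (le_trans (ler_normD _ _))// lerD.
Qed.

Lemma bounded_measurableM f g : bounded_measurable f -> bounded_measurable g ->
  bounded_measurable (fun x => f x * g x).
Proof.
move=> [mf [C fC]] [mg [D gD]]; split; first exact: measurable_funM.
by exists (C * D) => x; rewrite normrM ler_pM.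
Qed.

Lemma bounded_measurable_cst c : bounded_measurable (fun=> c).
Proof. by split=> //; exists `|c|. Qed.

Lemma bounded_measurable_sum L (f : nat -> R -> R) :
  (forall j, bounded_measurable (f j)) -> bounded_measurable (fun x => \sum_(j < L) f j x).
Proof.
move=> bf; elim: L => [|L ih].
  rewrite (_ : (fun _ => _) = (fun=> 0)); first exact: bounded_measurable_cst.
  by apply/funext => x; rewrite big_ord0.
rewrite (_ : (fun _ => _) = (fun x => \sum_(j < L) f j x + f L x)).
  exact: bounded_measurableD.
by apply/funext => x; rewrite big_ord_recr.
Qed.

Lemma Rintegral_sum_ord L (f : nat -> R -> R) : (forall j, bounded_measurable (f j)) ->
  \int[mu]_x (\sum_(j < L) f j x) = \sum_(j < L) \int[mu]_x f j x.
Proof.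
move=> bf; elim: L => [|L ih].
  rewrite big_ord0 -[RHS](mul0r (fine (mu setT))) -Rintegral_cst//.
  by apply: eq_Rintegral => x _; rewrite big_ord0.
rewrite big_ord_recr/= -ih -RintegralD//.
- by apply: eq_Rintegral => x _; rewrite big_ord_recr.
- by apply: bounded_measurable_integrable; exact: bounded_measurable_sum.
- exact: bounded_measurable_integrable.
Qed.

Lemma RintegralZ_bounded c f : bounded_measurable f ->
  \int[mu]_x (c * f x) = c * \int[mu]_x f x.
Proof. by move=> bf; apply: RintegralZl => //; exact: bounded_measurable_integrable. Qed.

Context (X : R -> R).
Hypothesis (mX : measurable_fun setT X).

Lemma bounded_measurable_cos (b : R) : bounded_measurable (fun x => cos (b * X x)).
Proof.
split; last by exists 1 => x; exact: cos_max.
apply: (@measurableT_comp _ _ _ _ _ _ cos); last exact: measurable_funM.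
by apply: continuous_measurable_fun; exact: continuous_cos.
Qed.

Lemma bounded_measurable_sin (b : R) : bounded_measurable (fun x => sin (b * X x)).
Proof.
split; last by exists 1 => x; exact: sin_max.
apply: (@measurableT_comp _ _ _ _ _ _ sin); last exact: measurable_funM.
by apply: continuous_measurable_fun; exact: continuous_sin.
Qed.

Lemma bounded_measurable_power L (u : nat -> R) :
  bounded_measurable (fun x => csum L u (X x) ^+ 2 + ssum L u (X x) ^+ 2).
Proof.
have bc : bounded_measurable (fun x => csum L u (X x)).
  apply: (@bounded_measurable_sum L (fun j x => u j * cos (j%:R * X x))) => j.
  by apply: bounded_measurableM; [exact: bounded_measurable_cst|exact: bounded_measurable_cos].
have bs : bounded_measurable (fun x => ssum L u (X x)).
  apply: (@bounded_measurable_sum L (fun j x => u j * sin (j%:R * X x))) => j.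
  by apply: bounded_measurableM; [exact: bounded_measurable_cst|exact: bounded_measurable_sin].
exact: bounded_measurableD (bounded_measurableM bc bc) (bounded_measurableM bs bs).
Qed.

(** The integral of |A(X)|^2 is the quadratic form of the matrix of
    Fourier coefficients of the law of X. *)
Lemma Rintegral_power L (u : nat -> R) :
  \int[mu]_x (csum L u (X x) ^+ 2 + ssum L u (X x) ^+ 2) =
  \sum_(j < L) \sum_(l < L) u j * u l * \int[mu]_x cos ((j%:R - l%:R) * X x).
Proof.
have bt j l : bounded_measurable (fun x => u j * u l * cos ((j%:R - l%:R) * X x)).
  by apply: bounded_measurableM; [exact: bounded_measurable_cst|exact: bounded_measurable_cos].
transitivity (\int[mu]_x (\sum_(j < L) \sum_(l < L) u j * u l * cos ((j%:R - l%:R) * X x))).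
  apply: eq_Rintegral => x _; rewrite /csum /ssum !expr2 !big_distrlr/= -big_split/=.
  apply: eq_bigr => j _; rewrite -big_split/=; apply: eq_bigr => l _.
  by rewrite mulrBl cosB; ring.
rewrite (@Rintegral_sum_ord L (fun j x => \sum_(l < L) u j * u l * cos ((j%:R - l%:R) * X x))).
  apply: eq_bigr => j _; rewrite (@Rintegral_sum_ord L (fun l x => u j * u l * cos ((j%:R - l%:R) * X x)))//.
  by apply: eq_bigr => l _; rewrite RintegralZ_bounded//; exact: bounded_measurable_cos.
by move=> j; exact: (bounded_measurable_sum L (bt j)).
Qed.

(** Let A have the coefficients a_j = sin (j th), th = pi/L, and let B have
    their differences b_j as coefficients, so that
    |B(x)|^2 = 2 (1 - cos x) |A(x)|^2. On S one has cos X <= cos (2 th), whence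
    (1 - cos (2 th)) |A(X)|^2 <= |B(X)|^2 / 2. If the Fourier coefficients of the
    law of X are small, integration replaces both sides by their energies up to a
    factor 1 - eta or 1 + eta, and the energy of b is 2 (1 - cos th) times that of
    a. Since 1 - cos (2 th) = 2 (1 - cos th) (1 + cos th) with cos th >= 0, this
    gives 2 (1 - eta) <= 1 + eta, that is eta >= 1/3. *)
Lemma turan_gap L (S : set R) (g : nat -> R) : (1 < L)%N -> measurable S ->
  mu (~` S) = 0%E -> (forall x, S x -> cos (X x) <= cos (2 * (pi / L%:R))) ->
  (forall k, 0 <= g k) -> g 0%N = 0 ->
  (forall j l : nat, j != l ->
    `|\int[mu]_x cos ((j%:R - l%:R) * X x)| <= g (j - l)%N + g (l - j)%N) ->
  1 / 3 <= 2 * \sum_(k < L) g k.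
Proof.
move=> L1 mS muS Scos g0 g00 hg.
have L0 : (0 < L)%N by exact: ltn_trans L1.
have LR : 0 < L%:R :> R by rewrite ltr0n.
pose th : R := pi / L%:R.
pose a j : R := sin (j%:R * th).
pose b j := a j.+1 - a j.
have a0 : a 0%N = 0 by rewrite /a mul0r sin0.
have aL : a L = 0 by rewrite /a /th mulrC divfK ?gt_eqF// sinpi.
pose PA x := csum L a (X x) ^+ 2 + ssum L a (X x) ^+ 2.
pose PB x := csum L b (X x) ^+ 2 + ssum L b (X x) ^+ 2.
have bPA : bounded_measurable PA := bounded_measurable_power L a.
have bPB : bounded_measurable PB := bounded_measurable_power L b.
pose eps := 1 - cos (2 * th).
have F0 : 0 <= \int[mu]_x (1 / 2 * PB x - eps * PA x).
  have [mF [C FC]] : bounded_measurable (fun x => 1 / 2 * PB x + - eps * PA x).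
    by apply: bounded_measurableD; apply: bounded_measurableM => //; exact: bounded_measurable_cst.
  have -> : \int[mu]_x (1 / 2 * PB x - eps * PA x) = \int[mu]_x (1 / 2 * PB x + - eps * PA x).
    by apply: eq_Rintegral => x _; rewrite mulNr.
  rewrite (prob_full_Rintegral mS mF FC muS); apply: Rintegral_ge0 => x Sx.
  rewrite /PB difference_transform// -/(PA x).
  have -> : 1 / 2 * (2 * (1 - cos (X x)) * PA x) + - eps * PA x =
     (cos (2 * th) - cos (X x)) * PA x by rewrite /eps; field.
  by rewrite mulr_ge0 ?subr_ge0 ?Scos// addr_ge0 ?sqr_ge0.
have QF : eps * \int[mu]_x PA x <= 1 / 2 * \int[mu]_x PB x.
  rewrite -subr_ge0 -!RintegralZ_bounded// -RintegralB//; apply: bounded_measurable_integrable;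
  by apply: bounded_measurableM => //; exact: bounded_measurable_cst.
have m1 (j : nat) : \int[mu]_x cos ((j%:R - j%:R) * X x) = 1.
  rewrite (@eq_Rintegral _ _ _ _ _ (fun=> 1)); last by move=> x _; rewrite subrr mul0r cos0.
  by rewrite Rintegral_cst// mul1r -[RHS]/(fine 1%E) -(probability_setT mu).
have := toeplitz_form L a g0 g00 m1 hg; have := toeplitz_form L b g0 g00 m1 hg.
rewrite -!Rintegral_power -/(PA _) -/(PB _).
rewrite (sine_energy L0 : energy L b = _) -/th.
have E0 : 0 < energy L a := sine_energy_gt0 L1.
have th0 : 0 < th by rewrite divr_gt0 ?pi_gt0.
have th2 : th <= pi / 2.
  by rewrite ler_pM2l ?pi_gt0// lef_pV2 ?posrE// ler_nat.
have c0 : 0 <= cos th.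
  by apply: cos_ge0_pihalf; rewrite th2 andbT (le_trans _ (ltW th0))// oppr_le0 divr_ge0 ?pi_ge0.
have c1 : cos th < 1.
  rewrite lt_neqAle cos_le1 andbT; apply/negP => /eqP cth.
  have := cos2Dsin2 th; rewrite cth expr1n => /eqP.
  rewrite -[X in _ == X]addr0 (inj_eq (addrI _)) sqrf_eq0 gt_eqF//.
  apply: sin_gt0_pi; rewrite th0/= (le_lt_trans th2)//.
  by rewrite ltr_pdivrMr// ltr_pMr ?pi_gt0// ltr1n.
have epsE : eps = 2 * (1 - cos th) * (1 + cos th).
  rewrite /eps mulr_natl mulr2n cosD -!expr2.
  by have := cos2Dsin2 th; move: (cos th) (sin th) => c s cs; have -> : s ^+ 2 = 1 - c ^+ 2 by [rewrite -cs; ring]; ring.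
move: QF E0; rewrite epsE; set QA := \int[mu]_x PA x; set QB := \int[mu]_x PB x.
set E := energy L a; set eta := 2 * \sum_(_ < _) _.
move: (cos th) c0 c1 => c c0 c1 QF E0.
rewrite !ler_norml => /andP[_ hB] /andP[hA _].
have eta0 : 0 <= eta by rewrite mulr_ge0// sumr_ge0.
rewrite leNgt; apply/negP => eta3.
have hA' : (1 - eta) * E <= QA by lra.
have hB' : QB <= (1 + eta) * (2 * (1 - c) * E) by lra.
have d0 : 0 < 1 - c by lra.
have e1 : 2 * (1 - c) * ((1 - eta) * E) <= 2 * (1 - c) * (1 + c) * QA.
  rewrite -!mulrA ler_pM2l// ler_pM2l//; apply: (le_trans hA').
  rewrite ler_peMl//; last by lra.
  by apply: le_trans hA'; rewrite mulr_ge0 ?ltW//; lra.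
have : 2 * (1 - c) * ((1 - eta) * E) <= 1 / 2 * ((1 + eta) * (2 * (1 - c) * E)).
  by apply: le_trans e1 _; apply: le_trans QF _; rewrite ler_pM2l//; lra.
have -> : 1 / 2 * ((1 + eta) * (2 * (1 - c) * E)) = (1 - c) * E * (1 + eta) by field.
have -> : 2 * (1 - c) * ((1 - eta) * E) = (1 - c) * E * (2 * (1 - eta)) by ring.
by rewrite ler_pM2l ?mulr_gt0//; lra.
Qed.

End turan.

(** * Upper bound for the Fourier dimension of the block sets *)

Section block_fourier_upper.
Context {R : realType}.
Local Notation borel_probability := (probability (measurableTypeR R) R).
Implicit Types (m d k L : nat).

(** The phase is chosen such that the arc omitted by the fractional part of
    2^m y, namely [0, 2^(-d)), is centred at the angle 0. *)
Lemma keep_cos m d (y : R) : keep m d y ->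
  cos (2 * pi * 2 ^+ m * y - pi * 2 ^- d) <= cos (2 * (pi / (2 ^ d.+1)%:R)).
Proof.
move=> [a /andP[ay ya]].
have -> : 2 * (pi / (2 ^ d.+1)%:R) = pi * 2 ^- d :> R.
  by rewrite natrX exprS invfM; field; rewrite expf_neq0.
have -> : 2 * pi * 2 ^+ m * y - pi * 2 ^- d =
    (2 * pi * (2 ^+ m * y - a%:R) - pi * 2 ^- d) + pi *+ 2 *+ a :> R.
  by rewrite -[pi *+ 2 *+ a]mulr_natr -[pi *+ 2]mulr_natr; ring.
rewrite (periodicn (@cosD2pi R)).
have p0 : 0 < pi :> R by exact: pi_gt0.
have d0 : 0 < 2 ^- d :> R by rewrite invr_gt0 exprn_gt0.
move: ya; rewrite -[a.+1%:R]natr1 => ya.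
apply: cos_gap.
  apply/andP; split; first by rewrite mulr_ge0 ?ltW.
  rewrite -subr_ge0; set Y := 2 ^+ m * y in ay ya *; set e := 2 ^- d in ay ya *.
  have -> : 2 * pi * (Y - a%:R) - pi * e - pi * e = 2 * pi * (Y - a%:R - e) by ring.
  by apply: mulr_ge0; [rewrite mulr_ge0 ?ltW|lra].
rewrite lerD2r -[leRHS]mulr1 ler_pM2l ?mulr_gt0//; lra.
Qed.

(** For s = 1/2 the terms k^(-1/2) are at most 2 (sqrt k - sqrt (k-1)), and
    the sum telescopes; for smaller s the terms are at most L^(1/2 - s)
    k^(-1/2). *)
Lemma sum_powR_le L (s : R) : 0 <= s <= 1 / 2 ->
  \sum_(k < L) (if k == 0%N :> nat then 0 else k%:R `^ (- s)) <= 2 * L%:R `^ (1 - s).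
Proof.
move=> /andP[s0 s12]; case: L => [|L].
  by rewrite big_ord0 mulr_ge0 ?powR_ge0.
have LR : 0 < L.+1%:R :> R by rewrite ltr0n.
pose c : R := L.+1%:R `^ (1 / 2 - s).
have c0 : 0 <= c by exact: powR_ge0.
suff h K : (K <= L)%N -> \sum_(k < K.+1) (if k == 0%N :> nat then 0 else k%:R `^ (- s)) <=
    2 * c * Num.sqrt (K%:R : R).
  apply: le_trans (h L (leqnn L)) _; rewrite -mulrA ler_pM2l//.
  have -> : L.+1%:R `^ (1 - s) = c * Num.sqrt (L.+1%:R : R).
    rewrite -powR12_sqrt ?ler0n// -powRD; first by congr (_ `^ _); lra.
    by rewrite pnatr_eq0 implybT.
  by rewrite ler_wpM2l// ler_sqrt// ler_nat.
elim: K => [_|K ih KL].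
  by rewrite big_ord_recr big_ord0/= add0r mulr_ge0 ?sqrtr_ge0// mulr_ge0.
rewrite big_ord_recr/=; apply: le_trans (lerD (ih (ltnW KL)) (lexx _)) _.
rewrite addrC -lerBrDr -mulrBr.
set a := Num.sqrt (K.+1%:R : R); set b := Num.sqrt (K%:R : R).
have a0 : 0 < a by rewrite sqrtr_gt0 ltr0n.
have ab : a ^+ 2 = b ^+ 2 + 1 by rewrite !sqr_sqrtr ?ler0n// natr1.
have -> : K.+1%:R `^ (- s) = a^-1 * K.+1%:R `^ (1 / 2 - s) :> R.
  rewrite /a -powR12_sqrt ?ler0n// -powRN -powRD.
    by congr (_ `^ _); lra.
  by rewrite pnatr_eq0 implybT.
apply: (@le_trans _ _ (a^-1 * c)).
  rewrite /c; apply: ler_wpM2l; first by rewrite invr_ge0 ltW.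
  apply: ge0_ler_powR.
  - lra.
  - by rewrite nnegrE ler0n.
  - by rewrite nnegrE ler0n.
  - by rewrite ler_nat ltnW.
rewrite [2 * c]mulrC -mulrA [leLHS]mulrC ler_wpM2l//.
rewrite -[a^-1]mul1r ler_pdivrMr//.
have : 0 <= (a - b) ^+ 2 by exact: sqr_ge0.
by rewrite sqrrB -mulr_natl; move: ab; rewrite !expr2 => ? ?; lra.
Qed.

Lemma fourier_decay_integrals (mu : borel_probability) s C (xi : R) : 0 < C ->
  fourier_decay mu s C -> xi != 0 ->
  `|\int[mu]_y cos (xi * y)| <= C * `|xi| `^ (- (s / 2)) /\
  `|\int[mu]_y sin (xi * y)| <= C * `|xi| `^ (- (s / 2)).
Proof.
move=> C0 dec xi0; have b0 : 0 <= C * `|xi| `^ (- (s / 2)) by rewrite mulr_ge0 ?powR_ge0// ltW.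
have /fourier_leP := dec xi xi0; move=> /(_ b0); set b := C * _.
move=> h; have sq (a c : R) : a ^+ 2 + c ^+ 2 <= b ^+ 2 -> `|a| <= b.
  move=> ac; rewrite -(ler_pXn2r (ltn0Sn 1)) ?nnegrE// real_normK ?num_real//.
  by apply: le_trans ac; rewrite lerDl sqr_ge0.
by split; [exact: sq h|apply: sq; rewrite addrC; exact: h].
Qed.

(** [turan_gap] for the law of X = 2 pi 2^m y - pi 2^(-d), with
    L = 2^(d+1): its k-th Fourier coefficient is a rotation of the transform of
    mu at 2 pi 2^m k, and the sum over k < L of (2^m k)^(-s/2) is of the order of
    2^(d (1 - s/2) - m s/2). *)
Lemma decay_gap m d (mu : borel_probability) (s C : R) : 0 <= s <= 1 -> 0 < C ->
  fourier_decay mu s C -> mu (~` [set y | cos (2 * pi * 2 ^+ m * y - pi * 2 ^- d) <=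
     cos (2 * (pi / (2 ^ d.+1)%:R))]) = 0%E ->
  1 / 3 <= 16 * C * 2 `^ (d%:R * (1 - s / 2) - m%:R * (s / 2)).
Proof.
move=> /andP[s0 s1] C0 dec muS.
pose t := s / 2; have t01 : 0 <= t <= 1 / 2 by rewrite /t; apply/andP; split; lra.
have p0 : 0 < pi :> R by exact: pi_gt0.
pose N : R := 2 ^+ m; have N0 : 0 < N by rewrite exprn_gt0.
pose X (y : R) : R := 2 * pi * N * y - pi * 2 ^- d.
have cX : continuous X.
  move=> y; apply: cvgB; last exact: cvg_cst.
  exact: mulrl_continuous.
have mX : measurable_fun setT X by exact: continuous_measurable_fun.
pose L := (2 ^ d.+1)%N.
have L1 : (1 < L)%N by rewrite -{1}(expn0 2) ltn_exp2l.
pose q (k : nat) : R := if k == 0%N then 0 else k%:R `^ (- t).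
have q0 k : 0 <= q k by rewrite /q; case: ifP => // _; exact: powR_ge0.
(* Twice the decay at frequency N k: the rotated coefficient has a cosine part
   and a sine part. *)
pose g (k : nat) : R := 2 * C * N `^ (- t) * q k.
have g0 k : 0 <= g k by rewrite mulr_ge0// mulr_ge0 ?powR_ge0// mulr_ge0// ltW.
have g00 : g 0%N = 0 by rewrite /g /q eqxx mulr0.
have gk k : k != 0%N -> `|\int[mu]_y cos (k%:R * X y)| <= g k.
  move=> k0; have kR : 0 < k%:R :> R by rewrite ltr0n lt0n.
  pose xi := k%:R * (2 * pi * N); have xi0 : 0 < xi by rewrite !mulr_gt0.
  have [hc hs] := fourier_decay_integrals C0 dec (lt0r_neq0 xi0).
  pose ph := k%:R * (pi * 2 ^- d) : R.
  have bc : bounded_measurable (fun y => cos (xi * y)).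
    by split; [exact: lip_measurable (cos_lip xi)|exists 1 => y; exact: cos_max].
  have bs : bounded_measurable (fun y => sin (xi * y)).
    by split; [exact: lip_measurable (sin_lip xi)|exists 1 => y; exact: sin_max].
  have -> : \int[mu]_y cos (k%:R * X y) =
      cos ph * \int[mu]_y cos (xi * y) + sin ph * \int[mu]_y sin (xi * y).
    rewrite -!RintegralZ_bounded// -RintegralD//; last 2 first.
    - apply: bounded_measurable_integrable; apply: bounded_measurableM => //.
      exact: bounded_measurable_cst.
    - apply: bounded_measurable_integrable; apply: bounded_measurableM => //.
      exact: bounded_measurable_cst.
    apply: eq_Rintegral => y _; rewrite /X mulrBr mulrA -/xi -/ph cosB; ring.
  have gE : g k = C * (N * k%:R) `^ (- t) + C * (N * k%:R) `^ (- t).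
    rewrite /g /q (negbTE k0) powRM ?ler0n ?(ltW N0)//; ring.
  have xiN : C * `|xi| `^ (- t) <= C * (N * k%:R) `^ (- t).
    rewrite ler_pM2l// gtr0_norm// !powRN lef_pV2 ?posrE ?powR_gt0 ?mulr_gt0//.
    apply: ge0_ler_powR; first by case/andP: t01.
    - by rewrite nnegrE mulr_ge0// ltW.
    - by rewrite nnegrE ltW.
    rewrite /xi [leLHS]mulrC ler_pM2l// ler_peMl ?(ltW N0)//.
    by have := pi_ge2 R; lra.
  rewrite gE (le_trans (ler_normD _ _))// lerD// normrM.
    by rewrite -[leRHS]mul1r ler_pM ?cos_max// (le_trans hc).
  by rewrite -[leRHS]mul1r ler_pM ?sin_max// (le_trans hs).
have hg (j l : nat) : j != l ->
    `|\int[mu]_y cos ((j%:R - l%:R) * X y)| <= g (j - l)%N + g (l - j)%N.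
  rewrite neq_ltn => /orP[jl|lj].
    have -> : \int[mu]_y cos ((j%:R - l%:R) * X y) = \int[mu]_y cos ((l - j)%N%:R * X y).
      by apply: eq_Rintegral => y _; rewrite natrB ?(ltnW jl)// -opprB mulNr cosN.
    rewrite (eqP (ltnW jl : (j - l)%N == 0%N)) g00 add0r; apply: gk.
    by rewrite subn_eq0 -ltnNge.
  rewrite (eqP (ltnW lj : (l - j)%N == 0%N)) g00 addr0 -natrB ?(ltnW lj)//; apply: gk.
  by rewrite subn_eq0 -ltnNge.
have mS : measurable [set y | cos (X y) <= cos (2 * (pi / L%:R))].
  apply: measurable_realfun.closed_measurable.
  apply: (@closed_comp _ _ (fun y => cos (X y)) [set z | z <= cos (2 * (pi / L%:R))]).
    by move=> y _; apply: continuous_comp; [exact: cX|exact: continuous_cos].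
  exact: closed_le.
have := turan_gap mX L1 mS muS (fun x Sx => Sx) g0 g00 hg.
move=> /le_trans; apply.
rewrite /g -mulr_sumr.
have qs : \sum_(k < L) q k <= 2 * L%:R `^ (1 - t) := sum_powR_le L t01.
apply: (@le_trans _ _ (2 * (2 * C * N `^ (- t) * (2 * L%:R `^ (1 - t))))).
  by rewrite ler_pM2l// ler_wpM2l// !mulr_ge0 ?powR_ge0 ?ltW.
have -> : N `^ (- t) = 2 `^ (- (m%:R * t)).
  by rewrite /N -powR_mulrn// -powRrM mulrN.
have LE : L%:R `^ (1 - t) <= 2 * 2 `^ (d%:R * (1 - t)).
  rewrite /L natrX -powR_mulrn// -powRrM -[d.+1%:R]natr1 mulrDl mul1r powRD ?pnatr_eq0 ?implybT//.
  rewrite mulrC ler_wpM2r ?powR_ge0// -[leRHS]powRr1// ler_powR ?ler1n//.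
  by case/andP: t01; lra.
rewrite -/t (_ : 2 `^ (d%:R * (1 - t) - m%:R * t) =
    2 `^ (d%:R * (1 - t)) * 2 `^ (- (m%:R * t))); last first.
  by rewrite -powRD// pnatr_eq0 implybT.
set A := 2 `^ (- (m%:R * t)); set B := 2 `^ (d%:R * (1 - t)) in LE *.
set D := L%:R `^ (1 - t) in LE *.
have A0 : 0 <= A by exact: powR_ge0.
have -> : 2 * (2 * C * A * (2 * D)) = 8 * C * A * D by ring.
have -> : 16 * C * (B * A) = 8 * C * A * (2 * B) by ring.
by rewrite ler_wpM2l// mulr_ge0// mulr_ge0// ltW.
Qed.

(** For a decay exponent s > 2 tau / (1 + tau), the exponent
    d_j (1 - s/2) - n_j s/2 of [decay_gap] is at most - kap n_j for infinitely
    many j, where kap = s/2 - (1 - s/2) tau > 0; this contradicts the lower bound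
    1/3. *)
Lemma block_fourier_dim_le (n d : nat -> nat) (tau : R) : 0 <= tau < 1 ->
  (forall j, (j <= n j)%N) ->
  (forall J, exists2 j, (J <= j)%N & (d j)%:R <= tau * (n j)%:R) ->
  fourier_dim (block_closure n d : set R) <= 2 * tau / (1 + tau).
Proof.
move=> /andP[tau0 tau1] nj dj; rewrite leNgt; apply/negP => hdim.
have q0 : 0 <= 2 * tau / (1 + tau) by rewrite divr_ge0 ?mulr_ge0 ?addr_ge0.
have [s /andP[qs s1] [mu [C [C0 muE dec]]]] := fourier_dim_gt q0 hdim.
have s0 : 0 <= s by exact: le_trans q0 (ltW qs).
pose kap := s / 2 - (1 - s / 2) * tau.
have kap0 : 0 < kap.
  by move: qs; rewrite ltr_pdivrMr /kap => [h|]; lra.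
pose q := (Num.truncn kap^-1).+1.
have qk : 1 <= q%:R * kap.
  by rewrite -ler_pdivrMr// div1r ltW// truncnS_gt.
(* With n_j >= j >= q i the exponent is at most - i, and 16 C 2^(-i) < 1/3. *)
pose i := (Num.truncn (48 * C)).+1.
have [j Jj djt] := dj (q * i)%N.
have supp : mu (~` [set y | cos (2 * pi * 2 ^+ n j * y - pi * 2 ^- d j) <=
     cos (2 * (pi / (2 ^ (d j).+1)%:R))]) = 0%E.
  have cS : closed [set y : R | cos (2 * pi * 2 ^+ n j * y - pi * 2 ^- d j) <=
      cos (2 * (pi / (2 ^ (d j).+1)%:R))].
    apply: (@closed_comp _ _ (fun y => cos (2 * pi * 2 ^+ n j * y - pi * 2 ^- d j))
        [set z | z <= cos (2 * (pi / (2 ^ (d j).+1)%:R))]); last exact: closed_le.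
    move=> y _; apply: continuous_comp; last exact: continuous_cos.
    by apply: cvgB; [exact: mulrl_continuous|exact: cvg_cst].
  apply: closed_msupport_null => //; apply: (subset_trans muE).
  rewrite /block_closure [X in _ `<=` X]((closure_id _).1 cS); apply: closure_subset.
  by move=> z [_ /(_ j)]; exact: keep_cos.
have := decay_gap (introT andP (conj s0 s1)) C0 dec supp.
apply/negP; rewrite -ltNge.
have e_le : (d j)%:R * (1 - s / 2) - (n j)%:R * (s / 2) <= - i%:R.
  apply: (@le_trans _ _ (- (kap * (n j)%:R))).
    have : (d j)%:R * (1 - s / 2) <= tau * (n j)%:R * (1 - s / 2) by apply: ler_wpM2r => //; lra.
    by rewrite /kap => h; lra.
  rewrite lerN2; apply: (@le_trans _ _ (q%:R * kap * i%:R)).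
    by rewrite ler_peMl.
  rewrite mulrAC mulrC ler_pM2l// -natrM ler_nat.
  exact: leq_trans (nj j).
apply: (@le_lt_trans _ _ (16 * C * (2 ^+ i)^-1)).
  rewrite ler_pM2l ?mulr_gt0//.
  apply: (@le_trans _ _ (2 `^ (- i%:R))); first by rewrite ler_powR// ler1n.
  by rewrite powRN powR_mulrn.
rewrite ltr_pdivrMr ?exprn_gt0//.
have : i%:R < 2 ^+ i :> R by rewrite -natrX ltr_nat ltn_expl.
have : 48 * C < i%:R by exact: truncnS_gt.
by move: (_ ^+ i) i%:R => a b; lra.
Qed.

End block_fourier_upper.

(** * Completeness *)

Section schedule.

(** Doubling leaves room for a block of length at most n_j before the next
    one starts; the exponent j + 3 starts high enough for blocks of length at
    least j + 3. *)
Definition level (j : nat) : nat := 2 ^ (j + 3).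

(** The proportion 1 - 2^(-r_j - 1) of the available positions: it is at least
    1/2, tends to 1 when r_j tends to infinity, and is bounded away from 1 when
    r_j is bounded. *)
Definition width (r : nat -> nat) (j : nat) : nat := level j - level j %/ 2 ^ (r j).+1.

Lemma levelS j : level j.+1 = (2 * level j)%N.
Proof. by rewrite /level addSn expnS. Qed.

Lemma level_sqr j : (j * j + 2 * j + 3 <= level j)%N.
Proof. by elim: j => // j; rewrite levelS; lia. Qed.

Lemma level_half r j : (2 * (level j %/ 2 ^ (r j).+1) <= level j)%N.
Proof.
rewrite mulnC -leq_divRL// leq_div2l// -[X in (X <= _)%N]expn1 leq_exp2l//.
Qed.

Lemma width_le r j : (width r j <= level j)%N.
Proof. exact: leq_subr. Qed.

Lemma level_le_width r j : (level j <= 2 * width r j)%N.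
Proof. by rewrite /width; have := level_half r j; lia. Qed.

Lemma width_gt1 r j : (1 < width r j)%N.
Proof. by have := level_le_width r j; have := level_sqr j; lia. Qed.

Lemma width_ge r j : (j + 3 <= width r j)%N.
Proof.
have : (2 * (j + 3) <= level j)%N by elim: j => // j; rewrite levelS; lia.
by have := level_le_width r j; lia.
Qed.

Lemma level_width r j : (level j + width r j <= level j.+1)%N.
Proof. by rewrite levelS; have := width_le r j; lia. Qed.

Lemma level_ge_id j : (j <= level j)%N.
Proof. by have := level_sqr j; lia. Qed.

End schedule.

Section dimension_dichotomy.
Context {R : realType}.
Implicit Types r : nat -> nat.

(** The Hausdorff dimension is 1 for every r: only the Fourier dimension
    depends on it. *)
Lemma block_hausdorff_dim r : hausdorff_dim (block_closure level (width r) : set R) = 1.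
Proof.
have nd := level_width r.
rewrite -trace_block_compact; apply: lebesgue_gt0_hausdorff_dim.
- exact: compact_trace.
- by rewrite trace_block_compact; exact: block_closure_unit.
rewrite trace_block_compact.
apply: (@lt_le_trans _ _ (3 / 4 : R)%:E); first by rewrite lte_fin.
apply: (le_trans (@lebesgue_block_set_ge R level (width r) nd (width_ge r))).
apply: le_measure; [apply/mem_set; exact: measurable_block_set|apply/mem_set|exact: subset_closure].
by apply: closed_measurable; exact: closed_closure.
Qed.

(** Here d_j >= (1 - k) n_j for every k > 0 and j large, and
    [block_fourier_dim_ge] applies to every t < 1/2. *)
Lemma fourier_dim_limit r :
  (forall m, exists J, forall j, (J <= j)%N -> (m <= r j)%N) ->
  fourier_dim (block_closure level (width r) : set R) = 1.
Proof.
move=> rinf; apply/eqP; rewrite eq_le fourier_dim_le1/= leNgt; apply/negP => fd1.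
set fd := fourier_dim _ in fd1.
have fd0 : 0 <= fd by exact: fourier_dim_ge0.
(* If fd were below 1, then 2 t = (fd + 1)/2 would be a larger lower bound. *)
pose t : R := (fd + 1) / 4.
have t0 : 0 <= t <= 1 / 2 by rewrite /t; apply/andP; split; lra.
suff : 2 * t <= fd by rewrite /t; lra.
apply: block_fourier_dim_ge => //; [exact: level_width|exact: width_ge|].
have t1 : 0 <= 1 - t by lra.
pose k : R := (1 - 2 * t) / 2.
have k0 : 0 < k by rewrite /k /t; lra.
pose m := Num.truncn k^-1.
have mk : 2 ^- m.+1 <= k.
  rewrite invf_ple ?posrE ?exprn_gt0//; apply: le_trans (ltW (truncnS_gt _)) _.
  by rewrite -natrX ler_nat ltnW// ltn_expl.
have [J hJ] := rinf m; exists (maxn J m.+1) => j; rewrite geq_max => /andP[/hJ mr mj].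
have nk : j%:R <= (level j)%:R * k.
  apply: (@le_trans _ _ (j%:R * (j%:R * k))).
    rewrite ler_peMr// -ler_pdivrMr// div1r; apply: le_trans (ltW (truncnS_gt _)) _.
    by rewrite ler_nat.
  by rewrite mulrA ler_pM2r// -natrM ler_nat; have := level_sqr j; lia.
have dn : (level j)%:R * (1 - k) <= (width r j)%:R :> R.
  rewrite /width natrB ?leq_div// mulrBr mulr1 lerD2l lerN2.
  apply: (@le_trans _ _ ((level j)%:R * 2 ^- m.+1)); last by rewrite ler_wpM2l.
  rewrite ler_pdivlMr ?exprn_gt0// -natrX -natrM ler_nat.
  apply: leq_trans _ (leq_trunc_div (level j) (2 ^ (r j).+1)).
  by rewrite leq_mul2l leq_exp2l// ltnS mr orbT.
apply: le_trans (ler_wpM2r t1 dn) => {dn mj mr}.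
have n0 : 0 <= (level j)%:R :> R by [].
move: nk n0; rewrite /k; move: (level j)%:R (j%:R) => n x nk n0 {mk}.
have : 0 <= n * (1 - 2 * t) * t by rewrite mulr_ge0 ?mulr_ge0//; lra.
by nra.
Qed.

(** When r_j < m, the ratio d_j / n_j is at most 1 - 2^(-m). *)
Lemma fourier_dim_bounded r m :
  (forall J, exists2 j, (J <= j)%N & (r j < m)%N) ->
  fourier_dim (block_closure level (width r) : set R) < 1.
Proof.
move=> rm; pose tau : R := 1 - 2 ^- m.
have p0 : 0 < 2 ^- m :> R by rewrite invr_gt0 exprn_gt0.
have p1 : 2 ^- m <= 1 :> R := invpow2_le1 m.
have tau01 : 0 <= tau < 1 by rewrite /tau; apply/andP; split; lra.
apply: (@le_lt_trans _ _ (2 * tau / (1 + tau))); last first.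
  by rewrite ltr_pdivrMr; lra.
apply: block_fourier_dim_le => //; first exact: level_ge_id.
move=> J; have [j] := rm (maxn J m); rewrite geq_max => /andP[Jj mj] rj; exists j => //.
rewrite /width natrB ?leq_div// /tau mulrBl mul1r lerD2l lerN2.
have -> : 2 ^- m * (level j)%:R = (level j %/ 2 ^ m)%:R :> R.
  have -> : level j = (2 ^ (j + 3 - m) * 2 ^ m)%N by rewrite -expnD subnK//; lia.
  by rewrite mulnK ?expn_gt0// natrM (natrX _ 2 m) mulrCA mulVf ?mulr1// expf_neq0.
by rewrite ler_nat leq_div2l ?expn_gt0// leq_exp2l.
Qed.

Lemma salem_block_closureP r : salem (block_closure level (width r) : set R) <->
  (forall m, exists J, forall j, (J <= j)%N -> (m <= r j)%N).
Proof.
rewrite /salem block_hausdorff_dim; split=> [fd1 m|/fourier_dim_limit ->//].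
apply: contrapT => nJ.
have : fourier_dim (block_closure level (width r) : set R) < 1.
  apply: (@fourier_dim_bounded _ m) => J; apply: contrapT => nj; apply: nJ.
  exists J => j Jj; rewrite leqNgt; apply/negP => rj; apply: nj; by exists j.
by rewrite -fd1 ltxx.
Qed.

End dimension_dichotomy.

Theorem theorem3p9 (R : realType) :
  complete R (Pi0 3)
    [set A : compacts (set_type `[0 : R, 1 : R]) | salem (set_val @` A)].
Proof.
split; last exact: Pi03_salem.
move=> X polishX clopenX A PA.
have [r [rc rA]] := Pi03_limit polishX clopenX PA.
exists (fun x => block_compact level (width (r^~ x))).
  apply: block_compact_continuous => x j; [exact: width_gt1|exact: level_width|].
  by apply: filterS (rc j x) => y ryx; rewrite /width ryx.
move=> x; rewrite rA /= -/(trace (block_compact level (width (r^~ x)))).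
by rewrite trace_block_compact; split=> /salem_block_closureP.
Qed.
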